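(* Let $\omega_0\in H^4(\mathbb{T}\times(0,1))$ satisfy the local Rayleigh condition, and let $\omega\in C([0,T];H^4(\mathbb{T}\times(0,1)))$ be the solution to the hydrostatic Euler equations in vorticity form with initial datum $\omega_0$ that satisfies the local Rayleigh condition in $[0,T]$. Set $$E_1(t)=\int_{\mathbb{T}\times(0,1)}\left(\frac{\omega\omega_x}{\omega_y}-u_x\right)dxdy=\int_{\mathbb{T}\times(0,1)}\frac{\omega\omega_x}{\omega_y}\,dxdy$$ and $$E_2(t)=\int_{\mathbb{T}\times(0,1)}\left(u^2\left(\frac{\omega\omega_x}{\omega_y}-u_x\right)-uP_x\right)dxdy=\int_{\mathbb{T}\times(0,1)}u^2\frac{\omega\omega_x}{\omega_y}\,dxdy.$$ Then, for $0\le t<T$, $$E_1=\partial_t\int_{\mathbb{T}\times(0,1)}\log\left(\frac{1}{\omega_y}\right)dxdy,$$ $$\partial_tE_1=\int_{\mathbb{T}\times(0,1)}\left|u_x-\frac{\omega\omega_x}{\omega_y}\right|^2dxdy,$$ $$\partial_tE_2=\int_{\mathbb{T}\times(0,1)}\left|P_x+u\left(u_x-\frac{\omega\omega_x}{\omega_y}\right)\right|^2dxdy.$$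
   Context: $\mathbb{T}=\mathbb{R}/\mathbb{Z}$ is the torus of length one; points of $\mathbb{T}\times(0,1)$ are written $(x,y)$. The hydrostatic Euler equations in vorticity form are $$\omega_t+u\omega_x+v\omega_y=0,\qquad (u,v)=(-\partial_y\mathcal{A}(\omega),\partial_x\mathcal{A}(\omega)),\qquad \omega|_{t=0}=\omega_0,$$ where the stream function $\mathcal{A}(\omega)$ solves $-\partial_y^2\mathcal{A}(\omega)=\omega$, $\mathcal{A}(\omega)|_{y=0,1}=0$. Thus $u_y=\omega$, $u_x+v_y=0$, $v|_{y=0,1}=0$, $\int_0^1u\,dy=0$ (standing normalization), and there is a pressure $P=P(x,t)$, independent of $y$, with $u_t+uu_x+vu_y+P_x=0$. The local Rayleigh condition for $\omega$ is $\partial_y\omega>0$, understood on the closed channel $\mathbb{T}\times[0,1]$ (so that $1/\omega_y$ is bounded). *)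

(* Defs.v *)
From mathcomp Require Import all_boot all_order all_algebra.
From mathcomp Require Import all_classical all_reals all_analysis.
Import Order.TTheory GRing.Theory Num.Theory.
Import numFieldNormedType.Exports.

Set Implicit Arguments.
Unset Strict Implicit.
Unset Printing Implicit Defensive.

Local Open Scope classical_set_scope.
Local Open Scope ring_scope.

(* A function on T x [0,1], T = R/Z, is a function on R * R that is 1-periodic
   in its first variable; only its values on the strip R x [0,1] matter.
   Integrals over T x (0,1) are taken over the fundamental cell
   [0,1) x (0,1).  An element of H^4(T x (0,1)) has a unique representative
   that is continuous on T x [0,1] (of class C^2, by Sobolev embedding); the
   pointwise derivatives dx, dy below are those of that representative, whereas
   membership in H^k and its norm are defined by weak derivatives. *)

Section Derivatives.
Context {R : realType} {V : normedModType R}.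
Implicit Types (S : set V) (f : V -> R) (a v : V).

(* Directional derivatives relative to a set S, i.e. with increments h such
   that a + h v stays in S: two-sided derivatives in the interior, one-sided
   ones at the boundary. *)
Definition quotient_in S f a v : set_system R :=
  h^-1 * (f (a + h *: v) - f a)
    @[h --> within [set h : R | S (a + h *: v)] (0 : R)^'].

Definition derivable_in S f a v : Prop := cvg (quotient_in S f a v).

Definition derive_in S f a v : R := lim (quotient_in S f a v).

End Derivatives.

Section Channel.
Context {R : realType}.
Implicit Types (f g phi : R * R -> R) (z : R * R).

Definition channel : set (R * R) := [set z | 0 <= z.2 <= 1].
Definition open_channel : set (R * R) := [set z | 0 < z.2 < 1].

Definition cell : set (R * R) := `[0, 1[ `*` `]0, 1[.

Local Notation lebesgue2 := (lebesgue_measure \x lebesgue_measure)%E.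

Definition integral2 f : R :=
  \int[lebesgue2]_(z in cell) f z.

Definition periodic_x f : Prop :=
  forall z, channel z -> f (z.1 + 1, z.2) = f z.

Definition dx f z : R := derive_in channel f z (1, 0).
Definition dy f z : R := derive_in channel f z (0, 1).

Definition partial_x phi : R * R -> R := 'D_(1, 0) phi.
Definition partial_y phi : R * R -> R := 'D_(0, 1) phi.

Fixpoint Ck (k : nat) phi : Prop :=
  continuous phi /\
  if k is k'.+1 then
    [/\ forall z, derivable phi z (1, 0), forall z, derivable phi z (0, 1),
        Ck k' (partial_x phi) & Ck k' (partial_y phi)]
  else True.

(* C_c^oo(T x (0,1)), extended by zero outside the strip *)
Definition test_function phi : Prop :=
  [/\ forall k, Ck k phi, periodic_x phi &
      exists2 d : R, 0 < d & forall z, phi z != 0 -> d <= z.2 <= 1 - d].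

Definition L2 f : Prop :=
  measurable_fun (cell : set (measurableTypeR R * measurableTypeR R)) f /\
  lebesgue2.-integrable cell
    (fun z => ((f z) ^+ 2)%:E).

Definition weak_derivative (a b : nat) f g : Prop :=
  forall phi, test_function phi ->
    integral2 (fun z => f z * iter b partial_y (iter a partial_x phi) z)
    = (-1) ^+ (a + b) * integral2 (fun z => g z * phi z).

(* H^k(T x (0,1)) *)
Definition sobolev (k : nat) f : Prop :=
  [/\ periodic_x f, L2 f &
      forall a b, (a + b <= k)%N -> exists2 g, L2 g & weak_derivative a b f g].

(* The weak derivative is unique up to null sets; pick a representative
   (meaningful only when one exists, e.g. if f is in H^k, a + b <= k). *)
Definition wD (a b : nat) f : R * R -> R :=
  get [set g | L2 g /\ weak_derivative a b f g].

Definition sobolev_norm (k : nat) f : R :=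
  Num.sqrt (\sum_(a < k.+1) \sum_(b < k.+1 | (a + b <= k)%N)
              integral2 (fun z => (wD a b f z) ^+ 2)).

(* C([0,T]; H^k(T x (0,1))) *)
Definition C0_sobolev (k : nat) (T : R) (w : R -> R * R -> R) : Prop :=
  (forall t, 0 <= t <= T -> sobolev k (w t)) /\
  (forall t, 0 <= t <= T ->
     sobolev_norm k (fun z => w s z - w t z)
       @[s --> within `[0, T] (nbhs t)] --> (0 : R)).

Definition local_rayleigh f : Prop := forall z, channel z -> 0 < dy f z.

(* A = A(w): the solution of - d_y^2 A = w, A = 0 at y = 0, 1 *)
Definition is_stream w (A : R * R -> R) : Prop :=
  (forall z, channel z ->
     [/\ derivable_in channel A z (0, 1),
         derivable_in channel (dy A) z (0, 1) & - dy (dy A) z = w z]) /\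
  (forall x, A (x, 0) = 0 /\ A (x, 1) = 0).

Definition vel_u (A : R -> R * R -> R) (t : R) z : R := - dy (A t) z.
Definition vel_v (A : R -> R * R -> R) (t : R) z : R := dx (A t) z.

(* time derivatives on [0,T], one-sided at the end points *)
Definition derivable_t (T : R) (F : R -> R) (t : R) : Prop :=
  derivable_in `[0, T] F t 1.
Definition dt (T : R) (F : R -> R) (t : R) : R := derive_in `[0, T] F t 1.

Definition hydrostatic_euler (T : R) (w0 : R * R -> R)
    (w A : R -> R * R -> R) : Prop :=
  [/\ forall t, 0 <= t <= T -> is_stream (w t) (A t),
      forall t z, 0 <= t <= T -> open_channel z ->
        derivable_t T (fun s => w s z) t /\
        dt T (fun s => w s z) t
          + vel_u A t z * dx (w t) z + vel_v A t z * dy (w t) z = 0 &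
      forall z, channel z -> w 0 z = w0 z].

Definition is_pressure (T : R) (A : R -> R * R -> R) (P : R -> R -> R) : Prop :=
  forall t, 0 <= t <= T ->
  [/\ forall x, P t (x + 1) = P t x,
      forall x, derivable (P t) x 1 &
      forall z, open_channel z ->
        derivable_t T (fun s => vel_u A s z) t /\
        dt T (fun s => vel_u A s z) t
          + vel_u A t z * dx (vel_u A t) z + vel_v A t z * dy (vel_u A t) z
          + derive1 (P t) z.1 = 0].

Definition E1 (w A : R -> R * R -> R) (t : R) : R :=
  integral2 (fun z => w t z * dx (w t) z / dy (w t) z - dx (vel_u A t) z).

Definition E2 (w A : R -> R * R -> R) (P : R -> R -> R) (t : R) : R :=
  integral2 (fun z =>
    (vel_u A t z) ^+ 2
      * (w t z * dx (w t) z / dy (w t) z - dx (vel_u A t) z)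
    - vel_u A t z * derive1 (P t) z.1).

End Channel.

(* Main.v *)
(** The analytic core is a set of pointwise identities.  Write [a] for
    [w w_x / w_y]; then
      [d_t (- ln w_y) = a - u_x + d_x (u ln w_y) + d_y (v ln w_y)],
      [d_t a = (u_x - a)^2 - d_x (u a + u u_x) - d_y (v a + u v_x)],
      [d_t (u^2 a) = (P_x + u (u_x - a))^2 - (P_x^2 + 2 P_x u u_x)
         - d_x (u^3 a + u^3 u_x / 3) - d_y (u^2 v a + u^3 v_x / 3)],
    and the divergences integrate to zero by periodicity and [v = v_x = 0] on
    the boundary.  Integrating the velocity equation in [y] gives
    [P_x = - 2 int u u_x dy], which removes the remaining term of the third
    identity.  All of this involves derivatives of [w] in [x, y] of order at most
    two; the equation supplies [d_t w], and [d_t w_x], [d_t w_y] exist by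
    exchanging the order of differentiation.

    The weak derivatives [W_ij] of an [H^4] function are L2, and for
    [i + j <= 2] so are [W_(i+1)j], [W_i(j+1)] and [W_(i+1)(j+1)]; [W_ij] is then
    recovered by integrating these three and itself against bounded kernels.
    The resulting function is continuous, is bounded by the [H^4] norm
    (whence continuity in time), and is a classical derivative because it
    is a weak one. *)

From HB Require Import structures.
Require Import Defs.
From mathcomp Require Import all_boot all_order all_algebra.
From mathcomp Require Import all_classical all_reals all_analysis.
From mathcomp Require Import measurable_realfun ring lra.
Import Order.TTheory GRing.Theory Num.Theory.
Import numFieldNormedType.Exports.

Set Implicit Arguments.
Unset Strict Implicit.
Unset Printing Implicit Defensive.

Local Open Scope classical_set_scope.
Local Open Scope ring_scope.

(** * Integrals and derivatives on the line *)

Section Primitive.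
Context {R : realType}.
Local Notation mu := (@lebesgue_measure R).
Implicit Types (f g : R -> R) (x y a b : R).

(** The data live on [[0, T]] and on the closed channel, with one-sided derivatives at the ends.
    Time and [y] are therefore clamped, and [x] reduced modulo 1, so that the functions in play are
    continuous on the whole space. Integrals then become iterated primitives, for which
    differentiation under the integral sign and integration by parts follow from the mean value
    theorem; measurability and Fubini enter only where primitives are compared with [integral2] and
    where weak derivatives are handled.

    The equation gives a time derivative of [w] only, pointwise in the open channel, and [P_x] is
    not assumed continuous. Hence the rule for mixed derivatives and the formula for [P_x] come
    before the third identity is integrated.

    A weak derivative is known only through its pairings with test functions. Continuity is thus
    proved for an explicit kernel expression, which is identified with the weak derivative by
    duality against products [a x * b y]: the transposed kernels turn such a product into products
    that are again admissible and whose derivatives are explicit. *)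

Definition prim f x : R :=
  \int[mu]_(s in `[0, x]) f s - \int[mu]_(s in `[x, 0]) f s.

Lemma continuous_integrable_itv f a b :
  continuous f -> mu.-integrable `[a, b] (EFin \o f).
Proof.
move=> cf; apply: continuous_compact_integrable; first exact: segment_compact.
exact: continuous_subspaceT.
Qed.

Lemma Rintegral_chasles f a b c : continuous f -> a <= b -> b <= c ->
  \int[mu]_(s in `[a, c]) f s =
  \int[mu]_(s in `[a, b]) f s + \int[mu]_(s in `[b, c]) f s.
Proof.
move=> cf ab bc; rewrite addrC -(@Rintegral_itv_obnd_cbnd _ b).
  by apply/eqP; rewrite -subr_eq; apply/eqP/Rintegral_itvB;
    rewrite ?bnd_simp//; exact: continuous_integrable_itv.
apply: integrableS (continuous_integrable_itv b c cf) => //.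
by apply: subset_itvr; rewrite bnd_simp.
Qed.

(** [prim f x] is the signed integral from [0] to [x]: at least one of its two terms is over an
    empty or one-point interval. From a base point left of both [0] and [x] it is an ordinary
    integral up to a constant. *)
Lemma prim_shift f a x : continuous f -> a <= 0 -> a <= x ->
  prim f x = \int[mu]_(s in `[a, x]) f s - \int[mu]_(s in `[a, 0]) f s.
Proof.
move=> cf a0 ax; rewrite /prim.
have [x0|x0] := leP 0 x.
  rewrite (@Rintegral_chasles f a 0 x)//.
  suff -> : \int[mu]_(s in `[x, 0]) f s = 0 by ring.
  move: x0; rewrite le_eqVlt => /predU1P[<-|x0].
    by rewrite set_itv1 Rintegral_set1.
  by rewrite set_itv_ge ?Rintegral_set0// -leNgt bnd_simp.
rewrite (@Rintegral_chasles f a x 0) ?(ltW x0)// (@set_itv_ge _ _ _ (BRight x)).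
  by rewrite Rintegral_set0; ring.
by rewrite bnd_simp -ltNge.
Qed.

Lemma prim_is_derive f x : continuous f -> is_derive x 1 (prim f) (f x).
Proof.
(* A base point below [0] and strictly below [x] serves for every point near [x]. *)
move=> cf; pose a := - `|x| - 1.
have a0 : a <= 0 by rewrite /a; have := normr_ge0 x; lra.
have ax : a < x by rewrite /a; have := ler_norm (- x); rewrite normrN; lra.
have [||||d1 d2] := @continuous_FTC1_closed R f a x (x + 1).
- by rewrite ltrDl.
- exact: continuous_integrable_itv.
- exact: ax.
- exact: cf.
have H : is_derive x 1 (fun z => \int[mu]_(s in `[a, z]) f s - \int[mu]_(s in `[a, 0]) f s) (f x).
  rewrite -[X in is_derive _ _ _ X]subr0; apply: is_deriveB.
  by apply: DeriveDef; [exact: d1|rewrite -derive1E; exact: d2].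
apply: near_eq_is_derive H => //; near=> z.
by rewrite (@prim_shift f a z)// ltW//; near: z; exact: lt_nbhsr.
Unshelve. all: by end_near. Qed.

Lemma prim0 f : prim f 0 = 0.
Proof. by rewrite /prim subrr. Qed.

Lemma Rintegral_prim f a b : continuous f -> a <= b ->
  \int[mu]_(s in `[a, b]) f s = prim f b - prim f a.
Proof.
move=> cf ab; pose c := - `|a|.
have c0 : c <= 0 by rewrite oppr_le0.
have ca : c <= a by rewrite lerNl -normrN ler_norm.
have cb := le_trans ca ab; rewrite !(@prim_shift f c)//.
by rewrite (@Rintegral_chasles f c a b)//; ring.
Qed.

End Primitive.

(** * Derivatives relative to a subset of the line *)

Section OneSidedDerivative.
Context {R : realType}.
Implicit Types (S : set R) (f g : R -> R) (t l : R).

(* Differentiability at a point relative to [S], stated by extension so that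
   the rules of calculus are inherited from [is_derive]. *)
Definition isD S f t l : Prop :=
  exists2 g, (forall s, S s -> f s = g s) & is_derive t 1 g l.

Lemma is_derive_isD S f t l : is_derive t 1 f l -> isD S f t l.
Proof. by exists f. Qed.

Lemma isDS S S' f t l : S' `<=` S -> isD S f t l -> isD S' f t l.
Proof. by move=> SS [g fg dg]; exists g => // s /SS /fg. Qed.

Lemma eq_isD S f g t l : (forall s, S s -> f s = g s) -> isD S f t l -> isD S g t l.
Proof. by move=> fg [k fk dk]; exists k => // s Ss; rewrite -fg// fk. Qed.

Lemma isD_cst S c t : isD S (fun=> c) t 0.
Proof. by apply: is_derive_isD; exact: is_derive_cst. Qed.

Lemma isDD S f g t l m : isD S f t l -> isD S g t m ->
  isD S (fun s => f s + g s) t (l + m).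
Proof.
move=> [f' ff df] [g' gg dg]; exists (fun s => f' s + g' s) => [s Ss|].
  by rewrite ff// gg.
exact: is_deriveD.
Qed.

Lemma isDN S f t l : isD S f t l -> isD S (fun s => - f s) t (- l).
Proof.
move=> [f' ff df]; exists (fun s => - f' s) => [s Ss|]; first by rewrite ff.
exact: is_deriveN.
Qed.

Lemma isDB S f g t l m : isD S f t l -> isD S g t m ->
  isD S (fun s => f s - g s) t (l - m).
Proof. by move=> df /isDN; exact: isDD. Qed.

(** The product rule involves the values at [t]; membership of [t] in [S] identifies them with those
    of the extensions. *)
Lemma isDM S f g t l m : S t -> isD S f t l -> isD S g t m ->
  isD S (fun s => f s * g s) t (l * g t + f t * m).
Proof.
move=> St [f' ff df] [g' gg dg]; exists (fun s => f' s * g' s) => [s Ss|].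
  by rewrite ff// gg.
rewrite ff// gg//; apply: is_derive_eq (is_deriveM df dg) _.
by rewrite /GRing.scale/=; ring.
Qed.

Lemma isDZ S f t l c : isD S f t l -> isD S (fun s => c * f s) t (c * l).
Proof.
move=> [f' ff df]; exists (fun s => c * f' s) => [s Ss|]; first by rewrite ff.
exact: is_deriveZ.
Qed.

Lemma isDV S f t l : S t -> f t != 0 -> isD S f t l ->
  isD S (fun s => (f s)^-1) t (- l / f t ^+ 2).
Proof.
move=> St ft0 [f' ff df]; exists (fun s => (f' s)^-1) => [s Ss|]; first by rewrite ff.
rewrite ff// in ft0 *; apply: is_derive_eq (is_deriveV ft0 df) _.
by rewrite /GRing.scale/=; ring.
Qed.

Lemma isD_ln S f t l : S t -> 0 < f t -> isD S f t l ->
  isD S (fun s => ln (f s)) t (l / f t).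
Proof.
move=> St ft0 [f' ff df]; exists (fun s => ln (f' s)) => [s Ss|]; first by rewrite ff.
rewrite ff// in ft0 *; rewrite mulrC.
have := @is_derive1_comp R (@ln R) f' t _ _ (is_derive1_ln ft0) df; exact.
Qed.

Lemma isD_shift S f t l c :
  isD S f (t + c) l -> isD [set s | S (s + c)] (fun s => f (s + c)) t l.
Proof.
move=> [g fg dg]; exists (fun s => g (s + c)) => [s /= /fg//|].
rewrite -[l]mulr1.
apply: (@is_derive1_comp _ g (fun s => s + c) t) => //.
rewrite -[1 in X in is_derive _ _ _ X]addr0.
exact: is_deriveD.
Qed.

Lemma isD_cvg S f t l : S t -> isD S f t l -> f s @[s --> within S (nbhs t)] --> f t.
Proof.
move=> St [g fg dg]; rewrite fg//.
apply: (@cvg_trans _ (g @ within S (nbhs t))).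
  by apply: near_eq_cvg; near=> s; rewrite fg//; near: s; exact: withinT.
apply: cvg_within_filter.
by apply: differentiable_continuous; apply/derivable1_diffP; case: dg.
Unshelve. all: by end_near. Qed.

Lemma isD_open S f t l : nbhs t S -> isD S f t l -> is_derive t 1 f l.
Proof.
by move=> St [g fg]; apply: near_eq_is_derive; apply: filterS St => s /fg.
Qed.

Lemma isD_mvt f df a b : a < b ->
  (forall x, a <= x <= b -> isD `[a, b] f x (df x)) ->
  exists2 c, a < c < b & f b - f a = df c * (b - a).
Proof.
move=> ab H; have [x xab||] := @MVT R f df a b ab.
- apply: (@isD_open `[a, b]); first by
    apply: filterS (near_in_itvoo xab) => z; exact: subset_itv_oo_cc.
  by apply: H; move: xab; rewrite in_itv/= => /andP[/ltW -> /ltW ->].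
- apply/subspace_continuousP => x /= xab.
  by apply: isD_cvg (H x _) => //; move: xab; rewrite in_itv.
by move=> c; rewrite in_itv/= => cab ?; exists c.
Qed.

(** The bound on the derivative is asked for in the open interval only, which suits data known only
    in the open channel. *)
Lemma isD_lip f df a b e : a <= b ->
  (forall x, a <= x <= b -> isD `[a, b] f x (df x)) ->
  (forall x, a < x < b -> `|df x| <= e) ->
  `|f b - f a| <= e * (b - a).
Proof.
rewrite le_eqVlt => /predU1P[<-|ab] df0 e0; first by rewrite !subrr normr0 mulr0.
have [c cab ->] := isD_mvt ab df0.
by rewrite normrM (gtr0_norm (x:=b - a)) ?subr_gt0// ler_pM2r ?subr_gt0// e0.
Qed.

(** The mean value theorem for two points in either order. The intermediate point is no farther from
    [t] than [s] is, so uniform estimates near [t] apply to it. *)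
Lemma isD_mvt_in S f df s t : is_interval S -> S s -> S t ->
  (forall x, S x -> isD S f x (df x)) ->
  exists c, [/\ S c, `|c - t| <= `|s - t| & f s - f t = df c * (s - t)].
Proof.
move=> iS Ss St D.
have sub x y : S x -> S y -> `[x, y] `<=` S.
  by move=> Sx Sy z /=; rewrite in_itv/=; exact: iS.
have [st|ts|->] := ltgtP s t; last by exists t; rewrite !subrr mulr0.
- have [x xst|c /andP[sc ct] E] := @isD_mvt f df s t st.
    by apply: (isDS (sub s t Ss St)); apply/D/(sub s t); rewrite //= in_itv.
  exists c; split; [by apply: (sub s t) => //=; rewrite in_itv/= !ltW| |].
    by rewrite !ler0_norm ?subr_le0 ?ltW//; lra.
  by rewrite -opprB E; ring.
- have [x xst|c /andP[sc ct] E] := @isD_mvt f df t s ts.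
    by apply: (isDS (sub t s St Ss)); apply/D/(sub t s); rewrite //= in_itv.
  exists c; split => //; first by apply: (sub t s) => //=; rewrite in_itv/= !ltW.
  by rewrite !ger0_norm ?subr_ge0 ?ltW//; lra.
Qed.

Lemma isD_cst_itv f a b : a <= b ->
  (forall x, a <= x <= b -> isD `[a, b] f x 0) -> f b = f a.
Proof.
move=> ab df0; apply/eqP; rewrite -subr_eq0 -normr_le0.
rewrite -[leRHS](mul0r (b - a)); apply: (@isD_lip f (fun=> 0)) => // x _.
by rewrite normr0.
Qed.

End OneSidedDerivative.

(** * Comparison with limits of difference quotients along a direction *)

Section QuotientIn.
Context {R : realType} {V : normedModType R}.
Implicit Types (S : set V) (f : V -> R) (a v : V) (l : R).

Lemma is_derive_cvgP (g : R -> R) (t l : R) :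
  is_derive t 1 g l <-> h^-1 * (g (t + h) - g t) @[h --> 0^'] --> l.
Proof.
have E : (fun h : R => h^-1 * (g (t + h) - g t)) =
    (fun h => h^-1 *: ((g \o shift t) (h *: 1) - g t)).
  by apply/funext => h; rewrite (addrC t) /GRing.scale/= mulr1.
rewrite E; split=> [[dg <-]|H]; first exact: dg.
by apply: DeriveDef; [apply/cvg_ex; exists l|exact: cvg_lim H].
Qed.

Lemma quotient_inP S f a v l : S a ->
  quotient_in S f a v --> l <->
  isD [set h : R | S (a + h *: v)] (fun h => f (a + h *: v)) 0 l.
Proof.
move=> Sa; set D := [set h : R | S (a + h *: v)].
have D0 : D 0 by rewrite /D /= scale0r addr0.
split=> [ql|[g fg /is_derive_cvgP dg]].
  (* Off [D] the extension is the tangent line, whose difference quotient is exactly [l]. *)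
  pose g h := if `[< D h >] then f (a + h *: v) else f a + h * l.
  have g0 : g 0 = f a by rewrite /g asboolT// scale0r addr0.
  exists g => [s Ss|]; first by rewrite /g asboolT.
  apply/is_derive_cvgP => U Ul; have := ql U Ul.
  rewrite /= !near_simpl /within /= => qU; near=> h.
  have h0 : h != 0 by near: h; exact: nbhs_dnbhs_neq.
  rewrite /= g0 add0r /g; case: asboolP => Dh.
    by move: Dh; rewrite /D/=; near: h; exact: qU.
  rewrite addrC addKr mulKf//; exact: nbhs_singleton.
rewrite /quotient_in; apply: cvg_trans (cvg_within_filter D dg).
apply: near_eq_cvg; near=> h.
have Dh : D h by near: h; exact: withinT.
by rewrite add0r -!fg// scale0r addr0.
Unshelve. all: by end_near. Qed.

Lemma derivable_inP S f a v : S a -> derivable_in S f a v ->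
  isD [set h : R | S (a + h *: v)] (fun h => f (a + h *: v)) 0 (derive_in S f a v).
Proof. by move=> Sa H; apply/quotient_inP. Qed.

(** The accumulation hypothesis makes the filter of admissible increments proper, so that limits are
    unique and [derive_in], defined by [lim], really is [l]. *)
Lemma isD_derivable_in S f a v l : S a ->
  (forall e : R, 0 < e -> exists h : R, [/\ h != 0, `|h| < e & S (a + h *: v)]) ->
  isD [set h : R | S (a + h *: v)] (fun h => f (a + h *: v)) 0 l ->
  derivable_in S f a v /\ derive_in S f a v = l.
Proof.
move=> Sa acc /quotient_inP -/(_ Sa) H.
have PF : ProperFilter (within [set h : R | S (a + h *: v)] (0 : R)^').
  split; last exact: within_filter.
  rewrite /within /= => /nbhs_ballP[e /= e0].
  have [h [h0 he Sh]] := acc _ e0.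
  by move=> /(_ h); apply => //; rewrite /ball /= sub0r normrN.
split; first by apply/cvg_ex; exists l.
exact: cvg_lim H.
Qed.

End QuotientIn.

(** * Calculus of primitives *)

Section PrimTheory.
Context {R : realType}.
Implicit Types (f g : R -> R) (x y a b : R).

Lemma prim_isD S f x : continuous f -> isD S (prim f) x (f x).
Proof. by move=> /prim_is_derive ?; exact: is_derive_isD. Qed.

Lemma continuous_prim f : continuous f -> continuous (prim f).
Proof.
move=> cf x; apply: differentiable_continuous; apply/derivable1_diffP.
by case: (prim_is_derive x cf).
Qed.

Lemma prim_lip f g y e : continuous f -> continuous g -> 0 <= y ->
  (forall r, 0 < r < y -> `|f r - g r| <= e) ->
  `|prim f y - prim g y| <= e * y.
Proof.
move=> cf cg y0 fg.
have := @isD_lip _ (fun r => prim f r - prim g r) (fun r => f r - g r) 0 y e y0.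
rewrite !prim0 !subr0; apply => // x _.
by apply: isDB; exact: prim_isD.
Qed.

Lemma eq_prim f g y : continuous f -> continuous g -> 0 <= y ->
  (forall r, 0 < r < y -> f r = g r) -> prim f y = prim g y.
Proof.
move=> cf cg y0 fg; apply/eqP; rewrite -subr_eq0 -normr_le0 -[leRHS](mul0r y).
by apply: prim_lip => // r /fg ->; rewrite subrr normr0.
Qed.

(** [F - prim f] has zero derivative relative to [[0, y]]. The rules of linearity below are
    instances: an antiderivative is exhibited each time. *)
Lemma prim_unique f (F : R -> R) y : continuous f -> 0 <= y ->
  (forall r, 0 <= r <= y -> isD `[0, y] F r (f r)) ->
  prim f y = F y - F 0.
Proof.
move=> cf y0 DF.
have := @isD_cst_itv _ (fun r => F r - prim f r) 0 y y0.
rewrite prim0 subr0 => <-; first by ring.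
move=> r ry; rewrite -[X in isD _ _ _ X](subrr (f r)).
by apply: isDB; [exact: DF|exact: prim_isD].
Qed.

Lemma primD f g y : continuous f -> continuous g -> 0 <= y ->
  prim (fun r => f r + g r) y = prim f y + prim g y.
Proof.
move=> cf cg y0; rewrite (@prim_unique _ (fun r => prim f r + prim g r))//.
- by rewrite !prim0 addr0 subr0.
- by move=> x; apply: cvgD; [exact: cf|exact: cg].
- by move=> r _; apply: isDD; exact: prim_isD.
Qed.

Lemma primZ c f y : continuous f -> 0 <= y ->
  prim (fun r => c * f r) y = c * prim f y.
Proof.
move=> cf y0; rewrite (@prim_unique _ (fun r => c * prim f r))//.
- by rewrite !prim0 mulr0 subr0.
- by move=> x; apply: cvgM; [exact: cvg_cst|exact: cf].
- by move=> r _; apply: isDZ; exact: prim_isD.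
Qed.

Lemma primN f y : continuous f -> 0 <= y -> prim (fun r => - f r) y = - prim f y.
Proof.
by move=> cf y0; rewrite -mulN1r -primZ//; congr prim; apply/funext => r; rewrite mulN1r.
Qed.

Lemma primB f g y : continuous f -> continuous g -> 0 <= y ->
  prim (fun r => f r - g r) y = prim f y - prim g y.
Proof.
move=> cf cg y0; rewrite primD// ?primN// => x.
by apply: cvgN; exact: cg.
Qed.

Lemma prim_cst c y : 0 <= y -> prim (fun=> c) y = c * y.
Proof.
move=> y0; rewrite (@prim_unique _ (fun r => c * r))//.
- by rewrite mulr0 subr0.
- exact: cst_continuous.
- move=> r _; rewrite -[X in isD _ _ _ X]mulr1; apply: isDZ.
  exact: is_derive_isD.
Qed.

Lemma prim_le f g y : continuous f -> continuous g -> 0 <= y ->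
  (forall r, 0 < r < y -> f r <= g r) -> prim f y <= prim g y.
Proof.
move=> cf cg; rewrite le_eqVlt => /predU1P[<- _|y0 fg]; first by rewrite !prim0.
have [|c cy E] := @isD_mvt _ (fun r => prim g r - prim f r) (fun r => g r - f r) 0 y y0.
  by move=> x _; apply: isDB; exact: prim_isD.
rewrite -subr_ge0; move: E; rewrite !prim0 !subr0 => ->.
by rewrite mulr_ge0 ?subr_ge0 ?fg// ltW.
Qed.

(** The primitive is nondecreasing and vanishes at both ends, hence is identically zero on [[0, y]],
    and so is its derivative inside. *)
Lemma prim_ge0_eq0 f y : continuous f -> 0 <= y ->
  (forall r, 0 < r < y -> 0 <= f r) -> prim f y = 0 ->
  forall r, 0 < r < y -> f r = 0.
Proof.
move=> cf y0 f0 fy r /andP[r0 ry].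
have mono a b : 0 <= a -> a <= b -> b <= y -> prim f a <= prim f b.
  move=> a0; rewrite le_eqVlt => /predU1P[->//|ab] byy.
  have [|c /andP[ac cb] E] := @isD_mvt _ (prim f) f a b ab.
    by move=> x _; exact: prim_isD.
  rewrite -subr_ge0 E mulr_ge0 ?subr_ge0 ?(ltW ab)// f0//.
  by rewrite (le_lt_trans a0 ac) (lt_le_trans cb byy).
have z x : 0 <= x <= y -> prim f x = 0.
  move=> /andP[x0 xy]; apply/eqP; rewrite eq_le; apply/andP; split.
    by rewrite -fy mono.
  by rewrite -(prim0 f) mono.
have D : is_derive r 1 (fun=> 0 : R) (f r).
  apply: near_eq_is_derive (prim_is_derive r cf).
  have rI : r \in `]0, y[ by rewrite in_itv/= r0.
  by apply: filterS (near_in_itvoo rI) => x; rewrite in_itv/= => /andP[? ?]; rewrite z// !ltW.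
have [_ <-] := D; exact: derive_cst.
Qed.

(** The little-o form of the derivative. As in the comparison with quotients, the extension off [S]
    is the tangent line, where the remainder is zero. *)
Lemma isD_eps (S : set R) f t l : S t ->
  (forall e, 0 < e -> \forall s \near t, S s ->
     `|f s - f t - l * (s - t)| <= e * `|s - t|) ->
  isD S f t l.
Proof.
move=> St H; pose g s := if `[< S s >] then f s else f t + l * (s - t).
have gt : g t = f t by rewrite /g asboolT.
exists g => [s Ss|]; first by rewrite /g asboolT.
apply/is_derive_cvgP/cvgrPdist_le => /= e e0.
have : \forall h \near (0:R), `|g (t + h) - g t - l * h| <= e * `|h|.
  have := H e e0; rewrite (near_shift 0) subr0 /=; apply: filterS => h /=.
  rewrite (addrC h) gt /g; case: asboolP => [Sh /(_ Sh)|_ _].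
    by rewrite (addrC t) addrK.
  have -> : f t + l * (t + h - t) - f t - l * h = 0 by ring.
  by rewrite normr0 mulr_ge0// ltW.
move=> {}H; near=> h.
have h0 : h != 0 by near: h; exact: nbhs_dnbhs_neq.
have H' : `|g (t + h) - g t - l * h| <= e * `|h|.
  by near: h; exact: nbhs_dnbhs.
rewrite -(ler_pM2r (_ : 0 < `|h|)) ?normr_gt0// -normrM; apply: le_trans H'.
by rewrite mulrBl mulrAC mulVf// mul1r distrC.
Unshelve. all: by end_near. Qed.

End PrimTheory.

(** * Primitives depending on a parameter *)

Section ParametricPrim.
Context {R : realType}.

(** A tube argument: the neighbourhoods of [p] that work near each [r] are combined by compactness
    of [K]. *)
Lemma near_unif (X : topologicalType) (f : X * R -> R) (K : set R) p :
  continuous f -> compact K -> forall e : R, 0 < e ->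
  \forall q \near p, forall r, K r -> `|f (q, r) - f (p, r)| <= e.
Proof.
move=> cf /compact_near_coveringP cK e e0.
have /= := cK _ (nbhs p) (fun q r => `|f (q, r) - f (p, r)| <= e).
apply => r Kr.
have e2 : 0 < e / 2 by rewrite divr_gt0.
have /cvgrPdist_le/(_ _ e2) := cf (p, r).
case=> -[U V] /= [pU rV] UV; exists (V, U) => //= -[r' q] /= [Vr Uq].
have k1 := UV (q, r') (conj Uq Vr); have k2 := UV (p, r') (conj (nbhs_singleton pU) Vr).
rewrite /= in k1 k2.
rewrite -(subrKA (f (p, r))) (le_trans (ler_normD _ _))// [e]splitr lerD// distrC//.
Qed.

End ParametricPrim.

Section ParametricPrimDerivative.
Context {R : realType}.

Lemma continuous_pairl (X Y : topologicalType) (f : X * Y -> R) p :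
  continuous f -> continuous (fun r => f (p, r)).
Proof.
move=> cf r; apply: (@continuous_comp _ _ _ (fun r => (p, r)) f); last exact: cf.
by apply: cvg_pair => //; exact: cvg_cst.
Qed.

Lemma continuous_pairr (X Y : topologicalType) (f : X * Y -> R) r :
  continuous f -> continuous (fun p => f (p, r)).
Proof.
move=> cf p; apply: (@continuous_comp _ _ _ (fun p => (p, r)) f); last exact: cf.
by apply: cvg_pair => //; exact: cvg_cst.
Qed.

(** First the upper limit moves with the parameter fixed, then the parameter moves; the integrands
    are then uniformly close on [[- M, M]], where [M] bounds all upper limits near [y]. *)
Lemma continuous_prim_pair (X : topologicalType) (f : X * R -> R) :
  continuous f -> continuous (fun q : X * R => prim (fun r => f (q.1, r)) q.2).
Proof.
move=> cf -[p y]; apply/cvgrPdist_le => /= e e0.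
pose M := `|y| + 1.
have M0 : 0 < M by rewrite ltr_wpDl.
have cfp q : continuous (fun r => f (q, r)) by exact: continuous_pairl.
have e2 : 0 < e / 2 by rewrite divr_gt0.
have := @near_unif _ _ f `[- M, M] p cf (@segment_compact _ _ _) (e / 2 / M) _.
rewrite divr_gt0// => /(_ isT) U.
have eM : 0 <= e / 2 / M by rewrite ltW// divr_gt0.
have /cvgrPdist_le/(_ _ e2) V := continuous_prim (cfp p) (x := y).
have W : \forall y' \near y, `|y'| <= M.
  near=> y'; have : `|y - y'| < 1 by near: y'; apply: nbhsx_ballx.
  by have := ler_distD y y' 0; rewrite !subr0 distrC /M; lra.
near=> q.
have Uq : forall r, `[- M, M]%classic r -> `|f (q.1, r) - f (p, r)| <= e / 2 / M.
  by near: q; exact: cvg_fst U.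
have Vq : `|prim (fun r => f (p, r)) y - prim (fun r => f (p, r)) q.2| <= e / 2.
  by near: q; exact: cvg_snd V.
have Wq : `|q.2| <= M by near: q; exact: cvg_snd W.
rewrite -(subrKA (prim (fun r => f (p, r)) q.2)) (le_trans (ler_normD _ _))//.
rewrite [leRHS]splitr lerD// distrC.
have -> : e / 2 = e / 2 / M * M by rewrite mulfVK// gt_eqF.
have D r S : isD S (fun r => prim (fun r => f (q.1, r)) r - prim (fun r => f (p, r)) r) r
   (f (q.1, r) - f (p, r)).
  by apply: isDB; exact: prim_isD.
have [q0|q0] := leP 0 q.2.
  have := @isD_lip _ _ _ 0 q.2 (e / 2 / M) q0 (fun r _ => D r _).
  rewrite !prim0 !subr0 => H; apply: le_trans (H _) _.
    move=> r /andP[r0 rq]; apply: Uq; rewrite /= in_itv/=.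
    by move: Wq; rewrite ger0_norm//; lra.
  by rewrite ler_wpM2l//; exact: le_trans (ler_norm _) Wq.
have := @isD_lip _ _ _ q.2 0 (e / 2 / M) (ltW q0) (fun r _ => D r _).
rewrite !prim0 !subr0 !sub0r normrN => H; apply: le_trans (H _) _.
  move=> r /andP[r0 rq]; apply: Uq; rewrite /= in_itv/=.
  by move: Wq; rewrite ltr0_norm//; lra.
by rewrite ler_wpM2l//; apply: le_trans (ler_norm _) _; rewrite normrN.
Unshelve. all: by end_near. Qed.

(** By the mean value theorem in the parameter, the remainder [q (s, r) - q (t, r) - (s - t) * q'
    (t, r)] equals [(s - t) * (q' (c, r) - q' (t, r))], which is small compared with [s - t]
    uniformly in [r]; integrating in [r] keeps this. *)
Lemma isD_prim (S : set R) (q q' : R * R -> R) t y :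
  is_interval S -> S t -> 0 <= y -> continuous q -> continuous q' ->
  (forall s r, S s -> 0 < r < y -> isD S (fun s => q (s, r)) s (q' (s, r))) ->
  isD S (fun s => prim (fun r => q (s, r)) y) t (prim (fun r => q' (t, r)) y).
Proof.
move=> iS St y0 cq cq' D; apply: isD_eps => // e e0.
have cqs s : continuous (fun r => q (s, r)) by exact: continuous_pairl.
have cqs' s : continuous (fun r => q' (s, r)) by exact: continuous_pairl.
have y1 : 0 < y + 1 by rewrite ltr_wpDl.
have := @near_unif _ _ q' `[0, y] t cq' (@segment_compact _ _ _) (e / (y + 1)) _.
rewrite divr_gt0// => /(_ isT) /nbhs_ballP[d /= d0 dU].
near=> s => Ss.
have sd : `|t - s| < d by near: s; exact: nbhsx_ballx.
rewrite mulrC -primZ// -!primB//; last first.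
- by move=> r; apply: cvgM; [exact: cvg_cst|exact: cqs'].
- by move=> r; apply: cvgB; exact: cqs.
have c1 : continuous (fun r => q (s, r) - q (t, r) - (s - t) * q' (t, r)).
  move=> r; apply: cvgB; [apply: cvgB; exact: cqs|].
  by apply: cvgM; [exact: cvg_cst|exact: cqs'].
have := @prim_lip _ _ (fun=> 0) y (e / (y + 1) * `|s - t|) c1 (@cst_continuous _ _ _) y0.
rewrite prim_cst// mul0r subr0 => H; apply: le_trans (H _) _.
  move=> r r0y; rewrite subr0.
  have [c [Sc cs ->]] := isD_mvt_in iS Ss St (fun x Sx => D x r Sx r0y).
  rewrite mulrC -mulrBr normrM mulrC ler_wpM2r//.
  apply: dU => /=; first by rewrite /ball/= distrC (le_lt_trans cs)// distrC.
  by rewrite in_itv/=; move: r0y => /andP[/ltW -> /ltW ->].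
by rewrite mulrAC ler_wpM2r// mulrAC ler_pdivrMr// ler_pM2l// lerDl.
Unshelve. all: by end_near. Qed.

(* Symmetry of mixed partial derivatives, when only one of them is known to exist. *)
Lemma isD_mixed (S X : set R) (f ft fx : R -> R -> R) (ftx : R * R -> R) t x :
  is_interval S -> S t -> is_interval X -> open X -> X x -> continuous ftx ->
  (forall s z, S s -> X z -> isD S (f ^~ z) s (ft s z)) ->
  (forall s z, S s -> X z -> isD X (ft s) z (ftx (s, z))) ->
  (forall s, S s -> isD X (f s) x (fx s x)) ->
  isD S (fx ^~ x) t (ftx (t, x)).
Proof.
move=> iS St iX oX Xx cf Dt Dtx Dx; apply: isD_eps => // e e0.
have /cvgrPdist_le/(_ _ e0) /nbhs_ballP[d /= d0 dU] := cf (t, x).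
near=> s => Ss.
have sd : `|t - s| < d by near: s; exact: nbhsx_ballx.
(* The double difference of [f] is evaluated by two mean values: in time for [f s z - f s x], which
   produces [ft c z - ft c x], then in [z], which produces [ftx (c, b)] at a point close to
   [(t, x)]. Dividing by [z - x] and letting [z] tend to [x] afterwards brings in [fx]. *)
have key : \forall z \near x, `|(f s z - f t z - ftx (t, x) * (s - t) * z) -
    (f s x - f t x - ftx (t, x) * (s - t) * x)| <= e * `|s - t| * `|z - x|.
  near=> z.
  have Xz : X z by near: z; exact: open_nbhs_nbhs.
  have zd : `|x - z| < d by near: z; exact: nbhsx_ballx.
  have [c [Sc cs E1]] := isD_mvt_in iS Ss St
    (fun s Ss => isDB (Dt s z Ss Xz) (Dt s x Ss Xx)).
  have [b [Xb bz E2]] := isD_mvt_in iX Xz Xx (fun z Xz => Dtx c z Sc Xz).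
  rewrite /= in E1.
  have -> : (f s z - f t z - ftx (t, x) * (s - t) * z) -
    (f s x - f t x - ftx (t, x) * (s - t) * x) =
    (f s z - f s x - (f t z - f t x)) - ftx (t, x) * (s - t) * (z - x) by ring.
  rewrite E1 E2.
  have -> : ftx (c, b) * (z - x) * (s - t) - ftx (t, x) * (s - t) * (z - x) =
    (ftx (c, b) - ftx (t, x)) * (s - t) * (z - x) by ring.
  rewrite !normrM !ler_wpM2r// distrC; apply: (dU (c, b)); split => /=.
    by rewrite /ball/= distrC (le_lt_trans cs)// distrC.
  by rewrite /ball/= distrC (le_lt_trans bz)// distrC.
have : is_derive x 1 (fun z => f s z - f t z - ftx (t, x) * (s - t) * z)
    (fx s x - fx t x - ftx (t, x) * (s - t)).
  apply: (@isD_open _ X); first exact: open_nbhs_nbhs.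
  apply: isDB; first by apply: isDB; exact: Dx.
  rewrite -[X in isD _ _ _ X]mulr1; apply: isDZ.
  exact: is_derive_isD.
move=> /is_derive_cvgP H.
have {}H := cvg_norm H.
have {}H := H (@dnbhs_filter _ _).
apply: (cvgr_to_le H); near=> h.
have h0 : h != 0 by near: h; exact: nbhs_dnbhs_neq.
rewrite normrM normfV mulrC ler_pdivrMr ?normr_gt0//.
near: h; apply: nbhs_dnbhs.
by move: key; rewrite (near_shift 0) subr0; apply: filterS => h /=; rewrite (addrC h) (addrC x h) addrK (addrC h).
Unshelve. all: by end_near. Qed.

End ParametricPrimDerivative.

(** * Velocity, stream function and integrals over the unit square for continuous data *)

Section ContinuousIntegrals.
Context {R : realType}.

(** The digit counts variables, not derivatives: [C2] and [C3] mean joint continuity of a curried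
    function of two or three arguments. *)
Definition C2 (g : R -> R -> R) := continuous (fun q : R * R => g q.1 q.2).
Definition C3 (f : R -> R -> R -> R) :=
  continuous (fun p : R * R * R => f p.1.1 p.1.2 p.2).

(* [V1 g] solves [- V'' = g], [V 0 = V 1 = 0], and [U1 g = - V']: the stream
   function and the horizontal velocity of the vorticity [g]. *)
Definition U1 (g : R -> R) (y : R) : R :=
  prim g y - (prim g 1 - prim (fun r => r * g r) 1).
Definition V1 (g : R -> R) (y : R) : R :=
  - (y * prim g y) + prim (fun r => r * g r) y
  + y * (prim g 1 - prim (fun r => r * g r) 1).
Definition I2 (g : R -> R -> R) : R := prim (fun x => prim (g x) 1) 1.

Lemma isD_eq (S : set R) f (t l m : R) : isD S f t l -> l = m -> isD S f t m.
Proof. by move=> + <-. Qed.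

Lemma continuousXM (g : R -> R) : continuous g -> continuous (fun r : R => r * g r).
Proof. by move=> cg r; apply: cvgM; [exact: cvg_id|exact: cg]. Qed.

Lemma isD_XM (S : set R) y : isD S (fun r : R => r) y 1.
Proof. exact: is_derive_isD. Qed.

Lemma isD_U1y S g y : continuous g -> isD S (U1 g) y (g y).
Proof.
move=> cg; apply: isD_eq (isDB (prim_isD S y cg) (isD_cst _ _ _)) _.
by rewrite subr0.
Qed.

Lemma isD_V1y S g y : S y -> continuous g -> isD S (V1 g) y (- U1 g y).
Proof.
move=> Sy cg; apply: isD_eq (isDD (isDD (isDN (isDM Sy (isD_XM S y) (prim_isD S y cg)))
  (prim_isD S y (continuousXM cg))) (isDM Sy (isD_XM S y) (isD_cst _ _ _))) _.
by rewrite /U1; ring.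
Qed.

Lemma V1_0 g : V1 g 0 = 0. Proof. by rewrite /V1 !prim0; ring. Qed.
Lemma V1_1 g : V1 g 1 = 0. Proof. by rewrite /V1; ring. Qed.

Lemma C2_section g x : C2 g -> continuous (g x).
Proof. exact: continuous_pairl. Qed.

Lemma C2_sectionr g y : C2 g -> continuous (g ^~ y).
Proof. exact: continuous_pairr. Qed.

Lemma C2XM g : C2 g -> C2 (fun x y => y * g x y).
Proof. by move=> cg p; apply: cvgM; [exact: cvg_snd|exact: cg]. Qed.

Lemma C2_prim g : C2 g -> C2 (fun x y => prim (g x) y).
Proof. exact: continuous_prim_pair. Qed.

Lemma isD_primp (S : set R) (q q' : R -> R -> R) t y :
  is_interval S -> S t -> 0 <= y <= 1 -> C2 q -> C2 q' ->
  (forall s r, S s -> 0 < r < 1 -> isD S (q ^~ r) s (q' s r)) ->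
  isD S (fun s => prim (q s) y) t (prim (q' t) y).
Proof.
move=> iS St /andP[y0 y1] cq cq' D.
apply: (@isD_prim _ S (fun p => q p.1 p.2) (fun p => q' p.1 p.2)) => //.
by move=> s r Ss /andP[r0 ry]; apply: D; rewrite // r0 (lt_le_trans ry).
Qed.

Lemma isD_primXp (S : set R) (q q' : R -> R -> R) t y :
  is_interval S -> S t -> 0 <= y <= 1 -> C2 q -> C2 q' ->
  (forall s r, S s -> 0 < r < 1 -> isD S (q ^~ r) s (q' s r)) ->
  isD S (fun s => prim (fun r => r * q s r) y) t (prim (fun r => r * q' t r) y).
Proof.
move=> iS St y01 cq cq' D.
apply: (@isD_primp _ (fun s r => r * q s r) (fun s r => r * q' s r)) => //.
- exact: C2XM.
- exact: C2XM.
- by move=> s r Ss r01; apply: isDZ; exact: D.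
Qed.

(** [U1] is built linearly from primitives, so it commutes with differentiation in a parameter. The
    parameter is [x] (with [S] the whole line) or time (with [S] equal to [[0, T]]). *)
Lemma isD_U1p (S : set R) (q q' : R -> R -> R) t y :
  is_interval S -> S t -> 0 <= y <= 1 -> C2 q -> C2 q' ->
  (forall s r, S s -> 0 < r < 1 -> isD S (q ^~ r) s (q' s r)) ->
  isD S (fun s => U1 (q s) y) t (U1 (q' t) y).
Proof.
move=> iS St y01 cq cq' D; have one : 0 <= (1 : R) <= 1 by apply/andP; split.
apply: isDB; first exact: isD_primp.
by apply: isDB; [exact: isD_primp|exact: isD_primXp].
Qed.

Lemma isD_V1p (S : set R) (q q' : R -> R -> R) t y :
  is_interval S -> S t -> 0 <= y <= 1 -> C2 q -> C2 q' ->
  (forall s r, S s -> 0 < r < 1 -> isD S (q ^~ r) s (q' s r)) ->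
  isD S (fun s => V1 (q s) y) t (V1 (q' t) y).
Proof.
move=> iS St y01 cq cq' D; have one : 0 <= (1 : R) <= 1 by apply/andP; split.
apply: isDD.
  by apply: isDD; [apply: isDN; apply: isDZ; exact: isD_primp|exact: isD_primXp].
by apply: isDZ; apply: isDB; [exact: isD_primp|exact: isD_primXp].
Qed.

Lemma C2_prim1 g : C2 g -> continuous (fun x => prim (g x) 1).
Proof. by move=> /C2_prim /(C2_sectionr (y := 1)). Qed.

Lemma I2D f g : C2 f -> C2 g -> I2 (fun x y => f x y + g x y) = I2 f + I2 g.
Proof.
move=> cf cg; rewrite /I2 -primD//; [|exact: C2_prim1..].
by congr prim; apply/funext => x; rewrite primD//; exact: C2_section.
Qed.

Lemma I2Z c f : C2 f -> I2 (fun x y => c * f x y) = c * I2 f.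
Proof.
move=> cf; rewrite /I2 -primZ//; last exact: C2_prim1.
by congr prim; apply/funext => x; rewrite primZ//; exact: C2_section.
Qed.

Lemma I2N f : C2 f -> I2 (fun x y => - f x y) = - I2 f.
Proof.
move=> cf; have := I2Z (- 1) cf; rewrite mulN1r => <-.
by congr I2; apply/funext => x; apply/funext => y; rewrite mulN1r.
Qed.

Lemma C2N f : C2 f -> C2 (fun x y => - f x y).
Proof. by move=> cf p; apply: cvgN; exact: cf. Qed.

Lemma I2B f g : C2 f -> C2 g -> I2 (fun x y => f x y - g x y) = I2 f - I2 g.
Proof. by move=> cf cg; rewrite I2D ?I2N//; exact: C2N. Qed.

Lemma eq_I2 f g : C2 f -> C2 g ->
  (forall x y, 0 < x < 1 -> 0 < y < 1 -> f x y = g x y) -> I2 f = I2 g.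
Proof.
move=> cf cg fg; apply: eq_prim => //; [exact: C2_prim1..|].
by move=> x x01; apply: eq_prim => //; [exact: C2_section..|move=> y; exact: fg].
Qed.

(** The [y]-integral of [g] is an antiderivative in [x] of that of [gx], and its values at [0] and
    [1] agree. *)
Lemma I2_dx g gx : C2 g -> C2 gx ->
  (forall x y, 0 < y < 1 -> isD setT (g ^~ y) x (gx x y)) ->
  (forall y, 0 < y < 1 -> g 1 y = g 0 y) -> I2 gx = 0.
Proof.
move=> cg cgx D per.
rewrite /I2 (@prim_unique _ _ (fun x => prim (g x) 1))//; last 2 first.
- exact: C2_prim1.
- move=> x _; apply: (@isDS _ setT) => //; apply: isD_primp => //.
    by apply/andP; split.
  by move=> s r _; exact: D.
by apply/eqP; rewrite subr_eq0; apply/eqP/eq_prim => //; exact: C2_section.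
Qed.

Lemma I2_dy g gy : C2 g -> C2 gy ->
  (forall x y, 0 <= y <= 1 -> isD `[0, 1] (g x) y (gy x y)) ->
  (forall x, g x 1 = g x 0) -> I2 gy = 0.
Proof.
move=> cg cgy D per; rewrite /I2 -[RHS](mul0r 1) -[RHS]prim_cst//.
congr prim; apply/funext => x.
rewrite (@prim_unique _ _ (g x))// ?per ?subrr//; first exact: C2_section.
by move=> r; exact: D.
Qed.

Lemma continuous_pairing (X Y Z : topologicalType) (f : X -> Y) (g : X -> Z) :
  continuous f -> continuous g -> continuous (fun x => (f x, g x)).
Proof. by move=> cf cg x; apply: cvg_pair; [exact: cf|exact: cg]. Qed.

Lemma C3_section f t : C3 f -> C2 (f t).
Proof.
move=> cf q; apply: (@continuous_comp _ _ _ (fun q : R * R => (t, q.1, q.2))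
  (fun p : R * R * R => f p.1.1 p.1.2 p.2)); last exact: cf.
apply: continuous_pairing; last by move=> ?; exact: cvg_snd.
by apply: continuous_pairing => ?; [exact: cvg_cst|exact: cvg_fst].
Qed.

Lemma C3_section2 f x : C3 f -> C2 (fun t => f t x).
Proof.
move=> cf q; apply: (@continuous_comp _ _ _ (fun q : R * R => (q.1, x, q.2))
  (fun p : R * R * R => f p.1.1 p.1.2 p.2)); last exact: cf.
apply: continuous_pairing; last by move=> ?; exact: cvg_snd.
by apply: continuous_pairing => ?; [exact: cvg_fst|exact: cvg_cst].
Qed.

Lemma C3_section3 f y : C3 f -> C2 (fun t x => f t x y).
Proof. exact: continuous_pairr. Qed.

Lemma C3_prim f : C3 f -> C3 (fun t x y => prim (f t x) y).
Proof.
move=> cf.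
exact: (@continuous_prim_pair _ _ (fun p : R * R * R => f p.1.1 p.1.2 p.2)).
Qed.

Lemma C3_fix f y : C3 f -> C3 (fun t x _ => f t x y).
Proof.
move=> cf p; apply: (@continuous_comp _ _ _ (fun p : R * R * R => (p.1, y))
  (fun p : R * R * R => f p.1.1 p.1.2 p.2)); last exact: cf.
by apply: continuous_pairing => ?; [exact: cvg_fst|exact: cvg_cst].
Qed.

Lemma C3y : C3 (fun _ _ y => y).
Proof. by move=> p; exact: cvg_snd. Qed.

Lemma C3D f g : C3 f -> C3 g -> C3 (fun t x y => f t x y + g t x y).
Proof. by move=> cf cg p; apply: cvgD; [exact: cf|exact: cg]. Qed.

Lemma C3B f g : C3 f -> C3 g -> C3 (fun t x y => f t x y - g t x y).
Proof. by move=> cf cg p; apply: cvgB; [exact: cf|exact: cg]. Qed.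

Lemma C3M f g : C3 f -> C3 g -> C3 (fun t x y => f t x y * g t x y).
Proof. by move=> cf cg p; apply: cvgM; [exact: cf|exact: cg]. Qed.

Lemma C3N f : C3 f -> C3 (fun t x y => - f t x y).
Proof. by move=> cf p; apply: cvgN; exact: cf. Qed.

Lemma C3_cst c : C3 (fun _ _ _ => c).
Proof. by move=> p; exact: cvg_cst. Qed.

Lemma C3X f n : C3 f -> C3 (fun t x y => f t x y ^+ n).
Proof.
move=> cf; elim: n => [|n IH]; first exact: C3_cst.
suff -> : (fun t x y => f t x y ^+ n.+1) = (fun t x y => f t x y * f t x y ^+ n).
  exact: C3M.
by apply/funext => t; apply/funext => x; apply/funext => y; rewrite exprS.
Qed.

Lemma C3V f : (forall t x y, f t x y != 0) -> C3 f -> C3 (fun t x y => (f t x y)^-1).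
Proof. by move=> f0 cf p; apply: cvgV => //; exact: cf. Qed.

Lemma C3_ln f : (forall t x y, 0 < f t x y) -> C3 f -> C3 (fun t x y => ln (f t x y)).
Proof.
move=> f0 cf p; apply: (continuous_comp (cf p)).
exact: continuous_ln.
Qed.

Lemma C3_U1 f : C3 f -> C3 (fun t x => U1 (f t x)).
Proof.
move=> cf; have cp := C3_prim cf; have cq := C3_prim (C3M C3y cf).
exact (C3B cp (C3B (C3_fix (y := 1) cp) (C3_fix (y := 1) cq))).
Qed.

Lemma C3_V1 f : C3 f -> C3 (fun t x => V1 (f t x)).
Proof.
move=> cf; have cp := C3_prim cf; have cq := C3_prim (C3M C3y cf).
exact (C3D (C3D (C3N (C3M C3y cp)) cq)
  (C3M C3y (C3B (C3_fix (y := 1) cp) (C3_fix (y := 1) cq)))).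
Qed.

Lemma isD_I2 (S : set R) q q' t : is_interval S -> S t -> C3 q -> C3 q' ->
  (forall s x y, S s -> 0 < x < 1 -> 0 < y < 1 ->
    isD S (fun s => q s x y) s (q' s x y)) ->
  isD S (fun s => I2 (q s)) t (I2 (q' t)).
Proof.
move=> iS St cq cq' D; have one : 0 <= (1 : R) <= 1 by apply/andP; split.
apply: (@isD_primp S (fun s x => prim (q s x) 1) (fun s x => prim (q' s x) 1)) => //.
- exact: C3_section3 (C3_prim cq).
- exact: C3_section3 (C3_prim cq').
move=> s x Ss x01.
apply: (@isD_primp S (fun s y => q s x y) (fun s y => q' s x y)) => //.
- exact: C3_section2.
- exact: C3_section2.
- by move=> s' y Ss' y01; exact: D.
Qed.

End ContinuousIntegrals.

(** * Time derivatives on a compact interval *)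

Section TimeDerivative.
Context {R : realType}.
Implicit Types (S : set R) (f : R -> R) (t l m T : R).

Lemma isD_derive_in S f t l : S t ->
  (forall e, 0 < e -> exists h, [/\ h != 0, `|h| < e & S (t + h)]) ->
  isD S f t l -> derivable_in S f t 1 /\ derive_in S f t 1 = l.
Proof.
move=> St acc D; apply: isD_derivable_in => //.
  by move=> e /acc[h [h0 he Sh]]; exists h; split => //; rewrite /GRing.scale/= mulr1.
have E h : t + h *: (1 : R) = h + t by rewrite addrC /GRing.scale/= mulr1.
have -> : [set h | S (t + h *: (1 : R))] = [set h | S (h + t)].
  by apply/seteqP; split => h /=; rewrite E.
rewrite (_ : (fun h => _) = fun h => f (h + t)); last by apply/funext => h; rewrite E.
by apply: isD_shift; rewrite add0r.
Qed.

(** The increment points away from the nearer end and has at most half the length of the interval,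
    so it cannot leave it. *)
Lemma itv_accum a b t : a < b -> a <= t <= b ->
  forall e : R, 0 < e -> exists h, [/\ h != 0, `|h| < e & `[a, b]%classic (t + h)].
Proof.
move=> ab /andP[at_ tb] e e0.
have [tm|tm] := ltP t ((a + b) / 2).
  pose h := Num.min (e / 2) ((b - a) / 2).
  have h0 : 0 < h by rewrite lt_min !divr_gt0// subr_gt0.
  exists h; split; first by rewrite gt_eqF.
    by rewrite gtr0_norm// gt_min; apply/orP; left; lra.
  have : h <= (b - a) / 2 by rewrite ge_min lexx orbT.
  by rewrite /= in_itv/= => ?; apply/andP; split; lra.
pose h := Num.min (e / 2) ((b - a) / 2).
have h0 : 0 < h by rewrite lt_min !divr_gt0// subr_gt0.
exists (- h); split; first by rewrite oppr_eq0 gt_eqF.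
  by rewrite normrN gtr0_norm// gt_min; apply/orP; left; lra.
have : h <= (b - a) / 2 by rewrite ge_min lexx orbT.
by rewrite /= in_itv/= => ?; apply/andP; split; lra.
Qed.

Lemma isD_dt T f t l : 0 < T -> 0 <= t <= T -> isD `[0, T] f t l ->
  derivable_t T f t /\ dt T f t = l.
Proof.
move=> T0 t0T; apply: isD_derive_in; first by rewrite /= in_itv.
exact: itv_accum.
Qed.

Lemma dt_isD T f t : 0 <= t <= T -> derivable_t T f t ->
  isD `[0, T] f t (dt T f t).
Proof.
move=> t0T D; have tI : `[0, T]%classic t by rewrite /= in_itv.
have := derivable_inP tI D; rewrite -[X in isD _ _ X](subrr t) => /isD_shift/=.
have E s : t + (s - t) *: (1 : R) = s by rewrite /GRing.scale/= mulr1; ring.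
move=> H; apply: eq_isD (isDS _ H) => [s _|s] /=; by rewrite E.
Qed.

Lemma isD_unique T f t l m : 0 < T -> 0 <= t <= T ->
  isD `[0, T] f t l -> isD `[0, T] f t m -> l = m.
Proof.
by move=> T0 t0T /(isD_dt T0 t0T)[_ <-] /(isD_dt T0 t0T)[_ <-].
Qed.

End TimeDerivative.

(** * The identities for classical solutions *)

Section HydrostaticEuler.
Context {R : realType} (T : R) (T0 : 0 < T).
(** The partial derivatives are separate functions, continuous in all variables and tied to [W] only
    by the differentiability hypotheses below. The [x]-derivatives and the equations are required in
    the open channel, the [y]-derivatives up to the walls, where boundary fluxes are evaluated. *)
Context (W Wx Wy Wxx Wxy Wyy : R -> R -> R -> R) (Px : R -> R -> R).
Let u t x := U1 (W t x).
Let ux t x := U1 (Wx t x).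
Let uxx t x := U1 (Wxx t x).
Let v t x := V1 (Wx t x).
Let vx t x := V1 (Wxx t x).
Let F t x y := - (u t x y * Wx t x y + v t x y * Wy t x y).
Let a t x y := W t x y * Wx t x y / Wy t x y.
(** The value that [Px] is shown to have on [[0, T]]. It is continuous by construction, whereas
    nothing is assumed on the regularity of [Px]; the dummy argument lets it enter the calculus of
    [C3]. *)
Let PX t x (_ : R) := - (2 * prim (fun y => u t x y * ux t x y) 1).
Context (cW : C3 W) (cWx : C3 Wx) (cWy : C3 Wy).
Context (cWxx : C3 Wxx) (cWxy : C3 Wxy) (cWyy : C3 Wyy).
Context (perW : forall t x y, W t (x + 1) y = W t x y).
Context (perWx : forall t x y, Wx t (x + 1) y = Wx t x y).
Context (perWy : forall t x y, Wy t (x + 1) y = Wy t x y).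
Context (Wy_gt0 : forall t x y, 0 < Wy t x y).
Context (dxW : forall t x y, 0 < y < 1 -> isD setT (fun x => W t x y) x (Wx t x y)).
Context (dxWx : forall t x y, 0 < y < 1 -> isD setT (fun x => Wx t x y) x (Wxx t x y)).
Context (dxWy : forall t x y, 0 < y < 1 -> isD setT (fun x => Wy t x y) x (Wxy t x y)).
Context (dyW : forall t x y, 0 <= y <= 1 -> isD `[0, 1] (W t x) y (Wy t x y)).
Context (dyWx : forall t x y, 0 <= y <= 1 -> isD `[0, 1] (Wx t x) y (Wxy t x y)).
Context (dyWy : forall t x y, 0 <= y <= 1 -> isD `[0, 1] (Wy t x) y (Wyy t x y)).
Context (dtW : forall t x y, 0 <= t <= T -> 0 < y < 1 ->
  isD `[0, T] (fun s => W s x y) t (F t x y)).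
Context (dtu : forall t x y, 0 <= t <= T -> 0 < y < 1 ->
  isD `[0, T] (fun s => u s x y) t
    (- (u t x y * ux t x y + v t x y * W t x y + Px t x))).

Let cu : C3 u. Proof. exact: C3_U1. Qed.
Let cux : C3 ux. Proof. exact: C3_U1. Qed.
Let cuxx : C3 uxx. Proof. exact: C3_U1. Qed.
Let cv : C3 v. Proof. exact: C3_V1. Qed.
Let cvx : C3 vx. Proof. exact: C3_V1. Qed.
Let cF : C3 F. Proof. exact (C3N (C3D (C3M cu cWx) (C3M cv cWy))). Qed.
Let Wy_neq0 t x y : Wy t x y != 0. Proof. by rewrite gt_eqF. Qed.
Let ca : C3 a. Proof. exact (C3M (C3M cW cWx) (C3V Wy_neq0 cWy)). Qed.
Let cPX : C3 PX.
Proof. exact (C3N (C3M (C3_cst (c := 2)) (C3_fix (y := 1) (C3_prim (C3M cu cux))))). Qed.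

Let peru t x y : u t (x + 1) y = u t x y.
Proof. by congr (U1 _ y); apply/funext => r. Qed.
Let perux t x y : ux t (x + 1) y = ux t x y.
Proof. by congr (U1 _ y); apply/funext => r. Qed.
Let pera t x y : a t (x + 1) y = a t x y.
Proof. by rewrite /a perW perWx perWy. Qed.

Let i0T : is_interval (`[0, T] : set R). Proof. exact: interval_is_interval. Qed.

Let dxu t x y : 0 <= y <= 1 -> isD setT (fun x => u t x y) x (ux t x y).
Proof.
move=> y01; apply: (@isD_U1p _ setT (W t) (Wx t)) => //; [exact: C3_section..|].
by move=> s r _; exact: dxW.
Qed.

Let dxux t x y : 0 <= y <= 1 -> isD setT (fun x => ux t x y) x (uxx t x y).
Proof.
move=> y01; apply: (@isD_U1p _ setT (Wx t) (Wxx t)) => //; [exact: C3_section..|].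
by move=> s r _; exact: dxWx.
Qed.

Let cW1 t x : continuous (W t x). Proof. exact/C2_section/C3_section. Qed.
Let cWx1 t x : continuous (Wx t x). Proof. exact/C2_section/C3_section. Qed.
Let cWxx1 t x : continuous (Wxx t x). Proof. exact/C2_section/C3_section. Qed.

Let dyu S t x y : isD S (u t x) y (W t x y).
Proof. exact: isD_U1y. Qed.
Let dyv t x y : 0 <= y <= 1 -> isD `[0, 1] (v t x) y (- ux t x y).
Proof. by move=> y01; apply: isD_V1y => //=; rewrite in_itv. Qed.
Let dyvx t x y : 0 <= y <= 1 -> isD `[0, 1] (vx t x) y (- uxx t x y).
Proof. by move=> y01; apply: isD_V1y => //=; rewrite in_itv. Qed.
Let v0 t x : v t x 0 = 0. Proof. exact: V1_0. Qed.
Let v1 t x : v t x 1 = 0. Proof. exact: V1_1. Qed.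
Let vx0 t x : vx t x 0 = 0. Proof. exact: V1_0. Qed.
Let vx1 t x : vx t x 1 = 0. Proof. exact: V1_1. Qed.

Let dxv t x y : 0 <= y <= 1 -> isD setT (fun x => v t x y) x (vx t x y).
Proof.
move=> y01; apply: (@isD_V1p _ setT (Wx t) (Wxx t)) => //; [exact: C3_section..|].
by move=> s r _; exact: dxWx.
Qed.

Let oo_cc y : 0 < y < 1 -> 0 <= y <= (1 : R).
Proof. by move=> /andP[/ltW -> /ltW ->]. Qed.

Let Fx t x y := - (ux t x y * Wx t x y + u t x y * Wxx t x y +
  (vx t x y * Wy t x y + v t x y * Wxy t x y)).
Let Fy t x y := - (W t x y * Wx t x y + u t x y * Wxy t x y +
  (- ux t x y * Wy t x y + v t x y * Wyy t x y)).
Let cFx : C3 Fx.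
Proof. exact (C3N (C3D (C3D (C3M cux cWx) (C3M cu cWxx))
  (C3D (C3M cvx cWy) (C3M cv cWxy)))). Qed.
Let cFy : C3 Fy.
Proof. exact (C3N (C3D (C3D (C3M cW cWx) (C3M cu cWxy))
  (C3D (C3M (C3N cux) cWy) (C3M cv cWyy)))). Qed.

Let dxF t x y : 0 < y < 1 -> isD setT (fun x => F t x y) x (Fx t x y).
Proof.
move=> y01; have y01' := oo_cc y01.
exact (isDN (isDD (isDM (I : setT x) (dxu t x y01') (dxWx t x y01))
  (isDM (I : setT x) (dxv t x y01') (dxWy t x y01)))).
Qed.

Let I01 y : 0 <= y <= (1 : R) -> `[0, 1]%classic y.
Proof. by rewrite /= in_itv. Qed.

Let dyF t x y : 0 <= y <= 1 -> isD `[0, 1] (F t x) y (Fy t x y).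
Proof.
move=> y01; have Iy := I01 y01.
exact (isDN (isDD (isDM Iy (dyu _ t x y) (dyWx t x y01))
  (isDM Iy (dyv t x y01) (dyWy t x y01)))).
Qed.

Let dtWx t x y : 0 <= t <= T -> 0 < y < 1 ->
  isD `[0, T] (fun s => Wx s x y) t (Fx t x y).
Proof.
move=> tT y01.
apply: (@isD_mixed _ `[0, T] setT (fun s x => W s x y) (fun s x => F s x y)
  (fun s x => Wx s x y) (fun q => Fx q.1 q.2 y)) => //.
- exact: openT.
- exact: C3_section3 cFx.
- by move=> s z; rewrite /= in_itv/= => sT _; exact: dtW.
- by move=> s z _ _; exact: dxF.
- by move=> s _; exact: dxW.
Qed.

Let dtWy t x y : 0 <= t <= T -> 0 < y < 1 ->
  isD `[0, T] (fun s => Wy s x y) t (Fy t x y).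
Proof.
move=> tT y01.
(* The rule for mixed derivatives asks for an open set of [y], hence the restriction from the closed
   to the open interval. *)
have oc : `]0, 1[ `<=` (`[0, 1] : set R) by exact: subset_itv_oo_cc.
apply: (@isD_mixed _ `[0, T] `]0, 1[ (fun s y => W s x y) (fun s y => F s x y)
  (fun s y => Wy s x y) (fun q => Fy q.1 x q.2)) => //.
- exact: interval_is_interval.
- exact: C3_section2 cFy.
- by move=> s z; rewrite /= !in_itv/= => sT z01; exact: dtW.
- by move=> s z _ /oc; rewrite /= in_itv/= => z01; exact: isDS oc (dyF _ _ z01).
- by move=> s _; apply: isDS oc (dyW _ _ _); exact: oo_cc.
Qed.

(** The time derivative of [u] is computed twice. Since [W_t = F], it is [U1 (F t x)], which has
    mean zero in [y] because it is minus the derivative of [V1 (F t x)], zero on both walls. The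
    velocity equation gives it as minus the sum of [u u_x + v w] and [Px], where [u u_x + v w] is
    [2 u u_x] plus the [y]-derivative of [u v], by [u_y = w] and [v_y = - u_x]. *)
Lemma pressure_gradientE t x : 0 <= t <= T ->
  Px t x = - (2 * prim (fun y => u t x y * ux t x y) 1).
Proof.
move=> tT.
have cF1 : continuous (F t x) by exact/C2_section/C3_section.
have cUF : continuous (U1 (F t x)) by exact: (C2_section (C3_section (C3_U1 cF))).
have E y : 0 < y < 1 -> - U1 (F t x) y =
    2 * (u t x y * ux t x y) + (W t x y * v t x y + u t x y * - ux t x y) + Px t x.
  move=> y01.
  suff /(isD_unique T0 tT)/(_ (dtu x tT y01)) -> :
      isD `[0, T] (fun s => u s x y) t (U1 (F t x) y) by ring.
  apply: (@isD_U1p _ `[0, T] (fun s => W s x) (fun s => F s x)) => //.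
  - exact: oo_cc.
  - exact: C3_section2.
  - exact: C3_section2.
  - by move=> s r; rewrite /= in_itv/= => sT r01; exact: dtW.
have cu1 : continuous (u t x) by exact/C2_section/C3_section.
have cux1 : continuous (ux t x) by exact/C2_section/C3_section.
have cv1 : continuous (v t x) by exact/C2_section/C3_section.
have c1 : continuous (fun y => u t x y * ux t x y).
  by move=> y; apply: cvgM; [exact: cu1|exact: cux1].
have c2 : continuous (fun y => 2 * (u t x y * ux t x y)).
  by move=> y; apply: cvgM; [exact: cvg_cst|exact: c1].
have c3 : continuous (fun y => W t x y * v t x y + u t x y * - ux t x y).
  move=> y; apply: cvgD; first by apply: cvgM; [exact: cW1|exact: cv1].
  by apply: cvgM; [exact: cu1|apply: cvgN; exact: cux1].
have c4 : continuous (fun _ : R => Px t x) by exact: cst_continuous.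
have c23 : continuous (fun y => 2 * (u t x y * ux t x y) +
    (W t x y * v t x y + u t x y * - ux t x y)).
  by move=> y; apply: cvgD; [exact: c2|exact: c3].
have c5 : continuous (fun y => - U1 (F t x) y).
  by move=> y; apply: cvgN; exact: cUF.
have c6 : continuous (fun y => 2 * (u t x y * ux t x y) +
    (W t x y * v t x y + u t x y * - ux t x y) + Px t x).
  by move=> y; apply: cvgD; [exact: c23|exact: c4].
have E0 : prim (fun y => - U1 (F t x) y) 1 = 0.
  rewrite (@prim_unique _ _ (V1 (F t x)))//; first by rewrite V1_1 V1_0 subrr.
  by move=> y y01; apply: isD_V1y => //; exact: I01.
move: E0; rewrite (eq_prim c5 c6 ler01 E) (primD c23 c4)// (primD c2 c3)// (primZ _ c1)//.
have -> : prim (fun y => W t x y * v t x y + u t x y * - ux t x y) 1 = 0.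
  rewrite (@prim_unique _ _ (fun y => u t x y * v t x y))//; first by rewrite v0 v1; ring.
  by move=> y y01; apply: isDM; [exact: I01|exact: dyu|exact: dyv].
rewrite prim_cst// => E0; apply/eqP; rewrite -addr_eq0; apply/eqP.
by rewrite -[RHS]E0; ring.
Qed.

Lemma I2_ux t : I2 (ux t) = 0.
Proof.
apply: (@I2_dx _ (u t)); [exact: C3_section..| |].
  by move=> x y y01; apply: dxu; exact: oo_cc.
by move=> y _; rewrite -[in LHS](add0r 1).
Qed.

Let L t x y := ln (Wy t x y).
Let cL : C3 L. Proof. exact: C3_ln. Qed.

Lemma E1_simpl t : I2 (fun x y => a t x y - ux t x y) = I2 (a t).
Proof. by rewrite I2B ?I2_ux ?subr0//; exact: C3_section. Qed.

Let I2_divergence (t : R) (X Y Xx Yy : R -> R -> R -> R) :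
  C3 X -> C3 Y -> C3 Xx -> C3 Yy ->
  (forall x y, 0 < y < 1 -> isD setT (fun x => X t x y) x (Xx t x y)) ->
  (forall x y, 0 <= y <= 1 -> isD `[0, 1] (Y t x) y (Yy t x y)) ->
  (forall y, X t 1 y = X t 0 y) -> (forall x, Y t x 0 = 0) -> (forall x, Y t x 1 = 0) ->
  I2 (fun x y => Xx t x y + Yy t x y) = 0.
Proof.
move=> cX cY cXx cYy dX dY pX Y0 Y1.
rewrite I2D; [|exact: C3_section..].
rewrite (@I2_dx _ (X t)) ?(@I2_dy _ (Y t)) ?addr0//; try exact: C3_section.
by move=> x; rewrite Y0 Y1.
Qed.

Let per01 (f : R -> R -> R -> R) t y :
  (forall t x y, f t (x + 1) y = f t x y) -> f t 1 y = f t 0 y.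
Proof. by move=> pf; rewrite -[in LHS](add0r 1). Qed.

Let isD_prim_ln t x y : 0 <= t <= T -> 0 < y < 1 ->
  isD `[0, T] (fun s => ln (1 / Wy s x y)) t (- (Fy t x y / Wy t x y)).
Proof.
move=> tT y01.
apply: (@eq_isD _ _ (fun s => - L s x y)).
  by move=> s _; rewrite div1r lnV// posrE.
by apply: isDN; apply: isD_ln => //; exact: dtWy.
Qed.

Lemma dt_log_integral t : 0 <= t <= T ->
  isD `[0, T] (fun s => I2 (fun x y => ln (1 / Wy s x y))) t
    (I2 (fun x y => a t x y - ux t x y)).
Proof.
move=> tT.
have cG : C3 (fun t x y => - (Fy t x y / Wy t x y)).
  exact (C3N (C3M cFy (C3V Wy_neq0 cWy))).
have cLn : C3 (fun t x y => ln (1 / Wy t x y)).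
  apply: C3_ln => [s x y|]; first by rewrite div1r invr_gt0.
  exact (C3M (C3_cst (c := 1)) (C3V Wy_neq0 cWy)).
apply: isD_eq (@isD_I2 _ `[0, T] _ (fun t x y => - (Fy t x y / Wy t x y)) t _ _ cLn cG _) _.
- exact: interval_is_interval.
- by rewrite /= in_itv.
- by move=> s x y; rewrite /= in_itv/= => sT _ y01; exact: isD_prim_ln.
(* The derivatives of the fluxes [u ln w_y] and [v ln w_y]. The logarithms cancel in the sum, as the
   velocity is divergence free. *)
pose Xx t x y := ux t x y * L t x y + u t x y * (Wxy t x y / Wy t x y).
pose Yy t x y := - ux t x y * L t x y + v t x y * (Wyy t x y / Wy t x y).
have cXx : C3 Xx by exact (C3D (C3M cux cL) (C3M cu (C3M cWxy (C3V Wy_neq0 cWy)))).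
have cYy : C3 Yy.
  exact (C3D (C3M (C3N cux) cL) (C3M cv (C3M cWyy (C3V Wy_neq0 cWy)))).
have : I2 (fun x y => Xx t x y + Yy t x y) = 0.
  apply: (@I2_divergence t (fun t x y => u t x y * L t x y) (fun t x y => v t x y * L t x y)).
  - exact: C3M.
  - exact: C3M.
  - exact: cXx.
  - exact: cYy.
  - move=> x y y01; apply: isDM => //; first by apply: dxu; exact: oo_cc.
    by apply: isD_ln => //; exact: dxWy.
  - move=> x y y01; apply: isDM; [exact: I01|exact: dyv|].
    by apply: isD_ln; [exact: I01| |exact: dyWy].
  - by move=> y; rewrite (per01 _ _ peru) /L (per01 _ _ perWy).
  - by move=> x; rewrite v0 mul0r.
  - by move=> x; rewrite v1 mul0r.
move=> E0; rewrite -[RHS]addr0 -E0 -I2D; last 2 first.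
- exact (C3_section (C3B ca cux)).
- exact (C3_section (C3D cXx cYy)).
apply: eq_I2; [exact: (C3_section cG)|exact (C3_section (C3D (C3B ca cux) (C3D cXx cYy)))|].
move=> x y _ _; rewrite /Fy /a /Xx /Yy; move: (Wy_neq0 t x y) => w0; field.
exact: w0.
Qed.

Let ax t x y := (Wx t x y * Wx t x y + W t x y * Wxx t x y) / Wy t x y
  + W t x y * Wx t x y * (- Wxy t x y / Wy t x y ^+ 2).
Let ay t x y := (Wy t x y * Wx t x y + W t x y * Wxy t x y) / Wy t x y
  + W t x y * Wx t x y * (- Wyy t x y / Wy t x y ^+ 2).
Let at_ t x y := (F t x y * Wx t x y + W t x y * Fx t x y) / Wy t x y
  + W t x y * Wx t x y * (- Fy t x y / Wy t x y ^+ 2).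
Let Wy2_neq0 t x y : Wy t x y ^+ 2 != 0. Proof. by rewrite expf_neq0. Qed.
(** The quotient rule gives [ax], [ay] and [at_] this common shape, so one proof of continuity
    serves all three. *)
Let c_a (f g h : R -> R -> R -> R) : C3 f -> C3 g -> C3 h ->
  C3 (fun t x y => (f t x y * Wx t x y + W t x y * g t x y) / Wy t x y
  + W t x y * Wx t x y * (- h t x y / Wy t x y ^+ 2)).
Proof.
move=> cf cg ch.
exact (C3D (C3M (C3D (C3M cf cWx) (C3M cW cg)) (C3V Wy_neq0 cWy))
  (C3M (C3M cW cWx) (C3M (C3N ch) (C3V Wy2_neq0 (C3X (n := 2) cWy))))).
Qed.
Let cax : C3 ax. Proof. exact: c_a. Qed.
Let cay : C3 ay. Proof. exact: c_a. Qed.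
Let cat : C3 at_. Proof. exact: c_a. Qed.

Let dxa t x y : 0 < y < 1 -> isD setT (fun x => a t x y) x (ax t x y).
Proof.
move=> y01; apply: isDM => //; first by apply: isDM; [|exact: dxW|exact: dxWx].
by apply: isDV => //; exact: dxWy.
Qed.

Let dya t x y : 0 <= y <= 1 -> isD `[0, 1] (a t x) y (ay t x y).
Proof.
move=> y01; have Iy := I01 y01; apply: isDM => //.
  by apply: isDM; [|exact: dyW|exact: dyWx].
by apply: isDV => //; exact: dyWy.
Qed.

Let dta t x y : 0 <= t <= T -> 0 < y < 1 -> isD `[0, T] (fun s => a s x y) t (at_ t x y).
Proof.
move=> tT y01; have It : `[0, T]%classic t by rewrite /= in_itv.
apply: isDM => //; first by apply: isDM; [|exact: dtW|exact: dtWx].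
by apply: isDV => //; exact: dtWy.
Qed.

Lemma dt_E1 t : 0 <= t <= T ->
  isD `[0, T] (fun s => I2 (a s)) t (I2 (fun x y => `|ux t x y - a t x y| ^+ 2)).
Proof.
move=> tT.
apply: isD_eq (@isD_I2 _ `[0, T] _ at_ t _ _ ca cat _) _.
- exact: interval_is_interval.
- by rewrite /= in_itv.
- by move=> s x y; rewrite /= in_itv/= => sT _ y01; exact: dta.
(* Besides the transport of [a], the flux [(u u_x, u v_x)] appears. Its divergence is
   [u_x ^ 2 + w v_x], since the terms in [u_xx] cancel: the first term completes the square, the
   second removes the [w v_x] that comes from [v_x w_y] in [Fx]. *)
pose Xx t x y := (ux t x y * a t x y + u t x y * ax t x y) +
  (ux t x y * ux t x y + u t x y * uxx t x y).
pose Yy t x y := (- ux t x y * a t x y + v t x y * ay t x y) +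
  (W t x y * vx t x y + u t x y * - uxx t x y).
have cXx : C3 Xx by exact (C3D (C3D (C3M cux ca) (C3M cu cax))
  (C3D (C3M cux cux) (C3M cu cuxx))).
have cYy : C3 Yy by exact (C3D (C3D (C3M (C3N cux) ca) (C3M cv cay))
  (C3D (C3M cW cvx) (C3M cu (C3N cuxx)))).
have E0 : I2 (fun x y => Xx t x y + Yy t x y) = 0.
  apply: (@I2_divergence t (fun t x y => u t x y * a t x y + u t x y * ux t x y)
    (fun t x y => v t x y * a t x y + u t x y * vx t x y)).
  - exact (C3D (C3M cu ca) (C3M cu cux)).
  - exact (C3D (C3M cv ca) (C3M cu cvx)).
  - exact: cXx.
  - exact: cYy.
  - move=> x y y01; have y01' := oo_cc y01.
    exact (isDD (isDM I (dxu t x y01') (dxa t x y01)) (isDM I (dxu t x y01') (dxux t x y01'))).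
  - move=> x y y01; have Iy := I01 y01.
    exact (isDD (isDM Iy (dyv t x y01) (dya t x y01)) (isDM Iy (dyu _ t x y) (dyvx t x y01))).
  - by move=> y; rewrite !(per01 _ _ peru) (per01 _ _ pera) (per01 _ _ perux).
  - by move=> x; rewrite v0 vx0 mul0r mulr0 addr0.
  - by move=> x; rewrite v1 vx1 mul0r mulr0 addr0.
have cS : C3 (fun t x y => (ux t x y - a t x y) ^+ 2).
  exact (C3X (n := 2) (C3B cux ca)).
have -> : (fun x y => `|ux t x y - a t x y| ^+ 2) = (fun x y => (ux t x y - a t x y) ^+ 2).
  by apply/funext => x; apply/funext => y; rewrite real_normK// num_real.
rewrite -[RHS]subr0 -E0 -I2B; last 2 first.
- exact (C3_section cS).
- exact (C3_section (C3D cXx cYy)).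
apply: eq_I2; [exact: (C3_section cat)|exact (C3_section (C3B cS (C3D cXx cYy)))|].
move=> x y _ _; rewrite /at_ /Xx /Yy /ax /ay /Fx /Fy /F /a.
by move: (Wy_neq0 t x y) => w0; field; exact: w0.
Qed.

Let cu2 : C3 (fun t x y => u t x y ^+ 2). Proof. exact: C3X. Qed.

Let isDX2 (S : set R) f t l : S t -> isD S f t l ->
  isD S (fun s => f s ^+ 2) t (2 * f t * l).
Proof. by move=> St D; apply: isD_eq (isDM St D D) _; ring. Qed.

(** The velocity is minus the [y]-derivative of a stream function that vanishes on both walls. *)
Let prim_u t x : prim (u t x) 1 = 0.
Proof.
rewrite (@prim_unique _ _ (fun y => - V1 (W t x) y))//.
- by rewrite V1_1 V1_0; ring.
- exact/C2_section/C3_section.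
- by move=> y y01; apply: isD_eq (isDN (isD_V1y _ _)) _; [exact: I01| |rewrite opprK].
Qed.

Let I2_u2ux t : I2 (fun x y => u t x y ^+ 2 * ux t x y) = 0.
Proof.
apply: (@I2_dx _ (fun x y => 3^-1 * (u t x y ^+ 2 * u t x y))).
- exact (C3_section (C3M (C3_cst (c := 3^-1)) (C3M cu2 cu))).
- exact (C3_section (C3M cu2 cux)).
- move=> x y y01; have D := dxu t x (oo_cc y01).
  by apply: isD_eq (isDZ _ (isDM I (isDX2 I D) D)) _; field.
- by move=> y y01; rewrite !(per01 _ _ peru).
Qed.

(** The pressure gradient does not depend on [y] and [u] has mean zero in [y]. *)
Let I2_uPX t : I2 (fun x y => u t x y * PX t x y) = 0.
Proof.
rewrite /I2 -[RHS](mul0r 1) -[RHS]prim_cst//; congr prim; apply/funext => x.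
(* Freezing the dummy argument at [0] exhibits [PX] as a constant that can leave the
   [y]-integral. *)
rewrite -[LHS]/(prim (fun y => u t x y * PX t x 0) 1).
under [X in prim X]eq_fun do rewrite mulrC.
rewrite primZ// ?prim_u ?mulr0//; exact/C2_section/C3_section.
Qed.

Lemma E2_simpl t : I2 (fun x y => u t x y ^+ 2 * (a t x y - ux t x y) - u t x y * PX t x y)
  = I2 (fun x y => u t x y ^+ 2 * a t x y).
Proof.
rewrite I2B; last 2 first.
- exact (C3_section (C3M cu2 (C3B ca cux))).
- exact (C3_section (C3M cu cPX)).
rewrite I2_uPX subr0.
have -> : (fun x y => u t x y ^+ 2 * (a t x y - ux t x y)) =
  (fun x y => u t x y ^+ 2 * a t x y - u t x y ^+ 2 * ux t x y).
  by apply/funext => x; apply/funext => y; rewrite mulrBr.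
rewrite I2B ?I2_u2ux ?subr0//.
- exact (C3_section (C3M cu2 ca)).
- exact (C3_section (C3M cu2 cux)).
Qed.

(** Already true for each [x]: the [y]-integral of [2 u u_x] is [- PX], so the second term
    integrates to [- PX ^ 2]. *)
Let I2_PX t : I2 (fun x y => PX t x y ^+ 2 + PX t x y * (2 * (u t x y * ux t x y))) = 0.
Proof.
rewrite /I2 -[RHS](mul0r 1) -[RHS]prim_cst//; congr prim; apply/funext => x.
have c1 : continuous (fun y => u t x y * ux t x y).
  exact (C2_section (C3_section (C3M cu cux))).
have c2 : continuous (fun y => 2 * (u t x y * ux t x y)).
  exact (C2_section (C3_section (C3M (C3_cst (c := 2)) (C3M cu cux)))).
rewrite -[LHS]/(prim (fun y => PX t x 0 ^+ 2 + PX t x 0 * (2 * (u t x y * ux t x y))) 1).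
have c0 : continuous (fun _ : R => PX t x 0 ^+ 2) by exact: cst_continuous.
have c3 : continuous (fun y => PX t x 0 * (2 * (u t x y * ux t x y))).
  by move=> y; apply: cvgM; [exact: cvg_cst|exact: c2].
rewrite (primD c0 c3)// (primZ _ c2)// (primZ _ c1)// prim_cst//.
by rewrite /PX; ring.
Qed.

Lemma dt_E2 t : 0 <= t <= T ->
  isD `[0, T] (fun s => I2 (fun x y => u s x y ^+ 2 * a s x y)) t
    (I2 (fun x y => `|PX t x y + u t x y * (ux t x y - a t x y)| ^+ 2)).
Proof.
move=> tT.
(* The time derivative of [u] with [PX] in place of [Px], so as to be continuous. *)
pose ut t x y := - (u t x y * ux t x y + v t x y * W t x y + PX t x y).
have cut : C3 ut by exact (C3N (C3D (C3D (C3M cu cux) (C3M cv cW)) cPX)).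
pose bt t x y := 2 * u t x y * ut t x y * a t x y + u t x y ^+ 2 * at_ t x y.
have cbt : C3 bt.
  exact (C3D (C3M (C3M (C3M (C3_cst (c := 2)) cu) cut) ca) (C3M cu2 cat)).
have cb : C3 (fun t x y => u t x y ^+ 2 * a t x y) by exact (C3M cu2 ca).
apply: isD_eq (@isD_I2 _ `[0, T] _ bt t _ _ cb cbt _) _.
- exact: interval_is_interval.
- by rewrite /= in_itv.
- move=> s x y; rewrite /= in_itv/= => sT _ y01.
  have Is : `[0, T]%classic s by rewrite /= in_itv.
  apply: isDM => //; last exact: dta.
  apply: isDX2 => //; apply: isD_eq (dtu x sT y01) _.
  by rewrite /ut pressure_gradientE.
(* The derivatives of [u ^ 3 a + u ^ 3 u_x / 3] and of [u ^ 2 v a + u ^ 3 v_x / 3], left in the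
   unexpanded form in which the product rules produce them, so that the proofs below match by
   conversion. *)
pose Xx t x y := ((2 * u t x y * ux t x y * u t x y + u t x y ^+ 2 * ux t x y) * a t x y
    + u t x y ^+ 2 * u t x y * ax t x y) +
  3^-1 * ((2 * u t x y * ux t x y * u t x y + u t x y ^+ 2 * ux t x y) * ux t x y
    + u t x y ^+ 2 * u t x y * uxx t x y).
pose Yy t x y := ((2 * u t x y * W t x y * v t x y + u t x y ^+ 2 * - ux t x y) * a t x y
    + u t x y ^+ 2 * v t x y * ay t x y) +
  3^-1 * ((2 * u t x y * W t x y * u t x y + u t x y ^+ 2 * W t x y) * vx t x y
    + u t x y ^+ 2 * u t x y * - uxx t x y).
have c2 := C3_cst (c := 2 : R); have c3 := C3_cst (c := 3^-1 : R).
have cXx : C3 Xx.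
  exact (C3D (C3D (C3M (C3D (C3M (C3M (C3M c2 cu) cux) cu) (C3M cu2 cux)) ca)
      (C3M (C3M cu2 cu) cax))
    (C3M c3 (C3D (C3M (C3D (C3M (C3M (C3M c2 cu) cux) cu) (C3M cu2 cux)) cux)
      (C3M (C3M cu2 cu) cuxx)))).
have cYy : C3 Yy.
  exact (C3D (C3D (C3M (C3D (C3M (C3M (C3M c2 cu) cW) cv) (C3M cu2 (C3N cux))) ca)
      (C3M (C3M cu2 cv) cay))
    (C3M c3 (C3D (C3M (C3D (C3M (C3M (C3M c2 cu) cW) cu) (C3M cu2 cW)) cvx)
      (C3M (C3M cu2 cu) (C3N cuxx))))).
have E0 : I2 (fun x y => Xx t x y + Yy t x y) = 0.
  apply: (@I2_divergence t
    (fun t x y => u t x y ^+ 2 * u t x y * a t x y + 3^-1 * (u t x y ^+ 2 * u t x y * ux t x y))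
    (fun t x y => u t x y ^+ 2 * v t x y * a t x y + 3^-1 * (u t x y ^+ 2 * u t x y * vx t x y))).
  - exact (C3D (C3M (C3M cu2 cu) ca) (C3M c3 (C3M (C3M cu2 cu) cux))).
  - exact (C3D (C3M (C3M cu2 cv) ca) (C3M c3 (C3M (C3M cu2 cu) cvx))).
  - exact: cXx.
  - exact: cYy.
  - move=> x y y01; have y01' := oo_cc y01; have D := dxu t x y01'.
    exact (isDD (isDM I (isDM I (isDX2 I D) D) (dxa t x y01))
      (isDZ _ (isDM I (isDM I (isDX2 I D) D) (dxux t x y01')))).
  - move=> x y y01; have Iy := I01 y01; have D := dyu `[0, 1] t x y.
    exact (isDD (isDM Iy (isDM Iy (isDX2 Iy D) (dyv t x y01)) (dya t x y01))
      (isDZ _ (isDM Iy (isDM Iy (isDX2 Iy D) D) (dyvx t x y01)))).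
  - by move=> y; rewrite !(per01 _ _ peru) (per01 _ _ pera) (per01 _ _ perux).
  - by move=> x; rewrite v0 vx0; ring.
  - by move=> x; rewrite v1 vx1; ring.
have cS : C3 (fun t x y => (PX t x y + u t x y * (ux t x y - a t x y)) ^+ 2).
  exact (C3X (n := 2) (C3D cPX (C3M cu (C3B cux ca)))).
have cP : C3 (fun t x y => PX t x y ^+ 2 + PX t x y * (2 * (u t x y * ux t x y))).
  exact (C3D (C3X (n := 2) cPX) (C3M cPX (C3M c2 (C3M cu cux)))).
have -> : (fun x y => `|PX t x y + u t x y * (ux t x y - a t x y)| ^+ 2) =
    (fun x y => (PX t x y + u t x y * (ux t x y - a t x y)) ^+ 2).
  by apply/funext => x; apply/funext => y; rewrite real_normK// num_real.
(* The integrand differs from the square by a divergence and by the terms of [I2_PX], all of zero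
   integral. *)
transitivity (I2 (fun x y => (PX t x y + u t x y * (ux t x y - a t x y)) ^+ 2
    - (Xx t x y + Yy t x y) - (PX t x y ^+ 2 + PX t x y * (2 * (u t x y * ux t x y))))).
  2: {
    rewrite I2B; [rewrite I2B ?E0 ?I2_PX ?subr0//|..].
    - exact (C3_section cS).
    - exact (C3_section (C3D cXx cYy)).
    - exact (C3_section (C3B cS (C3D cXx cYy))).
    - exact (C3_section cP). }
apply: eq_I2; [exact: (C3_section cbt)|exact (C3_section (C3B (C3B cS (C3D cXx cYy)) cP))|].
move=> x y _ _; rewrite /bt /ut /at_ /Xx /Yy /ax /ay /Fx /Fy /F /a.
move: (Wy_neq0 t x y) (PX t x y) => w0 P'; field; exact: w0.
Qed.

End HydrostaticEuler.

(** * Integrals over the cell *)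

Section PlaneIntegral.
Context {R : realType}.
Local Notation mu := (@lebesgue_measure R).
Local Notation T2 := (measurableTypeR R * measurableTypeR R)%type.
Local Notation mu2 := (mu \x mu)%E.

(** The product sigma-algebra is generated by rectangles, so the open preimage of a half-line is
    written as a countable union of squares with rational centre and radius. *)
Lemma continuous_measurable2 (g : R * R -> R) :
  continuous g -> measurable_fun [set: T2] g.
Proof.
move=> cg; apply: (measurability _ (RGenOInfty.measurableE R)).
move=> _ [_ [a ->] <-]; rewrite setTI.
pose box (q r p : rat) : set T2 := ball (ratr q : R) (ratr p) `*` ball (ratr r : R) (ratr p).
pose U : set T2 := g @^-1` `]a, +oo[.
rewrite -/U.
have -> : U = \bigcup_q \bigcup_r \bigcup_p
    (if `[< box q r p `<=` U >] then box q r p else set0).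
  apply/seteqP; split=> [z Uz|z [q _ [r _ [p _]]]]; last first.
    by case: asboolP => // H /H.
  have oU : open U by apply: (@open_comp _ _ g) => //; exact: interval_open.
  have /nbhs_ballP[e /= e0 eU] : nbhs z U by exact: open_nbhs_nbhs.
  have e2 : 0 < e / 2 by rewrite divr_gt0.
  (* A radius below [e / 2], with a centre within that radius of [z], keeps the whole square in the
     [e]-ball around [z]. *)
  have [p p0 pe] : exists2 p : rat, 0 < ratr p :> R & ratr p < e / 2.
    have [p] := rat_in_itvoo e2.
    by rewrite in_itv/= => /andP[? ?]; exists p.
  have near_rat (x : R) : exists q : rat, `|ratr q - x| < ratr p.
    have [|q] := @rat_in_itvoo R (x - ratr p) (x + ratr p); first by lra.
    by rewrite in_itv/= => /andP[? ?]; exists q; rewrite ltr_distlC; apply/andP; split; lra.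
  have [q qz] := near_rat z.1; have [r rz] := near_rat z.2.
  exists q => //; exists r => //; exists p => //.
  rewrite asboolT; first by split.
  move=> w [/= wq wr]; apply: eU; split; rewrite /ball/=.
    apply: le_lt_trans (ler_distD (ratr q) _ _) _.
    by rewrite [e]splitr ltrD ?(lt_trans _ pe)// distrC.
  apply: le_lt_trans (ler_distD (ratr r) _ _) _.
  by rewrite [e]splitr ltrD ?(lt_trans _ pe)// distrC.
apply: bigcupT_measurable_rat => q; apply: bigcupT_measurable_rat => r.
apply: bigcupT_measurable_rat => p; case: ifP => _ //.
by apply: measurableX; exact: measurable_ball.
Qed.

Lemma measurable_cell : measurable (cell : set T2).
Proof. by apply: measurableX; exact: measurable_itv. Qed.

Lemma mu2_cell : mu2 (cell : set T2) = 1%E.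
Proof.
by rewrite product_measure1E//= !lebesgue_measure_itv/= !lte_fin !ltr01 oppr0 !adde0 mule1.
Qed.

Lemma integrable_cell_bounded (f : T2 -> R) (M : R) :
  measurable_fun cell f -> (forall z, cell z -> `|f z| <= M) ->
  mu2.-integrable cell (EFin \o f).
Proof.
move=> mf fM; apply: measurable_bounded_integrable => //.
- exact: measurable_cell.
- by have := @ltry R 1; rewrite -mu2_cell.
- by exists M; split; rewrite ?num_real// => x Mx z /fM /le_trans; apply; exact: ltW.
Qed.

Section Fubini.
Context d1 d2 (T1 : measurableType d1) (T3 : measurableType d2).
Context (m1 : {sigma_finite_measure set T1 -> \bar R}).
Context (m2 : {sigma_finite_measure set T3 -> \bar R}).
Context (D1 : set T1) (D2 : set T3) (mD1 : measurable D1) (mD2 : measurable D2).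

(** The inner integral is real-valued, and [fine] would turn an infinite value into a default.
    Sections are therefore assumed integrable at every point, not merely at almost every one. *)
Lemma Rintegral_prod12 (f : T1 * T3 -> R) :
  (m1 \x m2)%E.-integrable (D1 `*` D2) (EFin \o f) ->
  (forall x, D1 x -> m2.-integrable D2 (fun y => (f (x, y))%:E)) ->
  \int[(m1 \x m2)%E]_(z in D1 `*` D2) f z =
  \int[m1]_(x in D1) \int[m2]_(y in D2) f (x, y).
Proof.
move=> fi fxi; rewrite /Rintegral; congr fine.
have mD : measurable (D1 `*` D2) by exact: measurableX.
rewrite integral_mkcond -integral12_prod_meas1; last by apply: (integrable_mkcond _ mD).1 fi.
rewrite [RHS]integral_mkcond; apply: eq_integral => x _.
rewrite /fubini_F [RHS]patchE; case: ifPn => [/set_mem D1x|/negP D1x].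
  rewrite fineK; last exact: integrable_fin_num (fxi x D1x).
  rewrite [RHS]integral_mkcond; apply: eq_integral => y _.
  rewrite !patchE; congr (if _ then _ else _).
  by apply/idP/idP => /set_mem /=; rewrite inE; [case|].
apply: integral0_eq => y _; rewrite patchE; case: ifPn => // /set_mem [D1x' _].
by exfalso; apply: D1x; exact: mem_set.
Qed.

Lemma Rintegral_prod21 (f : T1 * T3 -> R) :
  (m1 \x m2)%E.-integrable (D1 `*` D2) (EFin \o f) ->
  (forall y, D2 y -> m1.-integrable D1 (fun x => (f (x, y))%:E)) ->
  \int[(m1 \x m2)%E]_(z in D1 `*` D2) f z =
  \int[m2]_(y in D2) \int[m1]_(x in D1) f (x, y).
Proof.
move=> fi fxi; rewrite /Rintegral; congr fine.
have mD : measurable (D1 `*` D2) by exact: measurableX.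
rewrite integral_mkcond -integral21_prod_meas1; last by apply: (integrable_mkcond _ mD).1 fi.
rewrite [RHS]integral_mkcond; apply: eq_integral => y _.
rewrite /fubini_G [RHS]patchE; case: ifPn => [/set_mem D2y|/negP D2y].
  rewrite fineK; last exact: integrable_fin_num (fxi y D2y).
  rewrite [RHS]integral_mkcond; apply: eq_integral => x _.
  rewrite !patchE; congr (if _ then _ else _).
  by apply/idP/idP => /set_mem /=; rewrite inE; [case|].
apply: integral0_eq => x _; rewrite patchE; case: ifPn => // /set_mem [_ D2y'].
by exfalso; apply: D2y; exact: mem_set.
Qed.
End Fubini.

End PlaneIntegral.

(** * Comparison of [integral2] with iterated primitives, and integrability of L2 functions *)

Section PlaneIntegralContinuous.
Context {R : realType}.
Local Notation mu := (@lebesgue_measure R).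
Local Notation T2 := (measurableTypeR R * measurableTypeR R)%type.
Local Notation mu2 := (mu \x mu)%E.

Lemma cellP (z : R * R) : cell z <-> (0 <= z.1 < 1) /\ (0 < z.2 < 1).
Proof. by rewrite /cell/= !in_itv/=. Qed.

Lemma cell_cc (z : R * R) : cell z -> 0 <= z.1 <= 1 /\ 0 <= z.2 <= 1.
Proof. by move=> /cellP[/andP[-> /ltW ->] /andP[/ltW -> /ltW ->]]. Qed.

Lemma C2_bounded (g : R -> R -> R) : C2 g -> exists2 M : R, 0 < M &
  forall x y, 0 <= x <= 1 -> 0 <= y <= 1 -> `|g x y| <= M.
Proof.
move=> cg.
have K : compact (`[0, 1] `*` `[0, 1] : set (R * R)).
  by apply: compact_setX; exact: segment_compact.
have /compact_bounded[M [_ MB]] := continuous_compact (continuous_subspaceT cg) K.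
exists (`|M| + 1) => [|x y x01 y01]; first by rewrite ltr_wpDl.
apply: MB; first by rewrite (le_lt_trans (ler_norm M))// ltrDl.
by exists (x, y) => //; split; rewrite /= in_itv.
Qed.

Lemma measurable_C2 (g : R -> R -> R) (D : set T2) :
  C2 g -> measurable_fun D (fun z : T2 => g z.1 z.2).
Proof. by move=> cg; apply: measurable_funTS; exact: continuous_measurable2. Qed.

Lemma integrable_C2 (g : R -> R -> R) : C2 g ->
  mu2.-integrable cell (EFin \o (fun z : T2 => g z.1 z.2)).
Proof.
move=> cg; have [M _ gM] := C2_bounded cg.
apply: (integrable_cell_bounded (M := M)); first exact: measurable_C2.
by move=> z /cell_cc[x01 y01]; exact: gM.
Qed.

Lemma Rintegral_co01 (f : R -> R) : continuous f ->
  \int[mu]_(x in `[0, 1[) f x = prim f 1.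
Proof.
move=> cf; rewrite Rintegral_itv_bndo_bndc ?Rintegral_prim ?prim0 ?subr0//.
apply: integrableS (continuous_integrable_itv 0 1 cf) => //.
by apply: subset_itvl; rewrite bnd_simp.
Qed.

Lemma Rintegral_oo01 (f : R -> R) : continuous f ->
  \int[mu]_(x in `]0, 1[) f x = prim f 1.
Proof.
move=> cf; rewrite Rintegral_itv_obnd_cbnd ?Rintegral_co01//.
apply: integrableS (continuous_integrable_itv 0 1 cf) => //.
exact: subset_itv_oo_cc.
Qed.

Lemma integrable_oo01 (f : R -> R) : continuous f ->
  mu.-integrable `]0, 1[ (EFin \o f).
Proof.
move=> cf; apply: integrableS (continuous_integrable_itv 0 1 cf) => //.
exact: subset_itv_oo_cc.
Qed.

Lemma integrable_co01 (f : R -> R) : continuous f ->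
  mu.-integrable `[0, 1[ (EFin \o f).
Proof.
move=> cf; apply: integrableS (continuous_integrable_itv 0 1 cf) => //.
by apply: subset_itvl; rewrite bnd_simp.
Qed.

Lemma eq_integral2 (f g : R * R -> R) :
  (forall z, cell z -> f z = g z) -> integral2 f = integral2 g.
Proof. by move=> fg; apply: eq_Rintegral => z /set_mem /fg. Qed.

(** The passage from Lebesgue integrals to primitives. Agreement on the cell suffices, so [g] may be
    a clamped, globally continuous version of [f]. *)
Lemma integral2_I2 (f : R * R -> R) (g : R -> R -> R) : C2 g ->
  (forall z, cell z -> f z = g z.1 z.2) -> integral2 f = I2 g.
Proof.
move=> cg /eq_integral2 ->.
rewrite /integral2 (@Rintegral_prod12 _ _ _ _ _ mu mu `[0, 1[ `]0, 1[)//; last 2 first.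
- exact: integrable_C2.
- by move=> x _; apply: integrable_oo01; exact: C2_section.
rewrite /I2 -Rintegral_co01; last exact: C2_prim1.
by apply: eq_Rintegral => x _; rewrite Rintegral_oo01//; exact: C2_section.
Qed.

Lemma continuous_swap (X Y : topologicalType) : continuous (fun q : X * Y => (q.2, q.1)).
Proof. by apply: continuous_pairing => q; [exact: cvg_snd|exact: cvg_fst]. Qed.

Lemma C2_swap (g : R -> R -> R) : C2 g -> C2 (fun x y => g y x).
Proof.
move=> cg q; apply: (@continuous_comp _ _ _ (fun q : R * R => (q.2, q.1))
  (fun q => g q.1 q.2)); last exact: cg.
exact: continuous_swap.
Qed.

(** Both orders of iteration are read off the same integral over the cell. *)
Lemma I2_swap (g : R -> R -> R) : C2 g -> I2 g = I2 (fun x y => g y x).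
Proof.
move=> cg; rewrite -(@integral2_I2 (fun z => g z.1 z.2))//.
rewrite /integral2 (@Rintegral_prod21 _ _ _ _ _ mu mu `[0, 1[ `]0, 1[)//; last 2 first.
- exact: integrable_C2.
- by move=> y _; apply: integrable_co01; exact: C2_sectionr.
rewrite /I2 -Rintegral_oo01; last exact/C2_prim1/C2_swap.
by apply: eq_Rintegral => y _; rewrite Rintegral_co01//; exact: C2_sectionr.
Qed.

(** The cell has finite measure and [|f| <= 1 + f ^ 2]. *)
Lemma L2_integrable (f : R * R -> R) : L2 f -> mu2.-integrable cell (EFin \o f).
Proof.
move=> [mf f2].
have i1 : mu2.-integrable cell (EFin \o (fun _ : T2 => 1 : R)).
  by apply: (integrable_cell_bounded (M := 1)) => [|z _]; rewrite ?normr1//.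
apply: (le_integrable measurable_cell _ _ (integrableD measurable_cell i1 f2)).
  exact/measurable_EFinP.
move=> z _ /=; rewrite lee_fin [leRHS]ger0_norm ?addr_ge0 ?sqr_ge0//.
rewrite -(real_normK (num_real (f z))); have := sqr_ge0 (`|f z| - 1).
have := normr_ge0 (f z); nra.
Qed.

Lemma L2M_integrable (f g : R * R -> R) (M : R) : L2 f -> 0 <= M ->
  measurable_fun (cell : set T2) g -> (forall z, cell z -> `|g z| <= M) ->
  mu2.-integrable cell (EFin \o (fun z => f z * g z)).
Proof.
move=> Lf M0 mg gM; have fi := L2_integrable Lf.
apply: (le_integrable measurable_cell _ _ (integrableZl measurable_cell M fi)).
  by apply/measurable_EFinP; apply: measurable_funM => //; case: Lf.
move=> z /gM gz /=; rewrite lee_fin !normrM mulrC ler_wpM2r//.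
by rewrite (ger0_norm M0).
Qed.

Lemma L2B (f g : R * R -> R) : L2 f -> L2 g -> L2 (fun z => f z - g z).
Proof.
move=> [mf f2] [mg g2]; have mfg : measurable_fun (cell : set T2) (fun z => f z - g z).
  exact: measurable_funB.
split => //.
have i2 := integrableZl measurable_cell 2 (integrableD measurable_cell f2 g2).
apply: (le_integrable measurable_cell _ _ i2).
  by apply/measurable_EFinP; exact: measurable_funX.
move=> z _ /=; rewrite lee_fin !ger0_norm ?sqr_ge0 ?mulr_ge0 ?addr_ge0 ?sqr_ge0//.
have := sqr_ge0 (f z + g z); nra.
Qed.

End PlaneIntegralContinuous.

(** * Test functions *)

Section Smooth.
Context {R : realType}.
Implicit Types (f g : R -> R) (x y : R) (k : nat) (p : {poly R}).

Fixpoint smoothn k f : Prop :=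
  continuous f /\
  if k is k'.+1 then (forall x, derivable f x 1) /\ smoothn k' (derive1 f) else True.

Definition smooth f := forall k, smoothn k f.

Lemma smoothn_continuous k f : smoothn k f -> continuous f.
Proof. by case: k => [|k] []. Qed.

Lemma is_derive_continuous f (f' : R -> R) : (forall x, is_derive x 1 f (f' x)) -> continuous f.
Proof.
move=> D x; apply: differentiable_continuous; apply/derivable1_diffP.
by case: (D x).
Qed.

Lemma smoothnSP k f (f' : R -> R) : (forall x, is_derive x 1 f (f' x)) ->
  smoothn k f' -> smoothn k.+1 f.
Proof.
move=> D sf'; split; first exact: is_derive_continuous D.
split=> [x|]; first by case: (D x).
rewrite (_ : (derive1 f) = f')//; apply/funext => x; rewrite derive1E.
by case: (D x).
Qed.

Lemma smoothnS_derive k f x : smoothn k.+1 f -> is_derive x 1 f ((derive1 f) x).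
Proof. by move=> [_ [D _]]; rewrite derive1E; exact: derivableP. Qed.

Lemma smoothnW k f : smoothn k.+1 f -> smoothn k f.
Proof. by elim: k f => [|k IH] f [cf [D sf]]; split => //; split => //; exact: IH. Qed.

Lemma smooth_continuous f : smooth f -> continuous f.
Proof. by move=> /(_ 0%N)/smoothn_continuous. Qed.

Lemma smooth_derive f x : smooth f -> is_derive x 1 f ((derive1 f) x).
Proof. by move=> /(_ 1%N)/(smoothnS_derive x). Qed.

Lemma smooth_derive1 f : smooth f -> smooth (derive1 f).
Proof. by move=> sf k; case: (sf k.+1) => _ []. Qed.

Lemma smooth_antiderivative f g : (forall x, is_derive x 1 f (g x)) -> smooth g -> smooth f.
Proof. by move=> D sg k; apply: smoothnW; exact: smoothnSP D (sg k). Qed.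

Lemma smooth_cst (c : R) : smooth (fun=> c).
Proof.
have s0 k : smoothn k (fun _ : R => 0 : R).
  elim: k => [|k IH]; first by split => //; exact: cst_continuous.
  by apply: smoothnSP IH => x; exact: is_derive_cst.
move=> [|k]; first by split => //; exact: cst_continuous.
by apply: smoothnSP (s0 k) => x; exact: is_derive_cst.
Qed.

Lemma smooth_id : smooth (fun x => x).
Proof. by apply: (@smooth_antiderivative _ (fun=> 1)); exact: smooth_cst. Qed.

Lemma smoothnD k f g : smoothn k f -> smoothn k g -> smoothn k (fun x => f x + g x).
Proof.
elim: k f g => [|k IH] f g sf sg.
  by split => // x; apply: cvgD; [exact: sf.1|exact: sg.1].
apply: (@smoothnSP _ _ (fun x => (derive1 f) x + (derive1 g) x)); last by apply: IH; [case: sf.2|case: sg.2].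
by move=> x; apply: is_deriveD; apply: smoothnS_derive; eassumption.
Qed.

Lemma smoothnM k f g : smoothn k f -> smoothn k g -> smoothn k (fun x => f x * g x).
Proof.
elim: k f g => [|k IH] f g sf sg.
  by split => // x; apply: cvgM; [exact: sf.1|exact: sg.1].
apply: (@smoothnSP _ _ (fun x => f x * (derive1 g) x + g x * (derive1 f) x)).
  move=> x; have Df := smoothnS_derive x sf; have Dg := smoothnS_derive x sg.
  exact: is_deriveM.
apply: smoothnD; apply: IH; try exact: smoothnW.
  by case: sg.2.
by case: sf.2.
Qed.

Lemma smoothn_comp k f g : smoothn k f -> smoothn k g -> smoothn k (f \o g).
Proof.
elim: k f g => [|k IH] f g sf sg.
  by split => // x; apply: continuous_comp; [exact: sg.1|exact: sf.1].
have D x : is_derive x 1 (f \o g) (derive1 f (g x) * derive1 g x).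
  exact: is_derive1_comp (smoothnS_derive (g x) sf) (smoothnS_derive x sg).
apply: smoothnSP D _; apply: smoothnM; last by case: sg.2.
by apply: (IH (derive1 f)); [case: sf.2|exact: smoothnW].
Qed.

Lemma smoothD f g : smooth f -> smooth g -> smooth (fun x => f x + g x).
Proof. by move=> sf sg k; exact: smoothnD. Qed.

Lemma smoothM f g : smooth f -> smooth g -> smooth (fun x => f x * g x).
Proof. by move=> sf sg k; exact: smoothnM. Qed.

Lemma smooth_comp f g : smooth f -> smooth g -> smooth (f \o g).
Proof. by move=> sf sg k; exact: smoothn_comp. Qed.

Lemma smoothB f g : smooth f -> smooth g -> smooth (fun x => f x - g x).
Proof.
move=> sf sg; apply: smoothD => //.
have := smoothM (smooth_cst (- 1)) sg.
by rewrite (_ : (fun x => -1 * g x) = (fun x => - g x))//; apply/funext => x; rewrite mulN1r.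
Qed.

Lemma smooth_prim f : smooth f -> smooth (prim f).
Proof.
move=> sf; have D x := prim_is_derive x (smooth_continuous sf).
exact: smooth_antiderivative D sf.
Qed.

Lemma smooth_sin : smooth sin.
Proof.
have H k : smoothn k sin /\ smoothn k cos.
  elim: k => [|k [IHs IHc]]; first by split; split => //; [exact: continuous_sin|exact: continuous_cos].
  split; first exact: (@smoothnSP _ _ cos).
  apply: (@smoothnSP _ _ (fun x => -1 * sin x)).
    by move=> x; rewrite mulN1r; exact: is_derive_cos.
  by apply: smoothnM => //; exact: smooth_cst.
by move=> k; case: (H k).
Qed.

(* The polynomial factor makes this class of functions stable under
   differentiation. *)
Definition flat p x : R := if 0 < x then p.[x^-1] * expR (- x^-1) else 0.

(** For positive [n], raise [y / n <= 1 + y / n <= exp (y / n)] to the power [n]. *)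
Lemma exprn_le_expR n y : 0 <= y -> y ^+ n <= n%:R ^+ n * expR y.
Proof.
move=> y0; case: n => [|n]; first by rewrite !expr0 mul1r (le_trans _ (expR_ge1Dx y))// lerDl.
have -> : expR y = expR (y / n.+1%:R) ^+ n.+1.
  by rewrite -expRM_natl mulrC mulfVK.
rewrite -exprMn; apply: lerXn2r.
- by rewrite nnegrE.
- by rewrite nnegrE mulr_ge0// expR_ge0.
rewrite mulrC -ler_pdivrMr//; apply: le_trans (expR_ge1Dx _).
by rewrite lerDr.
Qed.

Lemma poly_le_expR p : exists2 C : R, 0 <= C & forall y, 0 <= y -> `|p.[y]| <= C * expR y.
Proof.
exists (\sum_(i < size p) `|p`_i| * i%:R ^+ i).
  by apply: sumr_ge0 => i _; rewrite mulr_ge0// exprn_ge0.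
move=> y y0; rewrite horner_coef mulr_suml (le_trans (ler_norm_sum _ _ _))//.
apply: ler_sum => i _; rewrite normrM -mulrA ler_wpM2l// ger0_norm ?exprn_ge0//.
exact: exprn_le_expR.
Qed.

(** With ['X^2 * p] in place of [p], the exponential absorbs two extra powers of [1 / x]. The
    quadratic decay yields the zero derivative at [0]. *)
Lemma flat_bound p : exists2 C : R, 0 <= C & forall x, `|flat p x| <= C * x ^+ 2.
Proof.
have [C C0 CP] := poly_le_expR ('X^2 * p); exists C => // x; rewrite /flat.
case: ifPn => [x0|_]; last by rewrite normr0 mulr_ge0// sqr_ge0.
have y0 : 0 <= x^-1 by rewrite invr_ge0 ltW.
have := CP _ y0; rewrite hornerM hornerXn normrM (@ger0_norm _ (x^-1 ^+ 2)) ?exprn_ge0//.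
rewrite normrM expRN normfV (@ger0_norm _ (expR _)) ?expR_ge0// => H.
rewrite ler_pdivrMr ?expR_gt0// -(@ler_pM2l _ (x^-1 ^+ 2)) ?exprn_gt0 ?invr_gt0//.
apply: le_trans H _; have x1 : x != 0 by rewrite gt_eqF.
suff -> : x^-1 ^+ 2 * (C * x ^+ 2 * expR x^-1) = C * expR x^-1 by [].
by field.
Qed.

Lemma flat_is_derive p x : is_derive x 1 (flat p) (flat ('X^2 * (p - p^`())) x).
Proof.
have [x0|x0|<-] := ltgtP 0 x.
- have E : \near x, p.[x^-1] * expR (- x^-1) = flat p x.
    by near=> z; rewrite /flat ifT//; near: z; exact: lt_nbhsr.
  apply: near_eq_is_derive E _; rewrite {1}/flat x0.
  have Dv : is_derive x 1 (fun z : R => z^-1) (- x ^- 2).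
    have := @is_deriveV R (fun z => z) x 1 1 _ (is_derive_id _ _).
    rewrite gt_eqF// => /(_ isT); rewrite /GRing.scale/= mulr1; exact.
  have Dp : is_derive x 1 (fun z : R => p.[z^-1]) (p^`().[x^-1] * - x ^- 2).
    exact: (@is_derive1_comp _ (horner p) (fun z => z^-1)).
  have De : is_derive x 1 (fun z : R => expR (- z^-1)) (expR (- x^-1) * x ^- 2).
    rewrite -[x ^- 2]opprK.
    apply: (@is_derive1_comp _ expR (fun z => - z^-1)) => //.
  apply: is_derive_eq (is_deriveM Dp De) _.
  by rewrite /GRing.scale/= hornerM hornerXn hornerD hornerN exprVn; ring.
- apply: (@near_eq_is_derive _ _ _ (fun=> 0)).
    near=> z; rewrite /flat ifF//; apply/negbTE; rewrite -leNgt ltW//.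
    by near: z; exact: lt_nbhsl.
  by rewrite {1}/flat ltNge (ltW x0)/=; exact: is_derive_cst.
rewrite {2}/flat ltxx; apply/is_derive_cvgP.
have [C C0 CP] := flat_bound p.
apply/cvgrPdist_le => /= e e0; near=> h.
have h0 : h != 0 by near: h; exact: nbhs_dnbhs_neq.
rewrite sub0r normrN add0r {2}/flat ltxx subr0 normrM normfV.
rewrite ler_pdivrMl ?normr_gt0//; apply: le_trans (CP h) _.
rewrite -(real_normK (num_real h)) expr2 mulrA mulrC ler_wpM2l//.
have : `|0 - h| < e / (C + 1).
  by near: h; apply: nbhs_dnbhs; apply: nbhsx_ballx; rewrite divr_gt0// ltr_wpDl.
rewrite sub0r normrN => /ltW.
rewrite ler_pdivlMr ?ltr_wpDl// => H; apply: le_trans H.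
by rewrite mulrC ler_wpM2l// lerDl.
Unshelve. all: by end_near. Qed.

Lemma smooth_flat p : smooth (flat p).
Proof.
move=> k; elim: k p => [|k IH] p.
  by split => //; exact: is_derive_continuous (flat_is_derive p).
exact: smoothnSP (flat_is_derive p) (IH _).
Qed.

Lemma flat1_gt0 x : (0 < flat 1 x) = (0 < x).
Proof. by rewrite /flat; case: ifPn => // x0; rewrite hornerC mul1r expR_gt0. Qed.

Lemma flat1_ge0 x : 0 <= flat 1 x.
Proof. by rewrite /flat; case: ifPn => // x0; rewrite hornerC mul1r expR_ge0. Qed.

End Smooth.

(** * Bump functions in each variable and test functions of product form *)

Section TestFunctions.
Context {R : realType}.
Implicit Types (a b : R -> R) (x y : R).

Definition smooth_periodic a := smooth a /\ forall x, a (x + 1) = a x.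
Definition smooth_compact b :=
  smooth b /\ exists2 d : R, 0 < d & forall y, b y != 0 -> d <= y <= 1 - d.

(** Each sine changes sign when [x] increases by [1], so the product is 1-periodic. For
    [0 < l < r < 1] and [x] in [[0, 1]] both arguments lie strictly between [- pi] and [pi], so the
    product is positive exactly when [l < x < r]. *)
Definition bump_x (l r : R) x : R := flat 1 (sin (pi * (x - l)) * sin (pi * (r - x))).
Definition bump_y (l r : R) y : R := flat 1 ((y - l) * (r - y)).

Lemma smooth_affine (c d : R) : smooth (fun x => c * (x - d)).
Proof. by apply: smoothM (smooth_cst _) _; apply: smoothB smooth_id (smooth_cst _). Qed.

Lemma smooth_affineN (c d : R) : smooth (fun x => c * (d - x)).
Proof. by apply: smoothM (smooth_cst _) _; apply: smoothB (smooth_cst _) smooth_id. Qed.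

Lemma bump_x_smooth l r : smooth_periodic (bump_x l r).
Proof.
split=> [|x].
  apply: smooth_comp (smooth_flat 1) _; apply: smoothM.
    exact: smooth_comp smooth_sin (smooth_affine _ _).
  exact: smooth_comp smooth_sin (smooth_affineN _ _).
rewrite /bump_x.
have -> : pi * (x + 1 - l) = pi * (x - l) + pi by ring.
have -> : pi * (r - (x + 1)) = pi * (r - x) - pi by ring.
have := sinDpi (pi * (r - x) - pi); rewrite subrK => ->.
by rewrite sinDpi mulNr mulrN.
Qed.

Lemma sin_pi_gt0 x : -1 < x < 1 -> (0 < sin (pi * x)) = (0 < x).
Proof.
move=> /andP[x1 x2]; have [x0|x0|<-] := ltgtP 0 x.
- by rewrite sin_gt0_pi// mulr_gt0 ?pi_gt0//= -[ltRHS]mulr1 ltr_pM2l ?pi_gt0.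
- apply/negbTE; rewrite -leNgt -oppr_ge0 -sinN ltW// sin_gt0_pi//.
  rewrite -mulrN mulr_gt0 ?pi_gt0 ?oppr_gt0//=.
  by rewrite -[ltRHS]mulr1 ltr_pM2l ?pi_gt0// ltrNl.
- by rewrite mulr0 sin0 ltxx.
Qed.

Lemma bump_x_gt0 l r x : 0 < l -> l < r -> r < 1 -> 0 <= x <= 1 ->
  (0 < bump_x l r x) = (l < x < r).
Proof.
move=> l0 lr r1 /andP[x0 x1]; rewrite /bump_x flat1_gt0.
have sl := @sin_pi_gt0 (x - l); have sr := @sin_pi_gt0 (r - x).
have {}sl : (0 < sin (pi * (x - l))) = (l < x).
  by rewrite sl ?subr_gt0//; apply/andP; split; lra.
have {}sr : (0 < sin (pi * (r - x))) = (x < r).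
  by rewrite sr ?subr_gt0//; apply/andP; split; lra.
have [lx|xl] := ltP l x; first by rewrite pmulr_rgt0 ?sl// sr.
apply/negbTE; rewrite -leNgt mulr_le0_ge0//; first by rewrite leNgt sl -leNgt.
by rewrite ltW// sr (le_lt_trans xl).
Qed.

Lemma bump_x_ge0 l r x : 0 <= bump_x l r x. Proof. exact: flat1_ge0. Qed.
Lemma bump_y_ge0 l r x : 0 <= bump_y l r x. Proof. exact: flat1_ge0. Qed.

Lemma bump_y_gt0 l r y : l < r -> (0 < bump_y l r y) = (l < y < r).
Proof.
move=> lr; rewrite /bump_y flat1_gt0.
have [ly|yl] := ltP l y; first by rewrite pmulr_rgt0 subr_gt0.
apply/negbTE; rewrite -leNgt mulr_le0_ge0// ?subr_le0// subr_ge0.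
by rewrite ltW// (le_lt_trans yl).
Qed.

Lemma bump_y_smooth l r : 0 < l -> l < r -> r < 1 -> smooth_compact (bump_y l r).
Proof.
move=> l0 lr r1; split.
  apply: smooth_comp (smooth_flat 1) _; apply: smoothM.
    exact: smoothB smooth_id (smooth_cst _).
  exact: smoothB (smooth_cst _) smooth_id.
exists (Num.min l (1 - r)); first by rewrite lt_min l0 subr_gt0.
move=> y y0; have : 0 < bump_y l r y by rewrite lt_def y0 bump_y_ge0.
have m1 : Num.min l (1 - r) <= l by rewrite ge_min lexx.
have m2 : Num.min l (1 - r) <= 1 - r by rewrite ge_min lexx orbT.
by rewrite bump_y_gt0// => /andP[? ?]; apply/andP; split; lra.
Qed.

Lemma smooth_periodic_derive a : smooth_periodic a -> smooth_periodic (derive1 a).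
Proof.
move=> [sa pa]; split=> [|x]; first exact: smooth_derive1.
have D1 := smooth_derive x sa; have D2 := smooth_derive (x + 1) sa.
suff D : is_derive x 1 a (derive1 a (x + 1)) by case: D1 => _ <-; case: D.
have := @is_derive1_comp _ a (fun z => z + 1) x _ 1 D2 _.
rewrite mulr1 (_ : a \o _ = a); last by apply/funext => z /=.
apply; rewrite -[X in is_derive _ _ _ X]addr0; exact: is_deriveD.
Qed.

Lemma smooth_compact_derive b : smooth_compact b -> smooth_compact (derive1 b).
Proof.
move=> [sb [d d0 bd]]; split; first exact: smooth_derive1.
exists d => // y; apply: contraNT => yd; apply/eqP.
have b0 : \near y, (fun=> 0) y = b y.
  suff H : \forall z \near y, ~~ (d <= z <= 1 - d).
    by apply: filterS H => z zd; apply/esym/eqP; apply: contraNT zd; exact: bd.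
  move: yd; rewrite negb_and -!ltNge => /orP[yd|yd].
    near=> z; rewrite negb_and -!ltNge; apply/orP; left.
    by near: z; exact: lt_nbhsl.
  near=> z; rewrite negb_and -!ltNge; apply/orP; right.
  by near: z; exact: lt_nbhsr.
have D := smooth_derive y sb.
have [_ D0] := near_eq_is_derive b0 (is_derive_cst (0 : R) y (1 : R)).
by case: D => _ <-.
Unshelve. all: by end_near. Qed.

Lemma smooth_derive1n a n : smooth a -> smooth (iter n (@derive1 R R) a).
Proof. by move=> sa; elim: n => //= n; exact: smooth_derive1. Qed.

Lemma partial_x_prod a b (z : R * R) : smooth a ->
  is_derive z (1, 0 : R) (fun z : R * R => a z.1 * b z.2) (derive1 a z.1 * b z.2).
Proof.
move=> sa; have D : is_derive z.1 1 (fun x => a x * b z.2) (derive1 a z.1 * b z.2).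
  have Da := smooth_derive z.1 sa.
  apply: is_derive_eq (is_deriveM Da (is_derive_cst (b z.2) z.1 (1 : R))) _.
  by rewrite /GRing.scale/=; ring.
have E : (fun h : R => h^-1 *: (((fun z : R * R => a z.1 * b z.2) \o shift z) (h *: ((1, 0) : R * R)) - a z.1 * b z.2))
  = (fun h => h^-1 *: (((fun x => a x * b z.2) \o shift z.1) (h *: 1) - a z.1 * b z.2)).
  by apply/funext => h /=; rewrite scaler0 add0r.
by case: D => D1 D2; split; [rewrite /derivable E|rewrite /derive E].
Qed.

Lemma partial_y_prod a b (z : R * R) : smooth b ->
  is_derive z (0 : R, 1) (fun z : R * R => a z.1 * b z.2) (a z.1 * derive1 b z.2).
Proof.
move=> sb; have D : is_derive z.2 1 (fun y => a z.1 * b y) (a z.1 * derive1 b z.2).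
  have Db := smooth_derive z.2 sb; exact: is_deriveZ.
have E : (fun h : R => h^-1 *: (((fun z : R * R => a z.1 * b z.2) \o shift z) (h *: ((0, 1) : R * R)) - a z.1 * b z.2))
  = (fun h => h^-1 *: (((fun y => a z.1 * b y) \o shift z.2) (h *: 1) - a z.1 * b z.2)).
  by apply/funext => h /=; rewrite scaler0 add0r.
by case: D => D1 D2; split; [rewrite /derivable E|rewrite /derive E].
Qed.

Lemma partial_xE a b : smooth a ->
  partial_x (fun z => a z.1 * b z.2) = (fun z => derive1 a z.1 * b z.2).
Proof. by move=> sa; apply/funext => z; case: (partial_x_prod b z sa). Qed.

Lemma partial_yE a b : smooth b ->
  partial_y (fun z => a z.1 * b z.2) = (fun z => a z.1 * derive1 b z.2).
Proof. by move=> sb; apply/funext => z; case: (partial_y_prod a z sb). Qed.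

Lemma Ck_prod k a b : smooth a -> smooth b -> Ck k (fun z => a z.1 * b z.2).
Proof.
have cab a' b' : smooth a' -> smooth b' -> continuous (fun z : R * R => a' z.1 * b' z.2).
  move=> sa sb z; apply: cvgM.
    by apply: (continuous_comp (@cvg_fst _ _ _ _ _)); exact: smooth_continuous.
  by apply: (continuous_comp (@cvg_snd _ _ _ _ _)); exact: smooth_continuous.
elim: k a b => [|k IH] a b sa sb; first by split => //; exact: cab.
split; first exact: cab.
split.
- by move=> z; case: (partial_x_prod b z sa).
- by move=> z; case: (partial_y_prod a z sb).
- by rewrite partial_xE//; apply: IH => //; exact: smooth_derive1.
- by rewrite partial_yE//; apply: IH => //; exact: smooth_derive1.
Qed.

Lemma test_function_prod a b : smooth_periodic a -> smooth_compact b ->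
  test_function (fun z => a z.1 * b z.2).
Proof.
move=> [sa pa] [sb [d d0 bd]]; split; first by move=> k; exact: Ck_prod.
- by move=> z _ /=; rewrite pa.
- by exists d => // z; rewrite mulf_eq0 negb_or => /andP[_ /bd].
Qed.

Lemma iter_partial_prod i j a b : smooth a -> smooth b ->
  iter j partial_y (iter i partial_x (fun z => a z.1 * b z.2)) =
  (fun z => iter i (@derive1 R R) a z.1 * iter j (@derive1 R R) b z.2).
Proof.
move=> sa sb; have -> : iter i partial_x (fun z => a z.1 * b z.2) =
    (fun z => iter i (@derive1 R R) a z.1 * b z.2).
  by elim: i => //= i ->; rewrite partial_xE//; exact: smooth_derive1n.
by elim: j => //= j ->; rewrite partial_yE//; exact: smooth_derive1n.
Qed.

End TestFunctions.

(** * Kernel operators on L2 *)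

Section IntegrableSnd.
Context d1 d2 (T1 : measurableType d1) (T3 : measurableType d2) (R : realType).
Context (m1 : {sigma_finite_measure set T1 -> \bar R}).
Context (m2 : {sigma_finite_measure set T3 -> \bar R}).
Context (D1 : set T1) (D2 : set T3) (mD1 : measurable D1) (mD2 : measurable D2).

Lemma integrable_snd (W : T3 -> R) : (m1 D1 < +oo)%E ->
  m2.-integrable D2 (EFin \o W) ->
  (m1 \x m2)%E.-integrable (D1 `*` D2) (EFin \o (fun p => W p.2)).
Proof.
move=> D1oo iW; have mW := measurable_int _ iW.
have mcc : measurable (D1 `*` D2) by exact: measurableX.
apply: (integrable_mkcond _ mcc).2.
have mf : measurable_fun setT ((EFin \o (fun p : T1 * T3 => W p.2)) \_ (D1 `*` D2)).
  apply: (measurable_restrictT _ mcc).1.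
  apply: (@measurable_comp _ _ _ _ _ _ D2 (EFin \o W) _ snd) => //.
  - by move=> _ [p [_ ?] <-].
  - exact: measurable_funTS measurable_snd.
apply: (integrable12ltyP _ _ mf).2.
have /integrableP[_ iWfin] := iW.
rewrite (eq_integral ((cst (\int[m2]_(z in D2) `|(W z)%:E|)%E) \_ D1)); last first.
  move=> z _; rewrite patchE; case: ifPn => [/set_mem zc|/negP zc].
    rewrite [RHS]integral_mkcond; apply: eq_integral => z' _.
    rewrite !patchE /=; case: ifPn => [/set_mem [_ zc']|zc'].
      by rewrite mem_set.
    rewrite ifF ?abse0//; apply/negbTE; apply: contra zc' => /set_mem zc'.
    by apply/mem_set; split.
  apply: integral0_eq => z' _; rewrite patchE ifF ?abse0//.
  by apply/negP => /set_mem [/mem_set].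
rewrite -integral_mkcond integral_cst//.
apply: lte_mul_pinfty => //; first exact: integral_ge0.
by rewrite ge0_fin_numE// integral_ge0.
Qed.

(** The integrand is dominated by [M * |W z'|], integrable on the product because [D1] has finite
    measure. Exchanging the integrals moves the outer integration onto the kernel. *)
Lemma Rintegral_kernel (W : T3 -> R) (H : T1 * T3 -> R) (M : R) :
  (m1 D1 < +oo)%E -> m2.-integrable D2 (EFin \o W) -> 0 <= M ->
  measurable_fun setT H -> (forall z z', D1 z -> D2 z' -> `|H (z, z')| <= M) ->
  \int[m1]_(z in D1) \int[m2]_(z' in D2) (W z' * H (z, z')) =
  \int[m2]_(z' in D2) (W z' * \int[m1]_(z in D1) H (z, z')).
Proof.
move=> D1oo iW M0 mH HM; have mcc : measurable (D1 `*` D2) by exact: measurableX.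
have mW : measurable_fun D2 W by have /measurable_EFinP := measurable_int _ iW.
have mWs : measurable_fun (D1 `*` D2) (fun p : T1 * T3 => W p.2).
  apply: (@measurable_comp _ _ _ _ _ _ D2 W _ snd) => //.
  - by move=> _ [p [_ ?] <-].
  - exact: measurable_funTS measurable_snd.
have iWH : (m1 \x m2)%E.-integrable (D1 `*` D2) (EFin \o (fun p => W p.2 * H p)).
  have iWs := integrable_snd D1oo iW.
  apply: (le_integrable mcc _ _ (integrableZl mcc M iWs)).
    by apply/measurable_EFinP; apply: measurable_funM => //; exact: measurable_funTS.
  move=> [z z'] [/= zD z'D]; rewrite lee_fin !normrM mulrC ler_wpM2r//.
  by rewrite (ger0_norm M0) HM.
have mHl z : measurable_fun setT (fun z' => H (z, z')).
  exact: measurable_fun_pair2.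
have mHr z' : measurable_fun setT (fun z => H (z, z')).
  exact: measurable_fun_pair1.
have iH z' : D2 z' -> m1.-integrable D1 (fun z => (H (z, z'))%:E).
  move=> z'D; apply: measurable_bounded_integrable => //; first exact: measurable_funTS.
  exists M; split; rewrite ?num_real// => x Mx z zD /=.
  by rewrite (le_trans (HM _ _ zD z'D))// ltW.
have <- := @Rintegral_prod12 _ _ _ _ _ m1 m2 D1 D2 mD1 mD2 (fun p => W p.2 * H p) iWH.
  rewrite (@Rintegral_prod21 _ _ _ _ _ m1 m2 D1 D2)//.
    by apply: eq_Rintegral => z' /set_mem z'D /=; rewrite RintegralZl//; exact: iH.
  move=> z' z'D /=; exact (integrableZl mD1 (W z') (iH z' z'D)).
move=> z zD; apply: (le_integrable mD2 _ _ (integrableZl mD2 M iW)).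
  apply/measurable_EFinP; apply: measurable_funM => //; exact: measurable_funTS.
move=> z' z'D /=; rewrite lee_fin !normrM mulrC ler_wpM2r//.
by rewrite (ger0_norm M0) HM.
Qed.

End IntegrableSnd.

Section KernelOperators.
Context {R : realType}.
Local Notation mu := (@lebesgue_measure R).
Local Notation R' := (measurableTypeR R).
Local Notation T2 := (R' * R')%type.
Local Notation mu2 := (mu \x mu)%E.
Implicit Types (K : R -> R -> R) (W : R * R -> R).

Definition bounded01 K (B : R) : Prop :=
  measurable_fun [set: T2] (fun q : T2 => K q.1 q.2) /\
  forall x s, 0 <= x <= 1 -> 0 <= s <= 1 -> `|K x s| <= B.

(** An integral operator with a tensor-product kernel. The product form lets moduli of continuity
    and transposes be computed one variable at a time. *)
Definition kerop W K1 K2 (x y : R) : R :=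
  integral2 (fun z => W z * (K1 x z.1 * K2 y z.2)).

Lemma measurable_kernel_section K x : measurable_fun [set: T2] (fun q : T2 => K q.1 q.2) ->
  measurable_fun [set: R'] (K x).
Proof. by move=> mK; exact (measurable_fun_pair2 x mK). Qed.

Lemma measurable_kernel_sectionr K s : measurable_fun [set: T2] (fun q : T2 => K q.1 q.2) ->
  measurable_fun [set: R'] (K ^~ s).
Proof. by move=> mK; exact (measurable_fun_pair1 s mK). Qed.

Lemma measurable_prod_fun (f g : R -> R) :
  measurable_fun [set: R'] f -> measurable_fun [set: R'] g ->
  measurable_fun [set: T2] (fun z : T2 => f z.1 * g z.2).
Proof.
move=> mf mg; apply: measurable_funM.
  exact: measurableT_comp mf measurable_fst.
exact: measurableT_comp mg measurable_snd.
Qed.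

Lemma integrable_itv_bounded (i : interval R) (f : R -> R) (M : R) :
  [set` i] `<=` `[0, 1] ->
  measurable_fun [set: R'] f -> (forall x, 0 <= x <= 1 -> `|f x| <= M) ->
  mu.-integrable [set` i] (EFin \o f).
Proof.
move=> i01 mf fM; apply: measurable_bounded_integrable => //.
- apply: (@le_lt_trans _ _ (mu `[0, 1]%classic)).
    by apply: le_measure => //; rewrite inE.
  by rewrite lebesgue_measure_itv/= lte_fin ltr01 oppr0 adde0 ltry.
- exact: measurable_funTS.
- exists M; split; rewrite ?num_real// => x Mx z /i01 /=; rewrite in_itv/= => /fM.
  by move=> /le_trans; apply; exact: ltW.
Qed.

Lemma co01_sub : `[0, 1[ `<=` (`[0, 1] : set R).
Proof. by apply: subset_itvl; rewrite bnd_simp. Qed.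

Lemma oo01_sub : `]0, 1[ `<=` (`[0, 1] : set R).
Proof. exact: subset_itv_oo_cc. Qed.

Lemma integral2_prod (f g : R -> R) (B1 B2 : R) :
  measurable_fun [set: R'] f -> measurable_fun [set: R'] g ->
  (forall x, 0 <= x <= 1 -> `|f x| <= B1) -> (forall x, 0 <= x <= 1 -> `|g x| <= B2) ->
  integral2 (fun z => f z.1 * g z.2) =
  \int[mu]_(x in `[0, 1[) f x * \int[mu]_(y in `]0, 1[) g y.
Proof.
move=> mf mg fB gB.
have fi := integrable_itv_bounded co01_sub mf fB.
have gi := integrable_itv_bounded oo01_sub mg gB.
rewrite /integral2 (@Rintegral_prod12 _ _ _ _ _ mu mu `[0, 1[ `]0, 1[)//; last 2 first.
- apply: (integrable_cell_bounded (M := B1 * B2)).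
    by apply: measurable_funTS; exact: measurable_prod_fun.
  by move=> z /cell_cc[z1 z2]; rewrite normrM ler_pM// ?fB ?gB.
- move=> x _; have moo : measurable (`]0, 1[ : set R') by exact: measurable_itv.
  exact (integrableZl moo (f x) gi).
rewrite -RintegralZr//; apply: eq_Rintegral => x _ /=.
by rewrite RintegralZl.
Qed.

End KernelOperators.

(** * Bounds of kernel operators by integral norms *)

Section KernelOperatorBounds.
Context {R : realType}.
Local Notation mu := (@lebesgue_measure R).
Local Notation R' := (measurableTypeR R).
Local Notation T2 := (R' * R')%type.
Local Notation mu2 := (mu \x mu)%E.
Implicit Types (K : R -> R -> R) (W : R * R -> R).

Definition norm1 W : R := integral2 (fun z => `|W z|).
(** The square of the L2 norm; estimates are stated with it so that no square root occurs. *)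
Definition norm2 W : R := integral2 (fun z => W z ^+ 2).

Lemma mu2_cell_lty : (mu2 (cell : set T2) < +oo)%E.
Proof. by have := @ltry R 1; rewrite -mu2_cell. Qed.

Lemma norm1_ge0 W : 0 <= norm1 W. Proof. exact: Rintegral_ge0. Qed.
Lemma norm2_ge0 W : 0 <= norm2 W. Proof. by apply: Rintegral_ge0 => z _; exact: sqr_ge0. Qed.

Lemma le_integral2 (f g : R * R -> R) :
  mu2.-integrable cell (EFin \o f) -> mu2.-integrable cell (EFin \o g) ->
  (forall z, cell z -> f z <= g z) -> integral2 f <= integral2 g.
Proof. exact: le_Rintegral measurable_cell. Qed.

Lemma integral2_indic (A : set T2) (h : R) : measurable A ->
  (mu2 (cell `&` A) <= h%:E)%E -> integral2 (fun z => \1_A z) <= h.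
Proof.
move=> mA Ah; rewrite /integral2 /Rintegral integral_indic//; last exact: measurable_cell.
rewrite setIC -lee_fin fineK//.
rewrite ge0_fin_numE//; apply: le_lt_trans mu2_cell_lty.
apply: le_measure; rewrite ?inE//; [|exact: measurable_cell].
by apply: measurableI => //; exact: measurable_cell.
Qed.

(** The part of [D] carried by the small set [A] is handled by [|W| <= l * W ^ 2 + 1 / l],
    integrated over [A]: the second term costs only [h / l]. With [l] chosen small first and then
    [h], everything is small. This plays the part of the Cauchy-Schwarz inequality. *)
Lemma L2_weighted W (D : R * R -> R) (A : set T2) (B C h l : R) :
  L2 W -> measurable A -> (mu2 (cell `&` A) <= h%:E)%E ->
  measurable_fun (cell : set T2) D -> 0 <= B -> 0 <= C -> 0 <= h -> 0 < l ->
  (forall z, cell z -> `|D z| <= B * (C * h + \1_A z)) ->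
  `|integral2 (fun z => W z * D z)| <= B * (C * h * norm1 W + l * norm2 W + h / l).
Proof.
move=> LW mA Ah mD B0 C0 h0 l0 DB.
have iA : mu2.-integrable cell (EFin \o (fun z : T2 => \1_A z : R)).
  apply: (integrable_cell_bounded (M := 1)); first exact: measurable_indic.
  by move=> z _; rewrite indicE; case: (z \in A); rewrite ?normr1 ?normr0.
have iW := L2_integrable LW.
have mc := @measurable_cell R.
have iaW : mu2.-integrable cell (EFin \o (fun z => `|W z|)).
  by have := integrable_abse iW.
have iW2 : mu2.-integrable cell (EFin \o (fun z => W z ^+ 2)) by case: LW.
have i1 : mu2.-integrable cell (EFin \o (fun z => C * h * `|W z|)).
  exact (integrableZl mc (C * h) iaW).
have i2 : mu2.-integrable cell (EFin \o (fun z => l * W z ^+ 2)).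
  exact (integrableZl mc l iW2).
have i3 : mu2.-integrable cell (EFin \o (fun z : T2 => l^-1 * \1_A z)).
  exact (integrableZl mc l^-1 iA).
have i12 : mu2.-integrable cell (EFin \o (fun z => C * h * `|W z| + l * W z ^+ 2)).
  exact (integrableD mc i1 i2).
have i123 : mu2.-integrable cell (EFin \o (fun z => C * h * `|W z| + l * W z ^+ 2 + l^-1 * \1_A z)).
  exact (integrableD mc i12 i3).
have iB : mu2.-integrable cell (EFin \o (fun z => B * (C * h * `|W z| + l * W z ^+ 2 + l^-1 * \1_A z))).
  exact (integrableZl mc B i123).
have pw z : cell z -> `|W z * D z| <= B * (C * h * `|W z| + l * W z ^+ 2 + l^-1 * \1_A z).
  move=> /DB Dz; rewrite normrM.
  apply: le_trans (ler_wpM2l (normr_ge0 (W z)) Dz) _.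
  rewrite mulrCA ler_wpM2l// mulrDr -addrA mulrC lerD// indicE.
  case: (z \in A); last by rewrite !mulr0 addr0 mulr_ge0 ?sqr_ge0// ltW.
  rewrite !mulr1 -(real_normK (num_real (W z))) -subr_ge0.
  (* The square is completed in [|W z|]; the slack [3 / 4 * l^-1] is given away. *)
  have -> : l * `|W z| ^+ 2 + l^-1 - `|W z| =
    l * (`|W z| - (2 * l)^-1) ^+ 2 + 3 / 4 * l^-1 by field; rewrite gt_eqF.
  have l0' := ltW l0.
  apply: addr_ge0; first by rewrite mulr_ge0 ?sqr_ge0.
  by apply: mulr_ge0; [lra|rewrite invr_ge0].
have iWD : mu2.-integrable cell (EFin \o (fun z => W z * D z)).
  apply: (L2M_integrable LW (M := B * (C * h + 1))) => //.
    by rewrite mulr_ge0// addr_ge0// mulr_ge0.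
  move=> z /DB /le_trans; apply; rewrite ler_wpM2l// lerD2l indicE.
  by case: (z \in A).
apply: le_trans (le_normr_Rintegral mc iWD) _.
apply: (@le_trans _ _ (integral2 (fun z => B * (C * h * `|W z| + l * W z ^+ 2 + l^-1 * \1_A z)))).
  by apply: le_integral2 => //; exact: (integrable_abse iWD).
rewrite /integral2 (RintegralZl B mc i123) ler_wpM2l//.
rewrite (RintegralD mc i12 i3) (RintegralD mc i1 i2) (RintegralZl _ mc iaW)
  (RintegralZl _ mc iW2) (RintegralZl _ mc iA) lerD2l.
by rewrite mulrC ler_wpM2r ?invr_ge0 ?(ltW l0)//; exact: integral2_indic.
Qed.

Lemma norm1_le_norm2 W (l : R) : L2 W -> 0 < l -> norm1 W <= l * norm2 W + l^-1.
Proof.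
move=> LW l0.
have mc := @measurable_cell R.
have iW2 : mu2.-integrable cell (EFin \o (fun z => W z ^+ 2)) by case: LW.
have i1 : mu2.-integrable cell (EFin \o (fun _ : T2 => l^-1)).
  by apply: (integrable_cell_bounded (M := `|l^-1|)) => // z _.
have i2 : mu2.-integrable cell (EFin \o (fun z => l * W z ^+ 2)).
  exact (integrableZl mc l iW2).
have i12 : mu2.-integrable cell (EFin \o (fun z => l * W z ^+ 2 + l^-1)).
  exact (integrableD mc i2 i1).
have -> : l^-1 = integral2 (fun _ => l^-1).
  rewrite /integral2 (Rintegral_cst _ mc).
  by rewrite [X in fine X](_ : _ = 1%E) ?mulr1//; exact: mu2_cell.
rewrite /norm2 /integral2 -(RintegralZl _ mc iW2) -(RintegralD mc i2 i1).
apply: le_integral2 => //; first by have := integrable_abse (L2_integrable LW).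
move=> z _; rewrite -(real_normK (num_real (W z))) -subr_ge0.
have -> : l * `|W z| ^+ 2 + l^-1 - `|W z| =
  l * (`|W z| - (2 * l)^-1) ^+ 2 + 3 / 4 * l^-1 by field; rewrite gt_eqF.
have l0' := ltW l0; apply: addr_ge0; first by rewrite mulr_ge0 ?sqr_ge0.
by apply: mulr_ge0; [lra|rewrite invr_ge0].
Qed.

Lemma integrable_abse_cell W : mu2.-integrable cell (EFin \o W) ->
  mu2.-integrable cell (EFin \o (fun z => `|W z|)).
Proof. by move=> /integrable_abse. Qed.

Lemma kerop_bound W K1 K2 B1 B2 x y : L2 W -> bounded01 K1 B1 -> bounded01 K2 B2 ->
  0 <= B1 -> 0 <= B2 -> 0 <= x <= 1 -> 0 <= y <= 1 ->
  `|kerop W K1 K2 x y| <= B1 * B2 * norm1 W.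
Proof.
move=> LW [m1 b1] [m2 b2] B10 B20 x01 y01.
have mc := @measurable_cell R.
have mK : measurable_fun (cell : set T2) (fun z => K1 x z.1 * K2 y z.2).
  apply: measurable_funTS; apply: measurable_prod_fun; exact: measurable_kernel_section.
have bK z : cell z -> `|K1 x z.1 * K2 y z.2| <= B1 * B2.
  by move=> /cell_cc[z1 z2]; rewrite normrM ler_pM// ?b1 ?b2.
have iWK := L2M_integrable LW (mulr_ge0 B10 B20) mK bK.
apply: le_trans (le_normr_Rintegral mc iWK) _.
have iW := integrable_abse_cell (L2_integrable LW).
rewrite -(RintegralZl _ mc iW); apply: le_integral2.
- exact: (integrable_abse iWK).
- exact (integrableZl mc _ iW).
- by move=> z /bK H; rewrite normrM mulrC ler_wpM2r.
Qed.

End KernelOperatorBounds.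

(** * Modulus of continuity of kernel operators *)

Section KernelModulus.
Context {R : realType}.
Local Notation mu := (@lebesgue_measure R).
Local Notation R' := (measurableTypeR R).
Local Notation T2 := (R' * R')%type.
Local Notation mu2 := (mu \x mu)%E.
Implicit Types (K : R -> R -> R) (W : R * R -> R).

(* Lipschitz up to a unit jump of [K x s] across [x = s]. *)
Definition jump_lipschitz K : Prop := forall x x' s, 0 <= x -> x <= x' -> x' <= 1 ->
  0 <= s <= 1 -> `|K x' s - K x s| <= (x' - x) + \1_(`[x, x']%classic) s.

Lemma mu2_strip1 (x x' : R) : x <= x' ->
  (mu2 (cell `&` (`[x, x'] `*` [set: R])) <= (x' - x)%:E)%E.
Proof.
move=> xx'.
apply: (@le_trans _ _ (mu2 (`[x, x'] `*` `]0, 1[))).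
  apply: le_measure; rewrite ?inE.
  - by apply: measurableI; [exact: measurable_cell|exact: measurableX].
  - exact: measurableX.
  - by move=> z [[/= _ ?] [/= ? _]]; split.
rewrite product_measure1E//= !lebesgue_measure_itv/= !lte_fin ltr01 oppr0 adde0 mule1.
by case: ifPn => // _; rewrite lee_fin subr_ge0.
Qed.

Lemma mu2_strip2 (y y' : R) : y <= y' ->
  (mu2 (cell `&` ([set: R] `*` `[y, y'])) <= (y' - y)%:E)%E.
Proof.
move=> yy'.
apply: (@le_trans _ _ (mu2 (`[0, 1[ `*` `[y, y']))).
  apply: le_measure; rewrite ?inE.
  - by apply: measurableI; [exact: measurable_cell|exact: measurableX].
  - exact: measurableX.
  - by move=> z [[/= ? _] [/= _ ?]]; split.
rewrite product_measure1E//= !lebesgue_measure_itv/= !lte_fin ltr01 oppr0 adde0 mul1e.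
by case: ifPn => // _; rewrite lee_fin subr_ge0.
Qed.

Lemma kerop_integrable W K1 K2 B1 B2 x y : L2 W -> bounded01 K1 B1 -> bounded01 K2 B2 ->
  0 <= x <= 1 -> 0 <= y <= 1 ->
  mu2.-integrable cell (EFin \o (fun z => W z * (K1 x z.1 * K2 y z.2))).
Proof.
move=> LW [m1 b1] [m2 b2] x01 y01.
have z01 : 0 <= (0 : R) <= 1 by apply/andP; split.
have B10 : 0 <= B1 := le_trans (normr_ge0 _) (b1 x 0 x01 z01).
have B20 : 0 <= B2 := le_trans (normr_ge0 _) (b2 y 0 y01 z01).
apply: (L2M_integrable LW (mulr_ge0 B10 B20)).
  apply: measurable_funTS; apply: measurable_prod_fun; exact: measurable_kernel_section.
by move=> z /cell_cc[z1 z2]; rewrite normrM ler_pM// ?b1 ?b2.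
Qed.

(** Moving [x] to [x'] changes the kernel by at most [x' - x], plus one unit on the strip between
    the two abscissas, whose measure is at most [x' - x]; [L2_weighted] applies with this strip. *)
Lemma kerop_modulus1 W K1 K2 B1 B2 x x' y (l : R) : L2 W -> bounded01 K1 B1 -> bounded01 K2 B2 ->
  jump_lipschitz K1 -> 0 <= B2 -> 0 < l -> 0 <= x -> x <= x' -> x' <= 1 -> 0 <= y <= 1 ->
  `|kerop W K1 K2 x' y - kerop W K1 K2 x y| <=
  B2 * ((x' - x) * norm1 W + l * norm2 W + (x' - x) / l).
Proof.
move=> LW b1 b2 J1 B20 l0 x0 xx' x'1 y01.
have x01 : 0 <= x <= 1 by rewrite x0 (le_trans xx').
have x'01 : 0 <= x' <= 1 by rewrite x'1 (le_trans x0).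
rewrite /kerop /integral2 -RintegralB; last 3 first.
- exact: measurable_cell.
- exact: kerop_integrable b1 b2 _ _.
- exact: kerop_integrable b1 b2 _ _.
have -> : (fun z : T2 => W z * (K1 x' z.1 * K2 y z.2) - W z * (K1 x z.1 * K2 y z.2)) =
    (fun z => W z * ((K1 x' z.1 - K1 x z.1) * K2 y z.2)).
  by apply/funext => z; ring.
have h0 : 0 <= x' - x by rewrite subr_ge0.
rewrite -[X in X * norm1 W]mul1r.
apply: (@L2_weighted _ W _ (`[x, x'] `*` [set: R])) => //.
- exact: measurableX.
- exact: mu2_strip1.
- apply: measurable_funTS; apply: (@measurable_prod_fun _ (fun s => K1 x' s - K1 x s)).
    by apply: measurable_funB; exact: measurable_kernel_section b1.1.
  exact: measurable_kernel_section b2.1.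
move=> z /cell_cc[z1 z2]; rewrite normrM mulrC mul1r ler_pM//; first exact: b2.2.
have := J1 x x' z.1 x0 xx' x'1 z1; rewrite !indicE.
suff -> : (z \in `[x, x'] `*` [set: R]) = (z.1 \in `[x, x']%classic) by [].
by apply/idP/idP => /set_mem; [case=> ? _; exact: mem_set|move=> ?; apply: mem_set; split].
Qed.

Lemma kerop_modulus2 W K1 K2 B1 B2 x y y' (l : R) : L2 W -> bounded01 K1 B1 -> bounded01 K2 B2 ->
  jump_lipschitz K2 -> 0 <= B1 -> 0 < l -> 0 <= y -> y <= y' -> y' <= 1 -> 0 <= x <= 1 ->
  `|kerop W K1 K2 x y' - kerop W K1 K2 x y| <=
  B1 * ((y' - y) * norm1 W + l * norm2 W + (y' - y) / l).
Proof.
move=> LW b1 b2 J2 B10 l0 y0 yy' y'1 x01.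
have y01 : 0 <= y <= 1 by rewrite y0 (le_trans yy').
have y'01 : 0 <= y' <= 1 by rewrite y'1 (le_trans y0).
rewrite /kerop /integral2 -RintegralB; last 3 first.
- exact: measurable_cell.
- exact: kerop_integrable b1 b2 _ _.
- exact: kerop_integrable b1 b2 _ _.
have -> : (fun z : T2 => W z * (K1 x z.1 * K2 y' z.2) - W z * (K1 x z.1 * K2 y z.2)) =
    (fun z => W z * (K1 x z.1 * (K2 y' z.2 - K2 y z.2))).
  by apply/funext => z; ring.
have h0 : 0 <= y' - y by rewrite subr_ge0.
rewrite -[X in X * norm1 W]mul1r.
apply: (@L2_weighted _ W _ ([set: R] `*` `[y, y'])) => //.
- exact: measurableX.
- exact: mu2_strip2.
- apply: measurable_funTS; apply: (@measurable_prod_fun _ _ (fun s => K2 y' s - K2 y s)).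
    exact: measurable_kernel_section b1.1.
  by apply: measurable_funB; exact: measurable_kernel_section b2.1.
move=> z /cell_cc[z1 z2]; rewrite normrM mul1r ler_pM//; first exact: b1.2.
have := J2 y y' z.2 y0 yy' y'1 z2; rewrite !indicE.
suff -> : (z \in [set: R] `*` `[y, y']) = (z.2 \in `[y, y']%classic) by [].
by apply/idP/idP => /set_mem; [case=> _ ?; exact: mem_set|move=> ?; apply: mem_set; split].
Qed.

Definition unif01 (g : R -> R -> R) : Prop := forall e, 0 < e -> exists2 d : R, 0 < d &
  forall x x' y y', 0 <= x <= 1 -> 0 <= x' <= 1 -> 0 <= y <= 1 -> 0 <= y' <= 1 ->
    `|x' - x| < d -> `|y' - y| < d -> `|g x' y' - g x y| <= e.

Lemma kerop_unif W K1 K2 B1 B2 : L2 W -> bounded01 K1 B1 -> bounded01 K2 B2 ->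
  jump_lipschitz K1 -> jump_lipschitz K2 -> 0 <= B1 -> 0 <= B2 -> unif01 (kerop W K1 K2).
Proof.
move=> LW b1 b2 J1 J2 B10 B20 e e0.
pose B := B1 + B2 + 1; pose N := norm1 W; pose Q := norm2 W.
have B0 : 0 < B by rewrite /B ltr_wpDl// addr_ge0.
have N0 : 0 <= N := norm1_ge0 W; have Q0 : 0 <= Q := norm2_ge0 W.
have Q1 : 0 < Q + 1 by rewrite ltr_wpDl.
(* [l] is fixed first, so that [B * (l * Q)] is at most [e / 4]; then [d], which depends on [1 / l],
   so that the two other terms add up to at most [e / 4]. The two coordinates are moved in turn,
   each at a cost of [e / 2]. *)
pose l := e / (4 * B * (Q + 1)).
have l0 : 0 < l by rewrite divr_gt0// mulr_gt0// mulr_gt0.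
have lQ : B * (l * Q) <= e / 4.
  rewrite (_ : B * (l * Q) = e / 4 * (Q / (Q + 1))); last first.
    by rewrite /l; field; rewrite !gt_eqF.
  rewrite -[leRHS]mulr1 ler_wpM2l// ?ler_pdivrMr ?mul1r ?lerDl//.
  by rewrite divr_ge0 ?ltW.
pose d := e / (4 * B * (N + l^-1)).
have li0 : 0 < l^-1 by rewrite invr_gt0.
have Nl : 0 < N + l^-1 by rewrite ltr_wpDl.
have d0 : 0 < d by rewrite divr_gt0// mulr_gt0// mulr_gt0.
have key (h C : R) : 0 <= h -> h < d -> 0 <= C <= B -> C * (h * N + l * Q + h / l) <= e / 2.
  move=> h0 hd /andP[C0 CB].
  apply: (@le_trans _ _ (B * (h * N + l * Q + h / l))).
    rewrite ler_wpM2r//; have l0' := ltW l0; have li0' := ltW li0.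
    by apply: addr_ge0; [apply: addr_ge0|]; exact: mulr_ge0.
  rewrite (_ : B * _ = B * (l * Q) + B * (h * (N + l^-1))); last by ring.
  have : B * (h * (N + l^-1)) <= B * (d * (N + l^-1)).
    by rewrite ler_wpM2l ?(ltW B0)// ler_wpM2r ?(ltW Nl)// ltW.
  have -> : B * (d * (N + l^-1)) = e / 4.
    by rewrite /d; move: (N + l^-1) Nl => M M0; field; rewrite !gt_eqF.
  lra.
exists d => // x x' y y' x01 x'01 y01 y'01 xd yd.
have C1 : 0 <= B1 <= B by rewrite B10 /B; lra.
have C2' : 0 <= B2 <= B by rewrite B20 /B; lra.
have S1 : `|kerop W K1 K2 x' y' - kerop W K1 K2 x y'| <= e / 2.
  wlog xx' : x x' x01 x'01 xd / x <= x' => [H|].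
    have [xx'|/ltW x'x] := leP x x'; first exact: H.
    by rewrite distrC; apply: H => //; rewrite distrC.
  move: x01 x'01 => /andP[x0 _] /andP[_ x1].
  apply: le_trans (kerop_modulus1 LW b1 b2 J1 B20 l0 x0 xx' x1 y'01) _.
  by apply: key; rewrite ?subr_ge0// -[ltLHS]ger0_norm ?subr_ge0.
have S2 : `|kerop W K1 K2 x y' - kerop W K1 K2 x y| <= e / 2.
  wlog yy' : y y' y01 y'01 yd {S1} / y <= y' => [H|].
    have [yy'|/ltW y'y] := leP y y'; first exact: H.
    by rewrite distrC; apply: H => //; rewrite distrC.
  move: y01 y'01 => /andP[y0 _] /andP[_ y1].
  apply: le_trans (kerop_modulus2 LW b1 b2 J2 B10 l0 y0 yy' y1 x01) _.
  by apply: key; rewrite ?subr_ge0// -[ltLHS]ger0_norm ?subr_ge0.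
rewrite -(subrKA (kerop W K1 K2 x y')) (le_trans (ler_normD _ _))//.
by rewrite [e]splitr lerD.
Qed.

End KernelModulus.

Section PlaneLebesgue.
Context {R : realType}.
Local Notation mu := (@lebesgue_measure R).
Local Notation R' := (measurableTypeR R).
Local Notation T2 := (R' * R')%type.

(* The library's instances leave [mu \x mu] without a usable sigma-finite
   structure: the one for subprobabilities shadows it. *)
Definition lebesgue2 : set T2 -> \bar R := (mu \x mu)%E.

HB.instance Definition _ := Measure.on lebesgue2.

Let sigma_finite_lebesgue2 : sigma_finite [set: T2] lebesgue2.
Proof.
have /sigma_finiteP[F [TF ndF Foo]] := sigma_finiteT mu.
exists (fun n => F n `*` F n).
  rewrite -setXTT TF predeqE => -[x y]; split.
    move=> [/= [n _ Fnx] [k _ Fky]]; exists (maxn n k) => //; split.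
    - by move: x Fnx; exact/subsetPset/ndF/leq_maxl.
    - by move: y Fky; exact/subsetPset/ndF/leq_maxr.
  by move=> [n _ []/= ? ?]; split; exists n.
move=> k; have [? ?] := Foo k.
split; first exact: measurableX.
by rewrite /lebesgue2 product_measure1E// lte_mul_pinfty// ge0_fin_numE.
Qed.

HB.instance Definition _ :=
  Measure_isSigmaFinite.Build _ _ _ lebesgue2 sigma_finite_lebesgue2.

Lemma integral2E (f : R * R -> R) :
  integral2 f = \int[lebesgue2]_(z in (cell : set T2)) f z.
Proof. by []. Qed.

Lemma measurable_continuous1 (f : R -> R) (D : set R') : continuous f -> measurable_fun D f.
Proof. by move=> cf; apply: measurable_funTS; exact: continuous_measurable_fun. Qed.

Lemma continuous_bounded01 (f : R -> R) : continuous f ->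
  exists2 M : R, 0 < M & forall x, 0 <= x <= 1 -> `|f x| <= M.
Proof.
move=> cf.
have cF : C2 (fun x _ : R => f x).
  by move=> q; apply: (continuous_comp (@cvg_fst _ _ _ _ _)); exact: cf.
have [M M0 MP] := C2_bounded cF.
by exists M => // x x01; apply: (MP x 0) => //; apply/andP; split.
Qed.

(** The transpose of a tensor-product kernel acts factor by factor. Fubini on the square of the cell
    puts the pairing with [a] and [b] on the kernels, and the remaining double integral splits into
    [A] and [B]. *)
Lemma kerop_weak (W : R * R -> R) (K1 K2 : R -> R -> R) (B1 B2 : R) (a b A B : R -> R) :
  L2 W -> bounded01 K1 B1 -> bounded01 K2 B2 -> continuous a -> continuous b ->
  (forall s, 0 <= s < 1 -> \int[mu]_(x in `[0, 1[) (a x * K1 x s) = A s) ->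
  (forall r, 0 < r < 1 -> \int[mu]_(y in `]0, 1[) (b y * K2 y r) = B r) ->
  integral2 (fun z => kerop W K1 K2 z.1 z.2 * (a z.1 * b z.2)) =
  integral2 (fun z => W z * (A z.1 * B z.2)).
Proof.
move=> LW b1 b2 ca cb hA hB.
have mc : measurable (cell : set T2) by exact: measurable_cell.
have z01 : 0 <= (0 : R) <= 1 by apply/andP; split.
have B10 : 0 <= B1 := le_trans (normr_ge0 _) (b1.2 0 0 z01 z01).
have B20 : 0 <= B2 := le_trans (normr_ge0 _) (b2.2 0 0 z01 z01).
have [Ma Ma0 aM] := continuous_bounded01 ca.
have [Mb Mb0 bM] := continuous_bounded01 cb.
pose H (p : T2 * T2) := (a p.1.1 * K1 p.1.1 p.2.1) * (b p.1.2 * K2 p.1.2 p.2.2).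
have mH : measurable_fun [set: T2 * T2] H.
  have m11 : measurable_fun [set: T2 * T2] (fun p : T2 * T2 => p.1.1).
    exact: measurableT_comp measurable_fst measurable_fst.
  have m12 : measurable_fun [set: T2 * T2] (fun p : T2 * T2 => p.1.2).
    exact: measurableT_comp measurable_snd measurable_fst.
  have m21 : measurable_fun [set: T2 * T2] (fun p : T2 * T2 => p.2.1).
    exact: measurableT_comp measurable_fst measurable_snd.
  have m22 : measurable_fun [set: T2 * T2] (fun p : T2 * T2 => p.2.2).
    exact: measurableT_comp measurable_snd measurable_snd.
  apply: measurable_funM; apply: measurable_funM.
  - exact: measurableT_comp (measurable_continuous1 ca) m11.
  - exact: (measurableT_comp b1.1 (measurable_fun_pair m11 m21)).
  - exact: measurableT_comp (measurable_continuous1 cb) m12.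
  - exact: (measurableT_comp b2.1 (measurable_fun_pair m12 m22)).
have HM z z' : cell z -> cell z' -> `|H (z, z')| <= Ma * B1 * (Mb * B2).
  move=> /cell_cc[z1 z2] /cell_cc[z1' z2']; rewrite /H/= !normrM.
  by rewrite !ler_pM ?mulr_ge0//= ?aM ?bM ?b1.2 ?b2.2.
have iW : lebesgue2.-integrable (cell : set T2) (EFin \o W) by exact: L2_integrable LW.
have M0 : 0 <= Ma * B1 * (Mb * B2) by rewrite !mulr_ge0// ltW.
have c1 : (lebesgue2 (cell : set T2) < +oo)%E by exact: mu2_cell_lty.
have E := @Rintegral_kernel _ _ T2 T2 R lebesgue2 lebesgue2 cell cell mc mc W H _ c1 iW M0 mH HM.
transitivity (\int[lebesgue2]_(z in (cell : set T2)) \int[lebesgue2]_(z' in (cell : set T2)) (W z' * H (z, z'))).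
  rewrite integral2E; apply: eq_Rintegral => z /set_mem /cell_cc[z1 z2].
  rewrite /kerop integral2E -RintegralZr; [|exact: mc|exact: kerop_integrable b1 b2 _ _].
  by apply: eq_Rintegral => z' _; rewrite /H /=; ring.
rewrite {}E integral2E; apply: eq_Rintegral => z' /set_mem zc; congr (_ * _).
have [/hA <- /hB <-] := (cellP z').1 zc; have [z1 z2] := cell_cc zc.
rewrite -(@integral2_prod _ (fun x => a x * K1 x z'.1) (fun y => b y * K2 y z'.2) (Ma * B1) (Mb * B2))//.
- apply: measurable_funM; [exact: measurable_continuous1|exact: measurable_kernel_sectionr b1.1].
- apply: measurable_funM; [exact: measurable_continuous1|exact: measurable_kernel_sectionr b2.1].
- by move=> x x01; rewrite normrM ler_pM ?aM ?b1.2.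
- by move=> x x01; rewrite normrM ler_pM ?bM ?b2.2.
Qed.

End PlaneLebesgue.

(** * The kernels of the representation formula *)

Section Kernels.
Context {R : realType}.
Local Notation mu := (@lebesgue_measure R).
Local Notation R' := (measurableTypeR R).
Local Notation T2 := (R' * R')%type.
Implicit Types (a b : R -> R).

Lemma smooth_periodic_cst (c : R) : smooth_periodic (fun=> c).
Proof. by split=> //; exact: smooth_cst. Qed.

(** The increment over one period has zero derivative and equals [prim f 1] at [0]. *)
Lemma prim_periodic (f : R -> R) : continuous f -> (forall x, f (x + 1) = f x) ->
  prim f 1 = 0 -> forall x, prim f (x + 1) = prim f x.
Proof.
move=> cf pf f0 x.
have D (z : R) : is_derive z 1 (fun z => prim f (z + 1) - prim f z) (0 : R).
  have Dz := prim_is_derive z cf.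
  have D1 := prim_is_derive (z + 1) cf; rewrite pf in D1.
  rewrite -[X in is_derive _ _ _ X](subrr (f z)); apply: is_deriveB.
  have Ds : is_derive z 1 (fun z : R => z + 1) 1.
    by rewrite -[X in is_derive _ _ _ X]addr0; exact: is_deriveD.
  have := @is_derive1_comp _ (prim f) (fun z => z + 1) z _ 1 D1 Ds.
  by rewrite mulr1.
have /= := is_derive_0_is_cst x 0 D.
by rewrite add0r prim0 f0 subrr => /eqP; rewrite subr_eq0 => /eqP.
Qed.

Lemma smooth_periodic_prim a : smooth_periodic a -> prim a 1 = 0 -> smooth_periodic (prim a).
Proof.
move=> [sa pa] a0; split; first exact: smooth_prim.
by apply: prim_periodic => //; exact: smooth_continuous.
Qed.

Lemma prim_vanish b (x y : R) : continuous b -> x <= y ->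
  (forall z, x <= z <= y -> b z = 0) -> prim b x = prim b y.
Proof.
move=> cb xy b0; apply/esym/isD_cst_itv => // z /b0 <-.
exact: prim_isD.
Qed.

(** The primitive is constant on each side of the support of [b]: zero on the left, and the total
    integral, assumed zero, on the right. *)
Lemma smooth_compact_prim b : smooth_compact b -> prim b 1 = 0 -> smooth_compact (prim b).
Proof.
move=> [sb [d d0 bd]] b10; have cb := smooth_continuous sb.
have b0 z : z < d \/ 1 - d < z -> b z = 0.
  by move=> H; apply/eqP; apply: contraT => /bd /andP[]; case: H; lra.
split; first exact: smooth_prim.
exists (d / 2); first by rewrite divr_gt0.
move=> y; apply: contraNT; rewrite negb_and -!ltNge => /orP[yd|yd]; apply/eqP.
  rewrite -(prim0 b); have [y0|/ltW y0] := leP y 0.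
    by apply: prim_vanish => // z /andP[_ z0]; apply: b0; left; lra.
  by apply/esym/prim_vanish => // z /andP[_ z0]; apply: b0; left; lra.
rewrite -b10; have [y1|/ltW y1] := leP y 1.
  by apply: prim_vanish => // z /andP[z0 _]; apply: b0; right; lra.
by apply/esym/prim_vanish => // z /andP[z0 _]; apply: b0; right; lra.
Qed.

Lemma smooth_compactB b b' : smooth_compact b -> smooth_compact b' ->
  smooth_compact (fun y => b y - b' y).
Proof.
move=> [sb [d d0 bd]] [sb' [d' d'0 bd']]; split; first exact: smoothB.
exists (Num.min d d'); first by rewrite lt_min d0.
have m1 : Num.min d d' <= d by rewrite ge_min lexx.
have m2 : Num.min d d' <= d' by rewrite ge_min lexx orbT.
move=> y; have [b0|/bd /andP[? ?] _] := eqVneq (b y) 0; last by apply/andP; split; lra.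
have [b'0|/bd' /andP[? ?] _] := eqVneq (b' y) 0; last by apply/andP; split; lra.
by rewrite b0 b'0 subrr eqxx.
Qed.

Lemma smooth_compactZ c b : smooth_compact b -> smooth_compact (fun y => c * b y).
Proof.
move=> [sb [d d0 bd]]; split; first by apply: smoothM => //; exact: smooth_cst.
by exists d => // y; rewrite mulf_eq0 negb_or => /andP[_ /bd].
Qed.

Let bump0 : R -> R := bump_y (4^-1) (3 / 4).

Let bump0_smooth : smooth_compact bump0.
Proof. by apply: bump_y_smooth; lra. Qed.

Let bump0_int : 0 < prim bump0 1.
Proof.
have cb := smooth_continuous bump0_smooth.1.
have c0 : continuous (fun _ : R => 0 : R) by exact: cst_continuous.
rewrite lt_def; apply/andP; split; last first.
  rewrite -[leLHS](mul0r (1 : R)) -(@prim_cst _ 0)//.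
  by apply: prim_le => // r _; exact: bump_y_ge0.
apply/eqP => p0.
have := prim_ge0_eq0 cb ler01 (fun r _ => bump_y_ge0 _ _ r) p0 (r := 2^-1).
have H : 0 < (2^-1 : R) < 1 by apply/andP; split; lra.
move=> /(_ H) b0; have : 0 < bump0 2^-1.
  by rewrite bump_y_gt0; [apply/andP; split; lra|lra].
by rewrite b0 ltxx.
Qed.

(** A weight of unit mass supported inside [(0, 1)]. Subtracting [prim b 1 * eta] from a test
    function [b] gives it mean zero, so that its primitive is again compactly supported. *)
Definition eta : R -> R := fun y => (prim bump0 1)^-1 * bump0 y.

Lemma eta_smooth : smooth_compact eta.
Proof. exact: smooth_compactZ. Qed.

Lemma eta_continuous : continuous eta.
Proof. exact: smooth_continuous eta_smooth.1. Qed.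

Lemma eta_ge0 y : 0 <= eta y.
Proof. by rewrite mulr_ge0 ?bump_y_ge0// invr_ge0 ltW. Qed.

Lemma prim_eta1 : prim eta 1 = 1.
Proof.
rewrite /eta primZ//; first by rewrite mulVf// gt_eqF.
exact: smooth_continuous bump0_smooth.1.
Qed.

Lemma prim_eta01 y : 0 <= y <= 1 -> 0 <= prim eta y <= 1.
Proof.
move=> /andP[y0 y1]; have c0 : continuous (fun _ : R => 0 : R) by exact: cst_continuous.
have ce := eta_continuous; apply/andP; split.
  rewrite -[leLHS](mul0r y) -(@prim_cst _ 0)//.
  by apply: prim_le => // r _; exact: eta_ge0.
rewrite -subr_ge0 -{1}prim_eta1 -Rintegral_prim//.
by apply: Rintegral_ge0 => r _; exact: eta_ge0.
Qed.

(* [f x = int f - int f' k_x] for a 1-periodic [f], and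
   [f y = int f eta - int f' k_y] on [0, 1]. *)
Definition k_one (_ _ : R) : R := 1.
Definition k_eta (_ r : R) : R := eta r.
Definition k_x (x s : R) : R := (x <= s)%R%:R + (x - s - 2^-1).
Definition k_y (y r : R) : R := (y <= r)%R%:R - prim eta r.

Lemma measurable_le_kernel : measurable_fun [set: T2] (fun q : T2 => (q.1 <= q.2)%R%:R : R).
Proof.
have m : measurable [set q : T2 | q.1 <= q.2].
  rewrite -[X in measurable X]setTI.
  by apply: measurable_fun_le.
rewrite (_ : (fun q : T2 => _) = \1_[set q : T2 | q.1 <= q.2]); first exact: measurable_indic.
by apply/funext => q; rewrite indicE mem_setE.
Qed.

Lemma le_kernel_jump (x x' s : R) : x <= x' ->
  `|(x' <= s)%R%:R - (x <= s)%R%:R| <= \1_(`[x, x']%classic) s :> R.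
Proof.
move=> xx'; rewrite indicE mem_setE in_itv/=.
have [x's|sx'] := leP x' s; first by rewrite (le_trans xx' x's) subrr normr0.
by case: (leP x s) => // xs; rewrite ?sub0r ?normrN ?subrr ?normr0 ?normr1 ?(ltW sx').
Qed.

Lemma bounded_k_one : bounded01 k_one 1.
Proof. by split=> [|x s _ _]; [exact: measurable_cst|rewrite normr1]. Qed.

Lemma jump_k_one : jump_lipschitz k_one.
Proof. by move=> x x' s _ xx' _ _; rewrite subrr normr0 addr_ge0 ?subr_ge0. Qed.

Lemma bounded_k_eta : exists2 B : R, 0 < B & bounded01 k_eta B.
Proof.
have [B B0 BP] := continuous_bounded01 eta_continuous; exists B => //.
split=> [|x s _]; last exact: BP.
exact: measurableT_comp (measurable_continuous1 eta_continuous) measurable_snd.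
Qed.

Lemma jump_k_eta : jump_lipschitz k_eta.
Proof. by move=> x x' s _ xx' _ _; rewrite subrr normr0 addr_ge0 ?subr_ge0. Qed.

Lemma bounded_k_x : bounded01 k_x 3.
Proof.
split.
  apply: measurable_funD; first exact: measurable_le_kernel.
  by apply: measurable_funB => //; apply: measurable_funB; [exact: measurable_fst|exact: measurable_snd].
move=> x s /andP[x0 x1] /andP[s0 s1]; rewrite /k_x ler_norml.
by case: (x <= s); rewrite /= ?mulr0n ?mulr1n; apply/andP; split; lra.
Qed.

Lemma jump_k_x : jump_lipschitz k_x.
Proof.
move=> x x' s _ xx' _ _; have := le_kernel_jump s xx'.
rewrite /k_x => H.
have -> : (x' <= s)%R%:R + (x' - s - 2^-1) - ((x <= s)%R%:R + (x - s - 2^-1)) =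
  (x' - x) + ((x' <= s)%R%:R - (x <= s)%R%:R) by ring.
by rewrite (le_trans (ler_normD _ _))// lerD// ger0_norm ?subr_ge0.
Qed.

Lemma bounded_k_y : bounded01 k_y 1.
Proof.
split.
  apply: measurable_funB; first exact: measurable_le_kernel.
  exact: measurableT_comp (measurable_continuous1 (continuous_prim eta_continuous)) measurable_snd.
move=> y r _ /prim_eta01/andP[e0 e1]; rewrite /k_y ler_norml.
by case: (y <= r); rewrite /= ?mulr0n ?mulr1n; apply/andP; split; lra.
Qed.

Lemma jump_k_y : jump_lipschitz k_y.
Proof.
move=> y y' r _ yy' _ _; have := le_kernel_jump r yy'.
move=> H; have -> : k_y y' r - k_y y r = (y' <= r)%R%:R - (y <= r)%R%:R.
  by rewrite /k_y; ring.
by apply: le_trans H _; rewrite lerDr subr_ge0.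
Qed.

(** The unit drop of the indicator makes up for the growth of [x] over one period; this needs
    [s < 1], as the indicator at [x = 1] must be zero. *)
Lemma k_x_periodic s : 0 <= s < 1 -> k_x 0 s = k_x 1 s.
Proof. by move=> /andP[s0 s1]; rewrite /k_x s0 (lt_geF s1)/=; ring. Qed.

Lemma Rintegral_co_le (a : R -> R) (s : R) : continuous a -> 0 <= s < 1 ->
  \int[mu]_(x in `[0, 1[) (a x * (x <= s)%R%:R) = prim a s.
Proof.
move=> ca /andP[s0 s1].
transitivity (\int[mu]_(x in `[0, s]) a x); last by rewrite Rintegral_prim// prim0 subr0.
have -> : [set` `[0, s]] = `[0, 1[ `&` [set x | x <= s].
  apply/seteqP; split=> x /=; rewrite !in_itv/=; last by move=> [/andP[-> _] ->].
  by move=> /andP[-> xs]; rewrite xs (le_lt_trans xs).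
rewrite Rintegral_mkcondr; apply: eq_Rintegral => x _.
rewrite patchE; case: ifPn => [/set_mem/= ->|xs]; first by rewrite mulr1.
    by rewrite (negbTE (_ : ~~ (x <= s)%R)) ?mulr0//; apply: contra xs => ?; exact: mem_set.
Qed.

Lemma Rintegral_oo_le (b : R -> R) (r : R) : continuous b -> 0 < r < 1 ->
  \int[mu]_(y in `]0, 1[) (b y * (y <= r)%R%:R) = prim b r.
Proof.
move=> cb /andP[r0 r1].
transitivity (\int[mu]_(y in `]0, r]) b y).
  have -> : [set` `]0, r]] = `]0, 1[ `&` [set y | y <= r].
    apply/seteqP; split=> x /=; rewrite !in_itv/=; last by move=> [/andP[-> _] ->].
    by move=> /andP[-> xs]; rewrite xs (le_lt_trans xs).
  rewrite Rintegral_mkcondr; apply: eq_Rintegral => x _.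
  rewrite patchE; case: ifPn => [/set_mem/= ->|xs]; first by rewrite mulr1.
    by rewrite (negbTE (_ : ~~ (x <= r)%R)) ?mulr0//; apply: contra xs => ?; exact: mem_set.
rewrite Rintegral_itv_obnd_cbnd ?Rintegral_prim ?prim0 ?subr0 ?ltW//.
apply: integrableS (continuous_integrable_itv 0 r cb) => //.
by apply: subset_itvr; rewrite bnd_simp.
Qed.

End Kernels.

(** * Sobolev embedding *)

Section Gluing.
Context {R : realType}.
Implicit Types (g : R -> R -> R) (x y e : R).

Definition clamp (T x : R) : R := Num.max 0 (Num.min T x).

Lemma clamp_itv T x : 0 <= T -> 0 <= clamp T x <= T.
Proof. by move=> T0; rewrite /clamp le_max lexx/= ge_max T0 ge_min lexx. Qed.

Lemma clamp_id T x : 0 <= x <= T -> clamp T x = x.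
Proof. by move=> /andP[x0 xT]; rewrite /clamp min_r// max_r. Qed.

Lemma clamp_lipschitz T x y : `|clamp T x - clamp T y| <= `|x - y|.
Proof.
wlog xy : x y / x <= y => [H|].
  by have [/H//|/ltW/H] := leP x y; rewrite distrC (distrC y).
have [m1 m2] : Num.min T x <= Num.min T y /\ Num.min T y <= Num.min T x + (y - x).
  by case: (leP T x) => ?; case: (leP T y) => ?; split; lra.
rewrite [leRHS]distrC (ger0_norm (x:=y - x)) ?subr_ge0// ler_norml /clamp.
move: m1 m2; set u := Num.min T x; set v := Num.min T y => m1 m2.
by case: (leP 0 u) => ?; case: (leP 0 v) => ?; apply/andP; split; lra.
Qed.

Lemma continuous_clamp T : continuous (clamp T).
Proof.
move=> x; apply/cvgrPdist_le => e e0.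
have H : \forall x' \near x, `|x - x'| < e by exact: nbhsx_ballx.
by apply: filterS H => x' /ltW; apply: le_trans; exact: clamp_lipschitz.
Qed.

Lemma unif01_clamp g : unif01 g -> C2 (fun x y => g (clamp 1 x) (clamp 1 y)).
Proof.
move=> ug -[x y]; apply/cvgrPdist_le => e e0.
have [d d0 dP] := ug e e0.
have xd : \forall x' \near x, `|x - x'| < d by exact: nbhsx_ballx.
have yd : \forall y' \near y, `|y - y'| < d by exact: nbhsx_ballx.
near=> q.
rewrite distrC; apply: dP; rewrite ?clamp_itv//.
  apply: le_lt_trans (clamp_lipschitz _ _ _) _; rewrite distrC.
  by near: q; exact: cvg_fst xd.
apply: le_lt_trans (clamp_lipschitz _ _ _) _; rewrite distrC.
by near: q; exact: cvg_snd yd.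
Unshelve. all: by end_near. Qed.

Lemma unif01D g g' : unif01 g -> unif01 g' -> unif01 (fun x y => g x y + g' x y).
Proof.
move=> ug ug' e e0; have e2 : 0 < e / 2 by rewrite divr_gt0.
have [d d0 dP] := ug _ e2; have [d' d'0 dP'] := ug' _ e2.
exists (Num.min d d'); first by rewrite lt_min d0.
move=> x x' y y' x01 x'01 y01 y'01; rewrite !lt_min => /andP[xd xd'] /andP[yd yd'].
rewrite opprD addrACA (le_trans (ler_normD _ _))// [e]splitr lerD//.
  exact: dP.
exact: dP'.
Qed.

Lemma unif01N g : unif01 g -> unif01 (fun x y => - g x y).
Proof.
move=> ug e e0; have [d d0 dP] := ug e e0; exists d => // x x' y y' *.
by rewrite -opprD normrN dP.
Qed.

Lemma unif01B g g' : unif01 g -> unif01 g' -> unif01 (fun x y => g x y - g' x y).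
Proof. by move=> ug ug'; apply: unif01D => //; exact: unif01N. Qed.

Definition fracp x : R := x - (Num.floor x)%:~R.

Lemma fracp_itv x : 0 <= fracp x < 1.
Proof. by rewrite /fracp subr_ge0 floor_le/= ltrBlDl -intrD1 floorD1_gt. Qed.

Lemma fracpD1 x : fracp (x + 1) = fracp x.
Proof. by rewrite /fracp floorDrz ?floor1 ?intrD//; ring. Qed.

Lemma fracp_id x : 0 <= x < 1 -> fracp x = x.
Proof.
move=> x01; rewrite /fracp (_ : Num.floor x = 0) ?subr0//.
by apply: floor_def; rewrite add0r.
Qed.

(** Only the integers, where [fracp] jumps, are at issue. Abscissas less than [1] apart have equal
    or consecutive integer parts, and in the second case the values of [g] at the abscissas [0] and
    [1] agree. *)
Lemma unif01_glue g : unif01 g -> (forall y, 0 <= y <= 1 -> g 0 y = g 1 y) ->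
  C2 (fun x y => g (fracp x) (clamp 1 y)).
Proof.
move=> ug per -[x0 y0]; apply/cvgrPdist_le => e e0.
have e2 : 0 < e / 2 by rewrite divr_gt0.
have [d d0 dP] := ug _ e2.
pose d1 := Num.min d 1.
have d1d : d1 <= d by rewrite ge_min lexx.
have d11 : d1 <= 1 by rewrite ge_min lexx orbT.
have d10 : 0 < d1 by rewrite lt_min d0 ltr01.
have fr x : 0 <= fracp x <= 1 by have /andP[-> /ltW ->] := fracp_itv x.
have z01 : 0 <= (0 : R) <= 1 by apply/andP; split.
have o01 : 0 <= (1 : R) <= 1 by apply/andP; split.
suff key x x' y y' : x <= x' -> `|x' - x| < d1 -> 0 <= y <= 1 -> 0 <= y' <= 1 -> `|y' - y| < d ->
    `|g (fracp x') y' - g (fracp x) y| <= e.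
  have xd : \forall x \near x0, `|x0 - x| < d1 by exact: nbhsx_ballx.
  have yd : \forall y \near y0, `|y0 - y| < d by exact: nbhsx_ballx.
  near=> q.
  have xq : `|x0 - q.1| < d1 by near: q; exact: cvg_fst xd.
  have yq : `|clamp 1 y0 - clamp 1 q.2| < d.
    apply: le_lt_trans (clamp_lipschitz _ _ _) _.
    by near: q; exact: cvg_snd yd.
  have [xx|/ltW xx] := leP x0 q.1; last by apply: key; rewrite ?clamp_itv.
  by rewrite distrC; apply: key; rewrite ?clamp_itv// distrC.
move=> xx' xd y01 y'01 yd.
have xd' : x' - x < d1 by move: xd; rewrite ger0_norm ?subr_ge0.
have f1 := le_floor xx'.
have /andP[a1 a2] := fracp_itv x; have /andP[a3 a4] := fracp_itv x'.
have f2 : Num.floor x' <= Num.floor x + 1.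
  rewrite -ltzD1 -(ltr_int R) !intrD; move: a1 a2 a3 a4; rewrite /fracp => *; lra.
have [E|E] : Num.floor x' = Num.floor x \/ Num.floor x' = Num.floor x + 1.
  move: f1; rewrite le_eqVlt => /predU1P[<-|f1]; [by left|right].
  by apply/eqP; rewrite eq_le f2 lezD1.
  apply: (@le_trans _ _ (e / 2)); last lra.
  by apply: dP; rewrite // /fracp E opprB addrA subrK (lt_le_trans xd).
(* An integer is crossed between [x] and [x']: the path reaches it at abscissa [1] and leaves it
   from abscissa [0], at a cost of [e / 2] on each side. *)
rewrite -(subrKA (g 0 y')) (le_trans (ler_normD _ _))// [e]splitr lerD//.
  apply: dP; rewrite // ?subrr ?normr0// subr0 ger0_norm//.
  move: a1 a2 a3 a4; rewrite /fracp E intrD => *; lra.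
rewrite per//; apply: dP => //; rewrite ger0_norm; last by rewrite subr_ge0 ltW.
move: a1 a2 a3 a4; rewrite /fracp E intrD => *; lra.
Unshelve. all: by end_near. Qed.

End Gluing.

(** * Weak derivatives tested against products *)

Section Embedding.
Context {R : realType}.
Local Notation mu := (@lebesgue_measure R).
Local Notation R' := (measurableTypeR R).
Local Notation T2 := (R' * R')%type.
Local Notation mu2 := (mu \x mu)%E.
Implicit Types (f g : R * R -> R) (a b : R -> R).

(** Test functions are restricted to products [a x * b y]: they are rich enough to determine a
    continuous function, and the transposed kernels preserve their form. *)
Definition weakx f g : Prop := forall a b, smooth_periodic a -> smooth_compact b ->
  integral2 (fun z => f z * (derive1 a z.1 * b z.2)) =
  - integral2 (fun z => g z * (a z.1 * b z.2)).

Definition weaky f g : Prop := forall a b, smooth_periodic a -> smooth_compact b ->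
  integral2 (fun z => f z * (a z.1 * derive1 b z.2)) =
  - integral2 (fun z => g z * (a z.1 * b z.2)).

Lemma C2_prod a b : continuous a -> continuous b -> C2 (fun x y => a x * b y).
Proof.
move=> ca cb q; apply: cvgM.
  by apply: (continuous_comp (@cvg_fst _ _ _ _ _)); exact: ca.
by apply: (continuous_comp (@cvg_snd _ _ _ _ _)); exact: cb.
Qed.

Lemma L2_prod_integrable f a b : L2 f -> continuous a -> continuous b ->
  mu2.-integrable cell (EFin \o (fun z => f z * (a z.1 * b z.2))).
Proof.
move=> Lf ca cb; have [M M0 MP] := C2_bounded (C2_prod ca cb).
apply: (L2M_integrable Lf (M := M)); first exact: ltW.
  exact: (@measurable_C2 _ (fun x y => a x * b y) _ (C2_prod ca cb)).
by move=> z /cell_cc[z1 z2]; exact: MP.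
Qed.

Lemma L2_prodB f a a' b b' : L2 f -> continuous a -> continuous a' ->
  continuous b -> continuous b' ->
  integral2 (fun z => f z * (a z.1 * b z.2)) + integral2 (fun z => f z * (a' z.1 * b' z.2)) =
  integral2 (fun z => f z * (a z.1 * b z.2 + a' z.1 * b' z.2)).
Proof.
move=> Lf ca ca' cb cb'; rewrite /integral2 -RintegralD.
- by apply: eq_Rintegral => z _; rewrite mulrDr.
- exact: measurable_cell.
- exact: L2_prod_integrable.
- exact: L2_prod_integrable.
Qed.

(** The fundamental lemma of the calculus of variations, with products of bumps. It suffices to
    exclude positive values, since [- H] satisfies the same hypotheses. *)
Lemma C2_weak_eq0 (H : R -> R -> R) : C2 H ->
  (forall a b, smooth_periodic a -> smooth_compact b ->
    integral2 (fun z => H z.1 z.2 * (a z.1 * b z.2)) = 0) ->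
  forall x y, 0 < x < 1 -> 0 < y < 1 -> H x y = 0.
Proof.
suff pos (H' : R -> R -> R) : C2 H' -> (forall a b, smooth_periodic a -> smooth_compact b ->
    integral2 (fun z => H' z.1 z.2 * (a z.1 * b z.2)) = 0) ->
    forall x y, 0 < x < 1 -> 0 < y < 1 -> ~ 0 < H' x y.
  move=> cH H0 x y x01 y01; have [neg|pos'|//] := ltgtP (H x y) 0; last first.
    by have := pos _ cH H0 _ _ x01 y01 pos'.
  exfalso; apply: (pos (fun x y => - H x y) (C2N cH) _ _ _ x01 y01); last by rewrite oppr_gt0.
  move=> a b sa sb; have := H0 a b sa sb => E.
  transitivity (integral2 (fun z => H z.1 z.2 * ((-1 * a z.1) * b z.2))).
    by apply: eq_integral2 => z _; ring.
  apply: (H0 (fun x => -1 * a x) b) => //; split=> [|z].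
    by apply: smoothM; [exact: smooth_cst|exact: sa.1].
  by rewrite sa.2.
move=> cH H0 x y /andP[x0 x1] /andP[y0 y1] Hxy.
have /cvgrPdist_lt/(_ _ Hxy)/nbhs_ballP[d /= d0 dU] := cH (x, y).
(* Half of the minimum, so that the bumps of half-width [r] are supported in the [d]-ball where [H']
   stays positive and strictly inside the unit square. *)
pose r := Num.min d (Num.min (Num.min x (1 - x)) (Num.min y (1 - y))) / 2.
have r0 : 0 < r by rewrite /r divr_gt0// !lt_min d0 x0 y0 !subr_gt0 x1 y1.
have r2 : r * 2 = Num.min d (Num.min (Num.min x (1 - x)) (Num.min y (1 - y))).
  by rewrite /r mulfVK.
have rd : r * 2 <= d by rewrite r2 ge_min lexx.
have rx : r * 2 <= x by rewrite r2 !ge_min lexx !orbT.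
have rx' : r * 2 <= 1 - x by rewrite r2 !ge_min lexx !orbT.
have ry : r * 2 <= y by rewrite r2 !ge_min lexx !orbT.
have ry' : r * 2 <= 1 - y by rewrite r2 !ge_min lexx !orbT.
pose a := bump_x (x - r) (x + r); pose b := bump_y (y - r) (y + r).
have sa : smooth_periodic a by exact: bump_x_smooth.
have sb : smooth_compact b by apply: bump_y_smooth; lra.
have ca := smooth_continuous sa.1; have cb := smooth_continuous sb.1.
have cHab : C2 (fun x y => H' x y * (a x * b y)).
  by move=> q; apply: cvgM; [exact: cH|exact: C2_prod].
have a_gt0 s : 0 <= s <= 1 -> (0 < a s) = (x - r < s < x + r).
  by move=> s01; rewrite /a bump_x_gt0//; lra.
have b_gt0 s : (0 < b s) = (y - r < s < y + r) by rewrite /b bump_y_gt0//; lra.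
have nonneg s t : 0 <= s <= 1 -> 0 <= H' s t * (a s * b t).
  move=> s01; have a0 : 0 <= a s by exact: bump_x_ge0.
  have b0 : 0 <= b t by exact: bump_y_ge0.
  have [sI|sI] := boolP (x - r < s < x + r); last first.
    have -> : a s = 0 by apply/eqP; rewrite eq_le a0 leNgt a_gt0// sI.
    by rewrite mul0r mulr0.
  have [tI|tI] := boolP (y - r < t < y + r); last first.
    have -> : b t = 0 by apply/eqP; rewrite eq_le b0 leNgt b_gt0// tI.
    by rewrite !mulr0.
  rewrite mulr_ge0 ?mulr_ge0//; move: sI tI => /andP[s1 s2] /andP[t1 t2].
  have : `|H' x y - H' s t| < H' x y.
    apply: (dU (s, t)); split; rewrite /ball/= ltr_distlC.
      by apply/andP; split; clear - s1 s2 rd r0; lra.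
    by apply/andP; split; clear - t1 t2 rd r0; lra.
  by rewrite ltr_distlC subrr => /andP[/ltW].
have I0 : I2 (fun x y => H' x y * (a x * b y)) = 0.
  by rewrite -(H0 a b sa sb); apply/esym/integral2_I2.
(* A nonnegative continuous integrand with zero integral vanishes: this is used in [x] here, and
   once more in [y] at the given point. *)
have inner0 s : 0 < s < 1 -> prim (fun t => H' s t * (a s * b t)) 1 = 0.
  apply: (@prim_ge0_eq0 _ (fun s => prim (fun t => H' s t * (a s * b t)) 1)) => //.
    exact: C2_prim1 cHab.
  move=> z /andP[z0 z1].
  have c0 : continuous (fun _ : R => 0 : R) by exact: cst_continuous.
  rewrite -[leLHS](mul0r (1 : R)) -(@prim_cst _ 0)//.
  apply: prim_le => //; first exact: C2_section cHab.
  by move=> t _; apply: nonneg; rewrite !ltW.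
have x01 : 0 < x < 1 by rewrite x0.
have x01' : 0 <= x <= 1 by rewrite !ltW.
have y01 : 0 < y < 1 by rewrite y0.
have E := prim_ge0_eq0 (C2_section (x := x) cHab) ler01 (fun t _ => nonneg x t x01') (inner0 x x01) y01.
have ax : 0 < a x by rewrite a_gt0//; apply/andP; split; lra.
have by_ : 0 < b y by rewrite b_gt0; apply/andP; split; lra.
have : 0 < H' x y * (a x * b y) by rewrite mulr_gt0// mulr_gt0.
by rewrite E ltxx.
Qed.

End Embedding.

(** * The representation formula and its weak form *)

Section EmbeddingTheorem.
Context {R : realType}.
Local Notation mu := (@lebesgue_measure R).
Local Notation R' := (measurableTypeR R).
Local Notation T2 := (R' * R')%type.
Local Notation mu2 := (mu \x mu)%E.
Implicit Types (f g : R * R -> R) (a b : R -> R).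

(** [Sx] and [Qy] are the transposes of the kernels [k_x] and [k_y]. They are primitives of [a]
    minus its mean and of [b] minus its multiple of [eta], hence again periodic and compactly
    supported; the constant in [Sx] is what the pairing with [k_x] produces. *)
Definition Sx a (s : R) : R :=
  prim (fun x => a x - prim a 1) s + prim (fun x => a x * (x - 2^-1)) 1.
Definition Qy b (r : R) : R := prim (fun y => b y - prim b 1 * eta y) r.

Lemma int_k_one a s : continuous a ->
  \int[mu]_(x in `[0, 1[) (a x * k_one x s) = prim a 1.
Proof.
move=> ca; rewrite -Rintegral_co01//.
by apply: eq_Rintegral => x _; rewrite mulr1.
Qed.

Lemma int_k_eta b r : continuous b ->
  \int[mu]_(y in `]0, 1[) (b y * k_eta y r) = prim b 1 * eta r.
Proof.
move=> cb; rewrite -Rintegral_oo01// -RintegralZr//.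
exact: integrable_oo01.
Qed.

Lemma int_k_x a s : continuous a -> 0 <= s < 1 ->
  \int[mu]_(x in `[0, 1[) (a x * k_x x s) = Sx a s.
Proof.
move=> ca s01; have [M M0 aM] := continuous_bounded01 ca.
have [s0 s1] := andP s01.
have c1 : continuous (fun x : R => x - s - 2^-1).
  by move=> x; apply: cvgB; [apply: cvgB|]; [exact: cvg_id|exact: cvg_cst|exact: cvg_cst].
have c2 : continuous (fun x => a x * (x - s - 2^-1)).
  by move=> x; apply: cvgM; [exact: ca|exact: c1].
have c3 : continuous (fun x => a x * (x - 2^-1)).
  by move=> x; apply: cvgM; [exact: ca|apply: cvgB; [exact: cvg_id|exact: cvg_cst]].
have c4 : continuous (fun x => s * a x).
  by move=> x; apply: cvgM; [exact: cvg_cst|exact: ca].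
have c5 : continuous (fun _ : R => prim a 1) by exact: cst_continuous.
have i1 : mu.-integrable `[0, 1[ (EFin \o (fun x => a x * (x <= s)%R%:R)).
  apply: (@integrable_itv_bounded _ _ _ M); first exact: co01_sub.
    apply: measurable_funM; first exact: measurable_continuous1.
    exact (measurable_kernel_sectionr (K := fun x s => (x <= s)%R%:R) s measurable_le_kernel).
  move=> x x01; rewrite normrM -[leRHS]mulr1 ler_pM ?aM//.
  by case: (x <= s); rewrite /= ?normr1 ?normr0.
rewrite (_ : (fun x => a x * k_x x s) = (fun x => a x * (x <= s)%R%:R + a x * (x - s - 2^-1))); last first.
  by apply/funext => x; rewrite /k_x mulrDr.
rewrite RintegralD//; last exact: integrable_co01.
rewrite Rintegral_co_le// Rintegral_co01// /Sx (primB ca c5)// prim_cst//.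
have -> : (fun x => a x * (x - s - 2^-1)) = (fun x => a x * (x - 2^-1) - s * a x).
  by apply/funext => x; ring.
by rewrite (primB c3 c4)// (primZ _ ca)//; ring.
Qed.

Lemma int_k_y b r : continuous b -> 0 < r < 1 ->
  \int[mu]_(y in `]0, 1[) (b y * k_y y r) = Qy b r.
Proof.
move=> cb r01; have [M M0 bM] := continuous_bounded01 cb.
have [r0 r1] := andP r01.
have c2 : continuous (fun y => b y * prim eta r).
  by move=> x; apply: cvgM; [exact: cb|exact: cvg_cst].
have c3 : continuous (fun y => prim b 1 * eta y).
  by move=> x; apply: cvgM; [exact: cvg_cst|exact: eta_continuous].
have i1 : mu.-integrable `]0, 1[ (EFin \o (fun x => b x * (x <= r)%R%:R)).
  apply: (@integrable_itv_bounded _ _ _ M); first exact: oo01_sub.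
    apply: measurable_funM; first exact: measurable_continuous1.
    exact (measurable_kernel_sectionr (K := fun x s => (x <= s)%R%:R) r measurable_le_kernel).
  move=> x x01; rewrite normrM -[leRHS]mulr1 ler_pM ?bM//.
  by case: (x <= r); rewrite /= ?normr1 ?normr0.
rewrite (_ : (fun x => b x * k_y x r) = (fun x => b x * (x <= r)%R%:R - b x * prim eta r)); last first.
  by apply/funext => x; rewrite /k_y mulrBr.
rewrite RintegralB//; last exact: integrable_oo01.
rewrite Rintegral_oo_le// Rintegral_oo01// /Qy (primB cb c3)// ?(ltW r0)//.
rewrite (primZ _ eta_continuous) ?(ltW r0)//; congr (_ - _).
under [X in prim X]eq_fun do rewrite mulrC.
by rewrite primZ// mulrC.
Qed.

Lemma Sx_smooth a : smooth_periodic a -> smooth_periodic (Sx a).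
Proof.
move=> [sa pa]; have ca := smooth_continuous sa.
have c5 : continuous (fun _ : R => prim a 1) by exact: cst_continuous.
have [s1 p1] : smooth_periodic (prim (fun x => a x - prim a 1)).
  apply: smooth_periodic_prim.
    by split=> [|x]; [apply: smoothB => //; exact: smooth_cst|rewrite pa].
  by rewrite (primB ca c5)// prim_cst// mulr1 subrr.
split=> [|x]; first by apply: smoothD => //; exact: smooth_cst.
by rewrite /Sx p1.
Qed.

Lemma Sx_derive a : smooth_periodic a -> derive1 (Sx a) = (fun x => a x - prim a 1).
Proof.
move=> [sa pa]; apply/funext => x; rewrite derive1E.
have c : continuous (fun x => a x - prim a 1).
  by move=> z; apply: cvgB; [exact: smooth_continuous|exact: cvg_cst].
have D : is_derive x 1 (Sx a) (a x - prim a 1).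
  rewrite -[X in is_derive _ _ _ X]addr0; apply: is_deriveD.
  exact: prim_is_derive c.
by case: D.
Qed.

Lemma Qy_smooth b : smooth_compact b -> smooth_compact (Qy b).
Proof.
move=> sb; have cb := smooth_continuous sb.1.
have c3 : continuous (fun y => prim b 1 * eta y).
  by move=> x; apply: cvgM; [exact: cvg_cst|exact: eta_continuous].
apply: smooth_compact_prim.
  by apply: smooth_compactB => //; apply: smooth_compactZ; exact: eta_smooth.
by rewrite (primB cb c3)// (primZ _ eta_continuous)// prim_eta1 mulr1 subrr.
Qed.

Lemma Qy_derive b : smooth_compact b -> derive1 (Qy b) = (fun y => b y - prim b 1 * eta y).
Proof.
move=> sb; apply/funext => y; rewrite derive1E.
have c : continuous (fun y => b y - prim b 1 * eta y).
  move=> z; apply: cvgB; first exact: (smooth_continuous sb.1).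
  by apply: cvgM; [exact: cvg_cst|exact: eta_continuous].
have D : is_derive y 1 (Qy b) (b y - prim b 1 * eta y) by exact: prim_is_derive c.
by case: D.
Qed.

(* Decompose a test function [a b] as [(m + (Sx a)') (c eta + (Qy b)')]
   and move the derivatives onto [g00]: its primitives only meet
   derivatives of [g00] of order at most one in each variable. *)
Definition sobolev_embed g00 g10 g01 g11 (x y : R) : R :=
  kerop g00 k_one k_eta x y - kerop g10 k_x k_eta x y
  - kerop g01 k_one k_y x y + kerop g11 k_x k_y x y.

Context (g00 g10 g01 g11 : R * R -> R).
Context (L00 : L2 g00) (L10 : L2 g10) (L01 : L2 g01) (L11 : L2 g11).

Let u1 : unif01 (kerop g00 k_one k_eta).
Proof.
have [B B0 bB] := @bounded_k_eta R.
by apply: kerop_unif bounded_k_one bB jump_k_one jump_k_eta _ _ => //; exact: ltW.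
Qed.

Let u2 : unif01 (kerop g10 k_x k_eta).
Proof.
have [B B0 bB] := @bounded_k_eta R.
by apply: kerop_unif bounded_k_x bB jump_k_x jump_k_eta _ _ => //; exact: ltW.
Qed.

Let u3 : unif01 (kerop g01 k_one k_y).
Proof. by apply: kerop_unif bounded_k_one bounded_k_y jump_k_one jump_k_y _ _. Qed.

Let u4 : unif01 (kerop g11 k_x k_y).
Proof. by apply: kerop_unif bounded_k_x bounded_k_y jump_k_x jump_k_y _ _. Qed.

Lemma embed_unif : unif01 (sobolev_embed g00 g10 g01 g11).
Proof. by apply: unif01D u4; apply: unif01B u3; exact: unif01B. Qed.

Lemma embed_periodic y : sobolev_embed g00 g10 g01 g11 0 y = sobolev_embed g00 g10 g01 g11 1 y.
Proof.
by congr (_ - _ - _ + _); apply: eq_integral2 => z /cellP[z1 _]; rewrite ?k_x_periodic.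
Qed.

Let pair_unif (k : R -> R -> R) a b : unif01 k -> continuous a -> continuous b ->
  mu2.-integrable cell (EFin \o (fun z => k z.1 z.2 * (a z.1 * b z.2))).
Proof.
move=> uk ca cb.
have c : C2 (fun x y => k (clamp 1 x) (clamp 1 y) * (a x * b y)).
  by move=> q; apply: cvgM; [exact: (unif01_clamp uk)|exact: (C2_prod ca cb)].
apply: eq_integrable (integrable_C2 c); first exact: measurable_cell.
by move=> z /set_mem /cell_cc[z1 z2]; rewrite /= !clamp_id.
Qed.

(** After transposition every pairing carries [Sx a] or [Qy b] exactly where a derivative of [g00]
    occurs. Integrating by parts, twice for [g11], leaves [g00] paired with the four products of [m]
    or [a - m] with [c eta] or [b - c eta], whose sum is [a b]. *)
Lemma embed_weak a b : weakx g00 g10 -> weaky g00 g01 -> weakx g01 g11 ->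
  smooth_periodic a -> smooth_compact b ->
  integral2 (fun z => sobolev_embed g00 g10 g01 g11 z.1 z.2 * (a z.1 * b z.2)) =
  integral2 (fun z => g00 z * (a z.1 * b z.2)).
Proof.
move=> w10 w01 w11 sa sb.
have ca := smooth_continuous sa.1; have cb := smooth_continuous sb.1.
have mc := @measurable_cell R.
have [B B0 bB] := @bounded_k_eta R.
pose m := prim a 1; pose c := prim b 1.
have sm := @smooth_periodic_cst R m.
have sce : smooth_compact (fun y => c * eta y) by apply: smooth_compactZ; exact: eta_smooth.
have sS := Sx_smooth sa; have sQ := Qy_smooth sb.
have cm := smooth_continuous sm.1; have cce := smooth_continuous sce.1.
have cS := smooth_continuous sS.1; have cQ := smooth_continuous sQ.1.
have E1 : integral2 (fun z => kerop g00 k_one k_eta z.1 z.2 * (a z.1 * b z.2)) =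
    integral2 (fun z => g00 z * (m * (c * eta z.2))).
  apply: (kerop_weak (A := fun=> m) (B := fun r => c * eta r) L00 bounded_k_one bB ca cb) => s _.
    exact: int_k_one.
  exact: int_k_eta.
have E2 : integral2 (fun z => kerop g10 k_x k_eta z.1 z.2 * (a z.1 * b z.2)) =
    integral2 (fun z => g10 z * (Sx a z.1 * (c * eta z.2))).
  apply: (kerop_weak (A := Sx a) (B := fun r => c * eta r) L10 bounded_k_x bB ca cb) => s s01.
    exact: int_k_x.
  exact: int_k_eta.
have E3 : integral2 (fun z => kerop g01 k_one k_y z.1 z.2 * (a z.1 * b z.2)) =
    integral2 (fun z => g01 z * (m * Qy b z.2)).
  apply: (kerop_weak (A := fun=> m) (B := Qy b) L01 bounded_k_one bounded_k_y ca cb) => s s01.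
    exact: int_k_one.
  exact: int_k_y.
have E4 : integral2 (fun z => kerop g11 k_x k_y z.1 z.2 * (a z.1 * b z.2)) =
    integral2 (fun z => g11 z * (Sx a z.1 * Qy b z.2)).
  apply: (kerop_weak (A := Sx a) (B := Qy b) L11 bounded_k_x bounded_k_y ca cb) => s s01.
    exact: int_k_x.
  exact: int_k_y.
have F2 := w10 _ _ sS sce; have F3 := w01 _ _ sm sQ; have F4 := w11 _ _ sS sQ.
(* The second integration by parts for [g11]: once the [x]-derivative is on [Sx a], the
   [y]-derivative goes onto [Qy b]. *)
have sS' := smooth_periodic_derive sS; have F5 := w01 _ _ sS' sQ.
rewrite !(Sx_derive sa) ?(Qy_derive sb) in F2 F3 F4 F5.
have ip k uk := @pair_unif k a b uk ca cb.
have i1 := ip _ u1; have i2 := ip _ u2; have i3 := ip _ u3; have i4 := ip _ u4.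
have i12 := integrableB mc i1 i2; have i123 := integrableB mc i12 i3.
have -> : integral2 (fun z => sobolev_embed g00 g10 g01 g11 z.1 z.2 * (a z.1 * b z.2)) =
    integral2 (fun z => kerop g00 k_one k_eta z.1 z.2 * (a z.1 * b z.2))
    - integral2 (fun z => kerop g10 k_x k_eta z.1 z.2 * (a z.1 * b z.2))
    - integral2 (fun z => kerop g01 k_one k_y z.1 z.2 * (a z.1 * b z.2))
    + integral2 (fun z => kerop g11 k_x k_y z.1 z.2 * (a z.1 * b z.2)).
  rewrite /integral2 -(RintegralB mc i1 i2) -(RintegralB mc i12 i3) -(RintegralD mc i123 i4).
  by apply: eq_Rintegral => z _; rewrite /sobolev_embed; ring.
move/eqP: F2; rewrite -eqr_oppLR => /eqP F2; move/eqP: F3; rewrite -eqr_oppLR => /eqP F3.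
move/eqP: F4; rewrite -eqr_oppLR => /eqP F4.
rewrite E1 E2 E3 E4 -F2 -F3 -F4 -F5 !opprK.
have cS' : continuous (fun x => a x - m).
  by move=> x; apply: cvgB; [exact: ca|exact: cvg_cst].
have cQ' : continuous (fun y => b y - c * eta y).
  by move=> x; apply: cvgB; [exact: cb|exact: cce].
rewrite (L2_prodB L00 cm cS' cce cce) -addrA (L2_prodB L00 cm cS' cQ' cQ').
have ca1 : continuous (fun _ : R => 1 : R) by exact: cst_continuous.
have j1 : mu2.-integrable cell (EFin \o (fun z => g00 z * (a z.1 * (c * eta z.2)))).
  exact (L2_prod_integrable L00 ca cce).
have j2 : mu2.-integrable cell (EFin \o (fun z => g00 z * (a z.1 * (b z.2 - c * eta z.2)))).
  exact (L2_prod_integrable L00 ca cQ').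
rewrite (@eq_integral2 _ _ (fun z => g00 z * (a z.1 * (c * eta z.2)))); last first.
  by move=> z _; ring.
rewrite (@eq_integral2 _ (fun z => g00 z * (m * _ + _)) (fun z => g00 z * (a z.1 * (b z.2 - c * eta z.2)))); last first.
  by move=> z _; ring.
rewrite /integral2 -(RintegralD mc j1 j2); apply: eq_Rintegral => z _.
by ring.
Qed.

End EmbeddingTheorem.

(** * From weak to classical derivatives *)

Section WeakToClassical.
Context {R : realType}.
Implicit Types (F G : R -> R -> R) (a b : R -> R).

Lemma closure_zero (H : R -> R -> R) : C2 H ->
  (forall x y, 0 < x < 1 -> 0 < y < 1 -> H x y = 0) ->
  forall x y, 0 <= x <= 1 -> 0 <= y <= 1 -> H x y = 0.
Proof.
move=> cH H0 x y x01 y01; apply/eqP; apply: contraT; rewrite -normr_gt0 => Hxy.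
have /cvgrPdist_lt/(_ _ Hxy)/nbhs_ballP[d /= d0 dU] := cH (x, y).
pose t := Num.min d 1 / 2.
have td : t * 2 <= d by rewrite /t mulfVK// ge_min lexx.
have t1 : t * 2 <= 1 by rewrite /t mulfVK// ge_min lexx orbT.
have t0 : 0 < t by rewrite /t divr_gt0// lt_min d0 ltr01.
(* Each coordinate is moved slightly towards the centre [1 / 2], into the open interval where [H] is
   known to vanish. *)
have inner z : 0 <= z <= 1 -> 0 < (1 - t) * z + t / 2 < 1 /\ `|z - ((1 - t) * z + t / 2)| < d.
  move=> /andP[z0 z1]; split; first by apply/andP; split; nra.
  by rewrite ltr_distlC; apply/andP; split; nra.
have [x' xd] := inner x x01; have [y' yd] := inner y y01.
have := dU ((1 - t) * x + t / 2, (1 - t) * y + t / 2) (conj xd yd).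
by rewrite /= (H0 _ _ x' y') subr0 ltxx.
Qed.

Lemma periodic_fracp (f : R -> R) : (forall x, f (x + 1) = f x) -> forall x, f x = f (fracp x).
Proof.
move=> pf x.
have pn (n : nat) z : f (z + n%:R) = f z.
  by elim: n => [|n IH]; rewrite ?addr0// -natr1 addrA pf.
rewrite /fracp; case: (Num.floor x) => n; first by rewrite -{1}(subrK n%:R x) pn.
by rewrite NegzE mulrNz opprK -pmulrn pn.
Qed.

Lemma C2D F G : C2 F -> C2 G -> C2 (fun x y => F x y + G x y).
Proof. by move=> cF cG p; apply: cvgD; [exact: cF|exact: cG]. Qed.

Lemma C2B F G : C2 F -> C2 G -> C2 (fun x y => F x y - G x y).
Proof. by move=> cF cG p; apply: cvgB; [exact: cF|exact: cG]. Qed.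

Lemma C2M F G : C2 F -> C2 G -> C2 (fun x y => F x y * G x y).
Proof. by move=> cF cG p; apply: cvgM; [exact: cF|exact: cG]. Qed.

Lemma C2_fst a : continuous a -> C2 (fun x _ : R => a x).
Proof. by move=> ca q; apply: (continuous_comp (@cvg_fst _ _ _ _ _)); exact: ca. Qed.

Lemma C2_snd b : continuous b -> C2 (fun _ y : R => b y).
Proof. by move=> cb q; apply: (continuous_comp (@cvg_snd _ _ _ _ _)); exact: cb. Qed.

(** Subtract from [F] the primitive [P] of [G] in [x], and from the result [D] its mean [k] in [x].
    Testing with the periodic primitive of [a - m] shows that the rest is weakly zero, so
    [F = P + k] on one period; periodicity of [F] then forces that of [P] and the identity extends
    to all [x]. *)
Lemma weakx_classical F G : C2 F -> C2 G ->
  (forall x y, F (x + 1) y = F x y) -> (forall x y, G (x + 1) y = G x y) ->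
  weakx (fun z => F z.1 z.2) (fun z => G z.1 z.2) ->
  forall x y, 0 <= y <= 1 -> isD setT (F ^~ y) x (G x y).
Proof.
move=> cF cG pF pG w.
pose P x y := prim (fun s => G s y) x.
have cP : C2 P by exact: (C2_swap (C2_prim (C2_swap cG))).
have dP x y : isD setT (P ^~ y) x (G x y) by exact: prim_isD (C2_sectionr cG).
pose D x y := F x y - P x y.
have cD : C2 D by exact: C2B.
pose k y := prim (fun s => D s y) 1.
have ck : continuous k by exact: C2_prim1 (C2_swap cD).
pose H x y := D x y - k y.
have cH : C2 H by exact: C2B cD (C2_snd ck).
have H0 : forall x y, 0 < x < 1 -> 0 < y < 1 -> H x y = 0.
  apply: C2_weak_eq0 => // a b sa sb.
  have ca := smooth_continuous sa.1; have cb := smooth_continuous sb.1.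
  pose m := prim a 1; pose S := prim (fun x => a x - m).
  have ca' : continuous (fun x => a x - m).
    by move=> x; apply: cvgB; [exact: ca|exact: cvg_cst].
  have cm : continuous (fun _ : R => m) by exact: cst_continuous.
  have S0 : S 0 = 0 by exact: prim0.
  have S1 : S 1 = 0 by rewrite /S (primB ca cm)// prim_cst// mulr1 subrr.
  have sS : smooth_periodic S.
    apply: smooth_periodic_prim => //; split=> [|x]; last by rewrite sa.2.
    by apply: smoothB sa.1 _; exact: smooth_cst.
  have cS := smooth_continuous sS.1.
  have dS : derive1 S = (fun x => a x - m).
    by apply/funext => x; rewrite derive1E; case: (prim_is_derive x ca').
  have := w S b sS sb; rewrite dS.
  have cFS : C2 (fun x y => F x y * ((a x - m) * b y)) by exact: C2M cF (C2_prod ca' cb).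
  have cGS : C2 (fun x y => G x y * (S x * b y)) by exact: C2M cG (C2_prod cS cb).
  have cPS : C2 (fun x y => P x y * ((a x - m) * b y)) by exact: C2M cP (C2_prod ca' cb).
  rewrite (integral2_I2 cFS)// (integral2_I2 cGS)// => E1.
  have E2 : I2 (fun x y => P x y * ((a x - m) * b y)) = - I2 (fun x y => G x y * (S x * b y)).
    apply/eqP; rewrite -addr_eq0 -I2D//; apply/eqP.
    apply: (@I2_dx _ (fun x y => P x y * (S x * b y))).
    - exact: C2M cP (C2_prod cS cb).
    - exact: C2D.
    - move=> x y _; apply: isD_eq (isDM I (dP x y) (isDM I (prim_isD _ x ca') (isD_cst _ (b y) x))) _.
      by rewrite mulr0 addr0 addrC.
    - by move=> y _; rewrite S1 S0 !mul0r !mulr0.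
  have cHa : C2 (fun x y => H x y * (a x * b y)) by exact: C2M cH (C2_prod ca cb).
  rewrite (integral2_I2 cHa)//.
  have cDb : C2 (fun x y => D x y * b y) by exact: C2M cD (C2_snd cb).
  have ckab : C2 (fun x y => k y * (a x * b y)) by exact: C2M (C2_snd ck) (C2_prod ca cb).
  have cFP := C2B cFS cPS.
  transitivity (I2 (fun x y => F x y * ((a x - m) * b y) - P x y * ((a x - m) * b y)
     + m * (D x y * b y) - k y * (a x * b y))).
    congr I2; apply/funext => x; apply/funext => y; rewrite /H /D; ring.
  have cmD : C2 (fun x y => m * (D x y * b y)).
    exact: C2M (C2_fst cm) cDb.
  rewrite (I2B (C2D cFP cmD) ckab) (I2D cFP cmD) (I2B cFS cPS) E1 E2 subrr add0r (I2Z _ cDb).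
  have ckb : continuous (fun y => k y * b y).
    by move=> y; apply: cvgM; [exact: ck|exact: cb].
  have -> : I2 (fun x y => D x y * b y) = prim (fun y => k y * b y) 1.
    rewrite (I2_swap cDb) /I2; congr prim; apply/funext => y.
    under [X in prim X]eq_fun do rewrite mulrC.
    by rewrite (primZ _ (C2_sectionr cD))// mulrC.
  have -> : I2 (fun x y => k y * (a x * b y)) = m * prim (fun y => k y * b y) 1.
    rewrite /I2 -[RHS]mulrC -(primZ _ ca)//; congr prim; apply/funext => x.
    rewrite mulrC -(primZ _ ckb)//; congr prim; apply/funext => y; ring.
  by rewrite subrr.
have H01 := closure_zero cH H0.
move=> x y y01.
have z01 : 0 <= (0 : R) <= 1 by apply/andP; split.
have o01 : 0 <= (1 : R) <= 1 by apply/andP; split.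
have P1 : P 1 y = 0.
  have F10 : F 1 y = F 0 y by rewrite -[in LHS](add0r 1).
  have := H01 _ _ z01 y01; have := H01 _ _ o01 y01.
  by rewrite /H /D /P prim0 F10 => h0 h1; lra.
have pP := prim_periodic (C2_sectionr (y := y) cG) (fun x => pG x y) P1.
apply: (@eq_isD _ _ (fun x => P x y + k y)).
  move=> s _; rewrite (periodic_fracp (f := fun s => F s y))//.
  rewrite (_ : P s y = P (fracp s) y); last exact: periodic_fracp pP s.
  have /andP[f0 /ltW f1] := fracp_itv s.
  have := H01 (fracp s) y _ y01; rewrite f0 f1 /H /D => /(_ isT).
  by move/eqP; rewrite subr_eq0 subr_eq addrC => /eqP <-.
apply: isD_eq (isDD (dP x y) (isD_cst _ _ _)) _.
by rewrite addr0.
Qed.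

(** The argument in [x] with the [eta]-weighted mean of [D] instead of the plain one, because the
    compactly supported primitive is that of [b - c eta]. The identity holds up to the walls by
    continuity, which gives the one-sided derivatives there. *)
Lemma weaky_classical F G : C2 F -> C2 G ->
  (forall x y, F (x + 1) y = F x y) -> (forall x y, G (x + 1) y = G x y) ->
  weaky (fun z => F z.1 z.2) (fun z => G z.1 z.2) ->
  forall x y, 0 <= y <= 1 -> isD `[0, 1] (F x) y (G x y).
Proof.
move=> cF cG pF pG w.
pose P x y := prim (G x) y.
have cP : C2 P by exact: C2_prim.
have dP S x y : isD S (P x) y (G x y) by exact: prim_isD (C2_section cG).
pose D x y := F x y - P x y.
have cD : C2 D by exact: C2B.
have ceta := @eta_continuous R.
have cDe : C2 (fun x y => D x y * eta y) by exact: C2M cD (C2_snd ceta).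
pose k x := prim (fun r => D x r * eta r) 1.
have ck : continuous k by exact: C2_prim1 cDe.
pose H x y := D x y - k x.
have cH : C2 H by exact: C2B cD (C2_fst ck).
have H0 : forall x y, 0 < x < 1 -> 0 < y < 1 -> H x y = 0.
  apply: C2_weak_eq0 => // a b sa sb.
  have ca := smooth_continuous sa.1; have cb := smooth_continuous sb.1.
  pose c := prim b 1; pose Q := Qy b.
  have sQ := Qy_smooth sb; have cQ := smooth_continuous sQ.1.
  have cce : continuous (fun y => c * eta y).
    by move=> y; apply: cvgM; [exact: cvg_cst|exact: ceta].
  have cb' : continuous (fun y => b y - c * eta y).
    by move=> x; apply: cvgB; [exact: cb|exact: cce].
  have Q0 : Q 0 = 0 by exact: prim0.
  have Q1 : Q 1 = 0 by rewrite /Q /Qy (primB cb cce)// (primZ _ ceta)// prim_eta1 mulr1 subrr.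
  have := w a Q sa sQ; rewrite (Qy_derive sb) -/c.
  have cFQ : C2 (fun x y => F x y * (a x * (b y - c * eta y))) by exact: C2M cF (C2_prod ca cb').
  have cGQ : C2 (fun x y => G x y * (a x * Q y)) by exact: C2M cG (C2_prod ca cQ).
  have cPQ : C2 (fun x y => P x y * (a x * (b y - c * eta y))) by exact: C2M cP (C2_prod ca cb').
  rewrite (integral2_I2 cFQ)// (integral2_I2 cGQ)// => E1.
  have E2 : I2 (fun x y => P x y * (a x * (b y - c * eta y))) = - I2 (fun x y => G x y * (a x * Q y)).
    apply/eqP; rewrite -addr_eq0 -I2D//; apply/eqP.
    apply: (@I2_dy _ (fun x y => P x y * (a x * Q y))).
    - exact: C2M cP (C2_prod ca cQ).
    - exact: C2D.
    - move=> x y y01; have Iy : `[0, 1]%classic y by rewrite /= in_itv.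
      apply: isD_eq (isDM Iy (dP _ x y) (isDM Iy (isD_cst _ (a x) y) (prim_isD _ y cb'))) _.
      by rewrite mul0r add0r addrC.
    - by move=> x; rewrite Q1 Q0 !mulr0.
  have cHa : C2 (fun x y => H x y * (a x * b y)) by exact: C2M cH (C2_prod ca cb).
  rewrite (integral2_I2 cHa)//.
  have cDa : C2 (fun x y => a x * (D x y * eta y)) by exact: C2M (C2_fst ca) cDe.
  have ckab : C2 (fun x y => k x * (a x * b y)) by exact: C2M (C2_fst ck) (C2_prod ca cb).
  have cFP := C2B cFQ cPQ.
  have cc : continuous (fun _ : R => c) by exact: cst_continuous.
  transitivity (I2 (fun x y => F x y * (a x * (b y - c * eta y)) - P x y * (a x * (b y - c * eta y))
     + c * (a x * (D x y * eta y)) - k x * (a x * b y))).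
    congr I2; apply/funext => x; apply/funext => y; rewrite /H /D; ring.
  have ccD : C2 (fun x y => c * (a x * (D x y * eta y))).
    exact: C2M (C2_fst cc) cDa.
  rewrite (I2B (C2D cFP ccD) ckab) (I2D cFP ccD) (I2B cFQ cPQ) E1 E2 subrr add0r (I2Z _ cDa).
  have cak : continuous (fun x => a x * k x).
    by move=> x; apply: cvgM; [exact: ca|exact: ck].
  have -> : I2 (fun x y => a x * (D x y * eta y)) = prim (fun x => a x * k x) 1.
    by rewrite /I2; congr prim; apply/funext => x; rewrite (primZ _ (C2_section cDe)).
  have -> : I2 (fun x y => k x * (a x * b y)) = c * prim (fun x => a x * k x) 1.
    rewrite /I2 -(primZ _ cak)//; congr prim; apply/funext => x.
    rewrite mulrC -(primZ _ cb)//; congr prim; apply/funext => y; ring.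
  by rewrite subrr.
have H01 := closure_zero cH H0.
move=> x y y01.
have /andP[f0 /ltW f1] := fracp_itv x.
have -> : F x = F (fracp x).
  by apply/funext => r; exact: (periodic_fracp (f := fun s => F s r)).
rewrite (periodic_fracp (f := fun s => G s y))//.
apply: (@eq_isD _ _ (fun y => P (fracp x) y + k (fracp x))).
  move=> s; rewrite /= in_itv/= => s01.
  have := H01 (fracp x) s _ s01; rewrite f0 f1 /H /D => /(_ isT).
  by move/eqP; rewrite subr_eq0 subr_eq addrC => /eqP <-.
apply: isD_eq (isDD (dP _ (fracp x) y) (isD_cst _ _ _)) _.
by rewrite addr0.
Qed.

End WeakToClassical.

(** * Continuous representatives of weak derivatives *)

Section SobolevRepresentative.
Context {R : realType}.
Local Notation mu := (@lebesgue_measure R).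
Local Notation R' := (measurableTypeR R).
Local Notation T2 := (R' * R')%type.
Local Notation mu2 := (mu \x mu)%E.
Implicit Types (f g h phi : R * R -> R) (a b : R -> R).

Lemma weak_derivative_prod i j f g a b : weak_derivative i j f g ->
  smooth_periodic a -> smooth_compact b ->
  integral2 (fun z => f z * (iter i (@derive1 R R) a z.1 * iter j (@derive1 R R) b z.2)) =
  (-1) ^+ (i + j) * integral2 (fun z => g z * (a z.1 * b z.2)).
Proof.
move=> w sa sb; rewrite -(w _ (test_function_prod sa sb)).
by rewrite iter_partial_prod//; [exact: sa.1|exact: sb.1].
Qed.

(** Testing [g] with [a'] and [h] with [a] are, up to sign, the same pairing of [f]; the two signs
    differ by one factor [-1]. *)
Lemma weakx_weak_derivative i j f g h : weak_derivative i j f g ->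
  weak_derivative i.+1 j f h -> weakx g h.
Proof.
move=> wg wh a b sa sb.
have := weak_derivative_prod wg (smooth_periodic_derive sa) sb.
rewrite -iterSr (weak_derivative_prod wh sa sb) addSn exprS mulN1r mulNr -mulrN => E.
by apply/esym; apply: mulfI E; rewrite signr_eq0.
Qed.

Lemma weaky_weak_derivative i j f g h : weak_derivative i j f g ->
  weak_derivative i j.+1 f h -> weaky g h.
Proof.
move=> wg wh a b sa sb.
have := weak_derivative_prod wg sa (smooth_compact_derive sb).
rewrite -iterSr (weak_derivative_prod wh sa sb) addnS exprS mulN1r mulNr -mulrN => E.
by apply/esym; apply: mulfI E; rewrite signr_eq0.
Qed.

Lemma wDP k f i j : sobolev k f -> (i + j <= k)%N ->
  L2 (wD i j f) /\ weak_derivative i j f (wD i j f).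
Proof.
move=> [_ _ H] ij; have [g Lg wg] := H i j ij.
by apply: (@getPex _ [set g | L2 g /\ weak_derivative i j f g]); exists g.
Qed.

Lemma norm2_wD_le k f i j : sobolev k f -> (i + j <= k)%N ->
  norm2 (wD i j f) <= sobolev_norm k f ^+ 2.
Proof.
move=> sf ij.
have ik : (i < k.+1)%N by rewrite ltnS (leq_trans (leq_addr _ _) ij).
have jk : (j < k.+1)%N by rewrite ltnS (leq_trans (leq_addl _ _) ij).
have nn (a b : nat) : 0 <= integral2 (fun z => wD a b f z ^+ 2) by exact: norm2_ge0.
rewrite /sobolev_norm sqr_sqrtr; last by apply: sumr_ge0 => a _; exact: sumr_ge0.
rewrite (bigD1 (Ordinal ik))//= (bigD1 (Ordinal jk))//= -addrA lerDl.
by rewrite addr_ge0// ?sumr_ge0// => a _; exact: sumr_ge0.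
Qed.

Lemma Ck_partial phi : (forall k, Ck k phi) ->
  (forall k, Ck k (partial_x phi)) /\ (forall k, Ck k (partial_y phi)).
Proof. by move=> H; split=> k; have [_ []] := H k.+1. Qed.

Lemma continuous_iter_partial phi i j : (forall k, Ck k phi) ->
  continuous (iter j partial_y (iter i partial_x phi)).
Proof.
move=> H; have Hx : forall k, Ck k (iter i partial_x phi).
  by elim: i => //= i IH; case: (Ck_partial IH).
have Hy : forall k, Ck k (iter j partial_y (iter i partial_x phi)).
  by elim: j => //= j IH; case: (Ck_partial IH).
by case: (Hy 0%N).
Qed.

Lemma L2_continuous_integrable f phi : L2 f -> continuous phi ->
  mu2.-integrable cell (EFin \o (fun z => f z * phi z)).
Proof.
move=> Lf cphi.
have c2 : C2 (fun x y => phi (x, y)).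
  by rewrite /C2 (_ : (fun q => _) = phi)//; apply/funext => -[].
have [M M0 MP] := C2_bounded c2.
apply: (L2M_integrable Lf (M := M)); first exact: ltW.
  exact: measurable_funTS (continuous_measurable2 cphi).
by move=> z /cell_cc[z1 z2]; have := MP z.1 z.2 z1 z2; rewrite -surjective_pairing.
Qed.

Lemma weak_derivativeB i j f g f' g' : L2 f -> L2 g -> L2 f' -> L2 g' ->
  weak_derivative i j f f' -> weak_derivative i j g g' ->
  weak_derivative i j (fun z => f z - g z) (fun z => f' z - g' z).
Proof.
move=> Lf Lg Lf' Lg' wf wg phi tphi; have [cphi _ _] := tphi.
have mc := @measurable_cell R.
have B (u v psi : R * R -> R) : L2 u -> L2 v -> continuous psi ->
    integral2 (fun z => (u z - v z) * psi z) =
    integral2 (fun z => u z * psi z) - integral2 (fun z => v z * psi z).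
  move=> Lu Lv cpsi; rewrite /integral2 -RintegralB//.
  - by apply: eq_Rintegral => z _; rewrite mulrBl.
  - exact: L2_continuous_integrable.
  - exact: L2_continuous_integrable.
rewrite B//; last exact: continuous_iter_partial.
rewrite B//; last by case: (cphi 0%N).
by rewrite wf// wg// mulrBr.
Qed.

Lemma sobolevB k f g : sobolev k f -> sobolev k g -> sobolev k (fun z => f z - g z).
Proof.
move=> sf sg; have [pf Lf _] := sf; have [pg Lg _] := sg.
split=> [z zc||i j ij]; first by rewrite pf// pg.
  exact: L2B.
have [Lf' wf] := wDP sf ij; have [Lg' wg] := wDP sg ij.
exists (fun z => wD i j f z - wD i j g z); first exact: L2B.
exact: weak_derivativeB.
Qed.

(* Representative of the weak derivative [wD i j f] for [f] in H^4 and [i + j <= 2],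
   extended to the plane. *)
Definition sobolev_rep i j f (x y : R) : R :=
  sobolev_embed (wD i j f) (wD i.+1 j f) (wD i j.+1 f) (wD i.+1 j.+1 f) (fracp x) (clamp 1 y).

Lemma rep_periodic i j f x y : sobolev_rep i j f (x + 1) y = sobolev_rep i j f x y.
Proof. by rewrite /sobolev_rep fracpD1. Qed.

Lemma rep_clamp i j f x y : sobolev_rep i j f x (clamp 1 y) = sobolev_rep i j f x y.
Proof. by rewrite /sobolev_rep clamp_id// clamp_itv. Qed.

Section Regularity.
Context (f : R * R -> R) (sf : sobolev 4 f) (i j : nat) (ij : (i + j <= 2)%N).

Let ij4 : (i + j <= 4)%N. Proof. exact: leq_trans ij _. Qed.
Let i1j4 : (i.+1 + j <= 4)%N. Proof. by rewrite addSn (leq_ltn_trans ij). Qed.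
Let ij14 : (i + j.+1 <= 4)%N. Proof. by rewrite addnS (leq_ltn_trans ij). Qed.
Let i1j14 : (i.+1 + j.+1 <= 4)%N. Proof. by rewrite addSn addnS !ltnS. Qed.
Let P00 := wDP sf ij4.
Let P10 := wDP sf i1j4.
Let P01 := wDP sf ij14.
Let P11 := wDP sf i1j14.

Lemma rep_C2 : C2 (sobolev_rep i j f).
Proof.
apply: unif01_glue => [|y _]; last exact: embed_periodic.
by apply: embed_unif; [exact: P00.1|exact: P10.1|exact: P01.1|exact: P11.1].
Qed.

Lemma rep_weak a b : smooth_periodic a -> smooth_compact b ->
  integral2 (fun z => sobolev_rep i j f z.1 z.2 * (a z.1 * b z.2)) =
  integral2 (fun z => wD i j f z * (a z.1 * b z.2)).
Proof.
move=> sa sb.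
have w1 := weakx_weak_derivative P00.2 P10.2.
have w2 := weaky_weak_derivative P00.2 P01.2.
have w3 := weakx_weak_derivative P01.2 P11.2.
apply: etrans (embed_weak P00.1 P10.1 P01.1 P11.1 w1 w2 w3 sa sb).
apply: eq_integral2 => z zc; have [/fracp_id z1 _] := (cellP z).1 zc.
by rewrite /sobolev_rep z1 clamp_id//; case: (cell_cc zc).
Qed.

End Regularity.

Lemma rep_weakx f i j : sobolev 4 f -> (i.+1 + j <= 2)%N ->
  weakx (fun z => sobolev_rep i j f z.1 z.2) (fun z => sobolev_rep i.+1 j f z.1 z.2).
Proof.
move=> sf ij; have ij' : (i + j <= 2)%N by exact: leq_trans ij.
move=> a b sa sb; rewrite !rep_weak//; last exact: smooth_periodic_derive.
apply: (weakx_weak_derivative (wDP sf _).2 (wDP sf _).2) => //.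
  exact: leq_trans ij' _.
exact: leq_trans ij _.
Qed.

Lemma rep_weaky f i j : sobolev 4 f -> (i + j.+1 <= 2)%N ->
  weaky (fun z => sobolev_rep i j f z.1 z.2) (fun z => sobolev_rep i j.+1 f z.1 z.2).
Proof.
move=> sf ij; have ij' : (i + j <= 2)%N by rewrite (leq_trans _ ij)// leq_add2l.
move=> a b sa sb; rewrite !rep_weak//; last exact: smooth_compact_derive.
apply: (weaky_weak_derivative (wDP sf _).2 (wDP sf _).2) => //.
  exact: leq_trans ij' _.
exact: leq_trans ij _.
Qed.

Lemma rep_dx f i j x y : sobolev 4 f -> (i.+1 + j <= 2)%N -> 0 <= y <= 1 ->
  isD setT (sobolev_rep i j f ^~ y) x (sobolev_rep i.+1 j f x y).
Proof.
move=> sf ij; have ij' : (i + j <= 2)%N by exact: leq_trans ij.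
apply: weakx_classical; [exact: rep_C2|exact: rep_C2|exact: rep_periodic|exact: rep_periodic|].
exact: rep_weakx.
Qed.

Lemma rep_dy f i j x y : sobolev 4 f -> (i + j.+1 <= 2)%N -> 0 <= y <= 1 ->
  isD `[0, 1] (sobolev_rep i j f x) y (sobolev_rep i j.+1 f x y).
Proof.
move=> sf ij; have ij' : (i + j <= 2)%N by rewrite (leq_trans _ ij)// leq_add2l.
apply: weaky_classical; [exact: rep_C2|exact: rep_C2|exact: rep_periodic|exact: rep_periodic|].
exact: rep_weaky.
Qed.

Lemma rep_unique (F G : R -> R -> R) : C2 F -> C2 G ->
  (forall x y, F (x + 1) y = F x y) -> (forall x y, G (x + 1) y = G x y) ->
  (forall a b, smooth_periodic a -> smooth_compact b ->
    integral2 (fun z => F z.1 z.2 * (a z.1 * b z.2)) =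
    integral2 (fun z => G z.1 z.2 * (a z.1 * b z.2))) ->
  forall x y, 0 <= y <= 1 -> F x y = G x y.
Proof.
move=> cF cG pF pG E x y y01.
have cH : C2 (fun x y => F x y - G x y) by exact: C2B.
have H0 : forall x y, 0 < x < 1 -> 0 < y < 1 -> F x y - G x y = 0.
  apply: (C2_weak_eq0 cH) => a b sa sb.
  have ca := smooth_continuous sa.1; have cb := smooth_continuous sb.1.
  have cFab : C2 (fun x y => F x y * (a x * b y)) by exact: C2M cF (C2_prod ca cb).
  have cGab : C2 (fun x y => G x y * (a x * b y)) by exact: C2M cG (C2_prod ca cb).
  have := E a b sa sb; rewrite (integral2_I2 cFab)// (integral2_I2 cGab)// => E'.
  rewrite (@integral2_I2 _ _ (fun x y => F x y * (a x * b y) - G x y * (a x * b y))).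
  - by rewrite I2B// E' subrr.
  - exact: C2B.
  - by move=> z _; rewrite mulrBl.
have /andP[f0 /ltW f1] := fracp_itv x.
have := closure_zero cH H0 _ y01 (x := fracp x); rewrite f0 f1 => /(_ isT)/eqP.
rewrite subr_eq0 => /eqP E1.
by rewrite (periodic_fracp (f := F ^~ y))// (periodic_fracp (f := G ^~ y)).
Qed.

(** [wD 0 0 f] pairs with test functions as [f] does, so the representative and the continuous
    function [f], extended by clamping [y], agree weakly and hence everywhere on the channel. *)
Lemma rep00 f z : sobolev 4 f -> {within channel, continuous f} -> channel z ->
  f z = sobolev_rep 0 0 f z.1 z.2.
Proof.
move=> sf cf zc.
have [pf _ _] := sf.
have ch (x y : R) : channel (x, clamp 1 y) by exact: clamp_itv.
have cF : C2 (fun x y => f (x, clamp 1 y)).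
  have cq : continuous (fun q : R * R => (q.1, clamp 1 q.2)).
    apply: continuous_pairing => q; first exact: cvg_fst.
    by apply: (continuous_comp (@cvg_snd _ _ _ _ _)); exact: continuous_clamp.
  move=> q; have /subspace_continuousP/(_ _ (ch q.1 q.2)) := cf.
  apply: cvg_trans => U; rewrite /nbhs/= /within/= => HU.
  have := cq q _ HU; rewrite /nbhs /=; apply: filterS => p /=.
  by apply; exact: ch.
have i0 : (0 + 0 <= 2)%N by [].
have := rep_unique cF (rep_C2 sf i0).
move=> /(_ _ (rep_periodic 0 0 f)).
have pF (x y : R) : f (x + 1, clamp 1 y) = f (x, clamp 1 y) by rewrite -(pf (x, clamp 1 y)).
move=> /(_ pF) H.
have z01 : 0 <= z.2 <= 1 by exact: zc.
rewrite -H//; first by rewrite clamp_id// -surjective_pairing.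
move=> a b sa sb; rewrite (rep_weak sf i0 sa sb).
have i4 : (0 + 0 <= 4)%N by [].
have [_ w0] := wDP sf i4.
have := weak_derivative_prod w0 sa sb; rewrite /= expr0 mul1r => <-.
apply: eq_integral2 => z' /cell_cc[_ z'2].
by rewrite clamp_id// -surjective_pairing.
Qed.

(** [wD] picks an arbitrary weak derivative, so it need not be additive pointwise. The continuous
    representatives are, since they are determined by their pairings. *)
Lemma repB f g i j x y : sobolev 4 f -> sobolev 4 g -> (i + j <= 2)%N ->
  sobolev_rep i j (fun z => f z - g z) x y = sobolev_rep i j f x y - sobolev_rep i j g x y.
Proof.
move=> sf sg ij; have sfg := sobolevB sf sg.
have ij4 : (i + j <= 4)%N by exact: leq_trans ij _.
rewrite -rep_clamp -[sobolev_rep i j f x y]rep_clamp -[sobolev_rep i j g x y]rep_clamp.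
have mc := @measurable_cell R.
apply: (@rep_unique _ (fun x y => sobolev_rep i j f x y - sobolev_rep i j g x y)); last exact: clamp_itv.
- exact: rep_C2.
- by apply: C2B; exact: rep_C2.
- exact: rep_periodic.
- by move=> x' y'; rewrite !rep_periodic.
move=> a b sa sb; rewrite rep_weak//.
have ca := smooth_continuous sa.1; have cb := smooth_continuous sb.1.
have [Lfg wfg] := wDP sfg ij4; have [Lf wf] := wDP sf ij4; have [Lg wg] := wDP sg ij4.
have [_ Lf0 _] := sf; have [_ Lg0 _] := sg.
have wfg' := weak_derivativeB Lf0 Lg0 Lf Lg wf wg.
have E : integral2 (fun z => wD i j (fun z => f z - g z) z * (a z.1 * b z.2)) =
    integral2 (fun z => (wD i j f z - wD i j g z) * (a z.1 * b z.2)).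
  have := weak_derivative_prod wfg sa sb.
  rewrite (weak_derivative_prod wfg' sa sb) => E'.
  by apply/esym; apply: mulfI E'; rewrite signr_eq0.
rewrite E /integral2.
have cfab : C2 (fun x y => sobolev_rep i j f x y * (a x * b y)) by exact: C2M (rep_C2 sf ij) (C2_prod ca cb).
have cgab : C2 (fun x y => sobolev_rep i j g x y * (a x * b y)) by exact: C2M (rep_C2 sg ij) (C2_prod ca cb).
transitivity (integral2 (fun z => wD i j f z * (a z.1 * b z.2)) -
    integral2 (fun z => wD i j g z * (a z.1 * b z.2))).
  rewrite /integral2 -RintegralB//; [|exact: L2_prod_integrable..].
  by apply: eq_Rintegral => z _; rewrite mulrBl.
rewrite -(rep_weak sf ij sa sb) -(rep_weak sg ij sa sb) /integral2.
rewrite -(RintegralB mc (integrable_C2 cfab) (integrable_C2 cgab)).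
by apply: eq_Rintegral => z _; rewrite mulrBl.
Qed.

(** Optimising the free parameter [l] would give a multiple of the norm. Keeping it avoids the
    square root and the case of a zero norm; it is chosen where smallness is wanted. *)
Lemma rep_bound : exists2 C : R, 0 < C & forall f i j x y (l : R),
  sobolev 4 f -> (i + j <= 2)%N -> 0 < l ->
  `|sobolev_rep i j f x y| <= C * (l * sobolev_norm 4 f ^+ 2 + l^-1).
Proof.
have [B B0 bB] := @bounded_k_eta R.
(* One product of kernel bounds for each of the four terms of [sobolev_embed]. *)
exists (1 * B + 3 * B + 1 * 1 + 3 * 1); first by rewrite !mul1r; lra.
move=> f i j x y l sf ij l0.
have n1 (a b : nat) : (a + b <= 4)%N -> norm1 (wD a b f) <= l * sobolev_norm 4 f ^+ 2 + l^-1.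
  move=> ab; have [Lab _] := wDP sf ab.
  apply: le_trans (norm1_le_norm2 Lab l0) _.
  by rewrite lerD2r ler_wpM2l ?(ltW l0)//; exact: norm2_wD_le.
have ij4 : (i + j <= 4)%N by exact: leq_trans ij _.
have i1j4 : (i.+1 + j <= 4)%N by rewrite addSn (leq_ltn_trans ij).
have ij14 : (i + j.+1 <= 4)%N by rewrite addnS (leq_ltn_trans ij).
have i1j14 : (i.+1 + j.+1 <= 4)%N by rewrite addSn addnS !ltnS.
have x01 : 0 <= fracp x <= 1 by have /andP[-> /ltW ->] := fracp_itv x.
have y01 : 0 <= clamp 1 y <= 1 by exact: clamp_itv.
have kb W K1 K2 B1 B2 := @kerop_bound R W K1 K2 B1 B2 (fracp x) (clamp 1 y).
set N := l * _ + _ in n1 *.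
have B0' := ltW B0; have three : 0 <= (3 : R) by lra.
have h1 := kb _ _ _ _ _ (wDP sf ij4).1 bounded_k_one bB ler01 B0' x01 y01.
have h2 := kb _ _ _ _ _ (wDP sf i1j4).1 bounded_k_x bB three B0' x01 y01.
have h3 := kb _ _ _ _ _ (wDP sf ij14).1 bounded_k_one bounded_k_y ler01 ler01 x01 y01.
have h4 := kb _ _ _ _ _ (wDP sf i1j14).1 bounded_k_x bounded_k_y three ler01 x01 y01.
have step (c n v : R) : `|v| <= c * n -> 0 <= c -> n <= N -> `|v| <= c * N.
  by move=> /le_trans v0 c0 nN; apply: v0; rewrite ler_wpM2l.
rewrite /sobolev_rep /sobolev_embed (mulrDl _ _ N) (mulrDl _ _ N) (mulrDl _ _ N).
apply: le_trans (ler_normD _ _) _; apply: lerD.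
  apply: le_trans (ler_normB _ _) _; apply: lerD.
    apply: le_trans (ler_normB _ _) _; apply: lerD.
      by apply: step h1 _ (n1 _ _ ij4); rewrite mulr_ge0.
    by apply: step h2 _ (n1 _ _ i1j4); rewrite mulr_ge0.
  by apply: step h3 _ (n1 _ _ ij14); rewrite mulr_ge0.
by apply: step h4 _ (n1 _ _ i1j14); rewrite mulr_ge0.
Qed.

End SobolevRepresentative.

(** * The vorticity equation *)

Section TimeContinuity.
Context {R : realType} (T : R) (T0 : 0 <= T).

(** Continuity in time uniform in space, together with continuity in space at each time, gives joint
    continuity. *)
Lemma C3_clamp (f : R -> R -> R -> R) : (forall t, 0 <= t <= T -> C2 (f t)) ->
  (forall t e, 0 <= t <= T -> 0 < e ->
    \forall s \near t, 0 <= s <= T -> forall x y, `|f s x y - f t x y| <= e) ->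
  C3 (fun t => f (clamp T t)).
Proof.
move=> cf uf [[t x] y]; apply/cvgrPdist_le => e e0 /=.
have e2 : 0 < e / 2 by rewrite divr_gt0.
have tT := clamp_itv t T0.
have H1 : \forall p \near (t, x, y), `|f (clamp T t) x y - f (clamp T t) p.1.2 p.2| <= e / 2.
  have /cvgrPdist_le/(_ _ e2) := cf _ tT (x, y).
  have c : continuous (fun p : R * R * R => (p.1.2, p.2)).
    apply: continuous_pairing => p; last exact: cvg_snd.
    by apply: (continuous_comp (@cvg_fst _ _ _ _ _)); exact: cvg_snd.
  exact: (c (t, x, y)).
have H2 : \forall p \near (t, x, y),
    forall x y, `|f (clamp T p.1.1) x y - f (clamp T t) x y| <= e / 2.
  have c : continuous (fun p : R * R * R => clamp T p.1.1).
    move=> p; apply: (@continuous_comp _ _ _ (fun p : R * R * R => p.1.1)); last exact: continuous_clamp.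
    by apply: (continuous_comp (@cvg_fst _ _ _ _ _)); exact: cvg_fst.
  have := c (t, x, y) _ (uf _ _ tT e2); rewrite /nbhs /=; apply: filterS => p /= pT.
  by apply: pT; exact: clamp_itv.
apply: filterS2 H1 H2 => p p1 /(_ p.1.2 p.2) p2.
rewrite (splitr e) (le_trans _ (lerD p1 p2))// -[X in _ <= _ + X]normrN opprB.
by rewrite (le_trans _ (ler_normD _ _))// addrA subrK.
Qed.

Lemma rep_C3 (w : R -> R * R -> R) i j : (i + j <= 2)%N -> C0_sobolev 4 T w ->
  C3 (fun t => sobolev_rep i j (w (clamp T t))).
Proof.
move=> ij [sw cw]; apply: (C3_clamp (f := fun t => sobolev_rep i j (w t))) => [t tT|t e tT e0].
  by apply: rep_C2 => //; exact: sw.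
have [C C0 CP] := @rep_bound R.
(* With the norm of the difference at most [e / (2 * C)] and [l = 2 * C / e], the two terms of the
   bound each contribute [e / 2]. *)
have d0 : 0 < e / (2 * C) by rewrite divr_gt0// mulr_gt0.
have l0 : 0 < 2 * C / e by rewrite divr_gt0// mulr_gt0.
have N : \forall s \near t, `[0, T]%classic s ->
    `|sobolev_norm 4 (fun z => w s z - w t z)| <= e / (2 * C).
  by have /cvgr0Pnorm_le/(_ _ d0) := cw t tT.
apply: filterS N => s + sT x y; rewrite /= in_itv/= sT => /(_ isT).
rewrite ger0_norm ?sqrtr_ge0// => sd.
rewrite -(repB x y (sw s sT) (sw t tT) ij).
apply: le_trans (CP _ i j x y _ (sobolevB (sw s sT) (sw t tT)) ij l0) _.
have : sobolev_norm 4 (fun z => w s z - w t z) ^+ 2 <= (e / (2 * C)) ^+ 2.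
  by rewrite ler_sqr ?nnegrE ?sqrtr_ge0// ltW.
rewrite -(ler_pM2l l0) => H; apply: le_trans (_ : C * (2 * C / e * (e / (2 * C)) ^+ 2 + (2 * C / e)^-1) <= _).
  by rewrite ler_pM2l// lerD2r.
rewrite le_eqVlt; apply/orP; left; apply/eqP; field.
by rewrite !gt_eqF.
Qed.

End TimeContinuity.

(** * Derivatives in the channel and uniqueness of the stream function *)

Section ChannelDerivatives.
Context {R : realType}.
Implicit Types (f A : R * R -> R) (F : R -> R -> R) (z : R * R).

(** Increments along [x] never leave the channel, so the relative derivative is a two-sided one. *)
Lemma dx_isD f F z l : (forall z, channel z -> f z = F z.1 z.2) -> channel z ->
  isD setT (F ^~ z.2) z.1 l -> dx f z = l.
Proof.
case: z => x y /= fF zc D.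
have E (h : R) : (x, y) + h *: ((1, 0) : R * R) = (h + x, y).
  by congr pair; rewrite /= /GRing.scale /= ?mulr1 ?mulr0 ?addr0// addrC.
apply: (isD_derivable_in (S := channel) (f := f) zc _ _).2.
  move=> e e0; exists (e / 2); rewrite E; split => //; first by rewrite gt_eqF// divr_gt0.
  by rewrite gtr0_norm ?divr_gt0//; lra.
have := D; rewrite -[X in isD _ _ X](add0r x) => /isD_shift D'.
apply: eq_isD (isDS _ D'); last by [].
by move=> h _; rewrite E fF.
Qed.

Lemma channel_y_shift x y h : (x, y) + h *: ((0, 1) : R * R) = (x, h + y).
Proof. by congr pair; rewrite /= /GRing.scale /= ?mulr1 ?mulr0 ?addr0// addrC. Qed.

Lemma dy_isD f F z l : (forall z, channel z -> f z = F z.1 z.2) -> channel z ->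
  isD `[0, 1] (F z.1) z.2 l -> dy f z = l.
Proof.
case: z => x y /= fF zc D; have y01 : 0 <= y <= 1 := zc.
apply: (isD_derivable_in (S := channel) (f := f) zc _ _).2.
  move=> e e0; have [h [h0 he hI]] := itv_accum ltr01 y01 e0.
  by exists h; split => //; rewrite channel_y_shift; move: hI; rewrite addrC /= in_itv.
have := D; rewrite -[X in isD _ _ X](add0r y) => /isD_shift D'.
apply: eq_isD (isDS _ D').
  by move=> h /=; rewrite channel_y_shift => /fF.
by move=> h /=; rewrite channel_y_shift in_itv.
Qed.

Lemma derivable_dy f x y : 0 <= y <= 1 -> derivable_in channel f (x, y) (0, 1) ->
  isD `[0, 1] (fun y => f (x, y)) y (dy f (x, y)).
Proof.
move=> y01 /(derivable_inP (y01 : channel (x, y))).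
rewrite -[X in isD _ _ X](subrr y) => /isD_shift D.
apply: eq_isD (isDS _ D) => [s _|s /=].
  by rewrite channel_y_shift subrK.
by rewrite channel_y_shift subrK in_itv.
Qed.

(** The difference [d0] of the two stream functions has derivative [d1], which is constant because
    both second derivatives equal [- f]. So [d0] is affine in [y], and it vanishes on both walls. *)
Lemma stream_unique f A F : is_stream f A -> (forall x, continuous (F x)) ->
  (forall z, channel z -> f z = F z.1 z.2) -> forall z, channel z ->
  A z = V1 (F z.1) z.2 /\ - dy A z = U1 (F z.1) z.2.
Proof.
move=> [sA bA] cF fF [x y] zc; have y01 : 0 <= y <= 1 := zc.
have [A0 A1] := bA x.
pose d1 r := dy A (x, r) + U1 (F x) r.
pose d0 r := A (x, r) - V1 (F x) r.
have D0 r : 0 <= r <= 1 -> isD `[0, 1] d0 r (d1 r).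
  move=> r01; have [dA _ _] := sA (x, r) r01.
  apply: isD_eq (isDB (derivable_dy r01 dA) (isD_V1y _ (cF x))) _.
    by rewrite /= in_itv.
  by rewrite opprK.
have D1 r : 0 <= r <= 1 -> isD `[0, 1] d1 r 0.
  move=> r01; have [_ dA E] := sA (x, r) r01.
  apply: isD_eq (isDD (derivable_dy r01 dA) (isD_U1y _ _ (cF x))) _.
  by rewrite -[dy _ _]opprK E (fF (x, r))//= addNr.
have cst (g : R -> R) : (forall r, 0 <= r <= 1 -> isD `[0, 1] g r 0) ->
    forall r, 0 <= r <= 1 -> g r = g 0.
  move=> Dg r /andP[r0 r1]; apply: isD_cst_itv => // s /andP[s0 sr].
  apply: (@isDS _ `[0, 1]); last by apply: Dg; rewrite s0 (le_trans sr).
  by move=> q /=; rewrite !in_itv/= => /andP[-> /le_trans ->].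
have d1c := cst _ D1.
have D0' r : 0 <= r <= 1 -> isD `[0, 1] (fun r => d0 r - d1 0 * r) r 0.
  move=> r01; apply: isD_eq (isDB (D0 r r01) (isDZ _ (isD_XM _ _))) _.
  by rewrite mulr1 d1c// subrr.
have one : 0 <= (1 : R) <= 1 by apply/andP; split.
have d00 : d0 0 = 0 by rewrite /d0 A0 V1_0 subrr.
have d10 : d1 0 = 0.
  have := cst _ D0' 1 one; rewrite {1}/d0 A1 V1_1 d00 mulr1 mulr0 !subr0 sub0r.
  by move/eqP; rewrite oppr_eq0 => /eqP.
split=> /=; apply/eqP; rewrite -subr_eq0.
  by have /= := cst _ D0' y y01; rewrite d10 !mul0r !subr0 d00 /d0 => ->.
by rewrite -opprD oppr_eq0 -/(d1 y) d1c// d10.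
Qed.

End ChannelDerivatives.

(** * Application to the given solution *)

Section Solution.
Context {R : realType} (T : R) (w0 : R * R -> R).
Context (w A : R -> R * R -> R) (P : R -> R -> R) (T_gt0 : 0 < T).
Context (w_H4 : C0_sobolev 4 T w).
Context (w_cont : forall t, 0 <= t <= T -> {within channel, continuous (w t)}).
Context (w_sol : hydrostatic_euler T w0 w A).
Context (w_rayleigh : forall t, 0 <= t <= T -> local_rayleigh (w t)).
Context (P_pressure : is_pressure T A P).
Implicit Types (t x y : R) (z : R * R).

Let T_ge0 : 0 <= T. Proof. exact: ltW. Qed.
Let cT t : 0 <= clamp T t <= T. Proof. exact: clamp_itv. Qed.

(** Clamping the time makes these functions, their spatial derivatives and their joint continuity
    available for every real [t]. *)
Let D i j t : R -> R -> R := sobolev_rep i j (w (clamp T t)).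

Let sw t : 0 <= t <= T -> sobolev 4 (w t). Proof. exact: w_H4.1. Qed.

Let D_dx i j t x y : (i.+1 + j <= 2)%N -> 0 <= y <= 1 ->
  isD setT (fun x => D i j t x y) x (D i.+1 j t x y).
Proof. by move=> ij y01; apply: rep_dx => //; exact: sw. Qed.

Let D_dx' i j t x y : (i.+1 + j <= 2)%N -> 0 < y < 1 ->
  isD setT (fun x => D i j t x y) x (D i.+1 j t x y).
Proof. by move=> ij /andP[y0 y1]; apply: D_dx => //; rewrite !ltW. Qed.

Let D_dy i j t x y : (i + j.+1 <= 2)%N -> 0 <= y <= 1 ->
  isD `[0, 1] (D i j t x) y (D i j.+1 t x y).
Proof. by move=> ij y01; apply: rep_dy => //; exact: sw. Qed.

Let D_C3 i j : (i + j <= 2)%N -> C3 (D i j).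
Proof. by move=> ij; exact: rep_C3. Qed.

Let D_C2 i j t : (i + j <= 2)%N -> C2 (D i j t).
Proof. by move=> ij; exact: C3_section (D_C3 ij). Qed.

Let D_cont i j t x : (i + j <= 2)%N -> continuous (D i j t x).
Proof. by move=> ij; exact: (C2_section (@D_C2 i j t ij)). Qed.

Let D_per i j t x y : D i j t (x + 1) y = D i j t x y.
Proof. exact: rep_periodic. Qed.

Let wE t z : 0 <= t <= T -> channel z -> w t z = D 0 0 t z.1 z.2.
Proof. by move=> tT zc; rewrite /D clamp_id// -rep00//; [exact: sw|exact: w_cont]. Qed.

Let dxwE t z : 0 <= t <= T -> channel z -> dx (w t) z = D 1 0 t z.1 z.2.
Proof.
move=> tT zc; apply: (@dx_isD _ _ (D 0 0 t)) => //; first by move=> *; exact: wE.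
exact: D_dx.
Qed.

Let dywE t z : 0 <= t <= T -> channel z -> dy (w t) z = D 0 1 t z.1 z.2.
Proof.
move=> tT zc; apply: (@dy_isD _ _ (D 0 0 t)) => //; first by move=> *; exact: wE.
exact: D_dy.
Qed.

(** [D] sees [t] and [y] only through their clamped values, so the Rayleigh condition on the closed
    channel over [[0, T]] gives positivity everywhere, and dividing by it preserves continuity. *)
Let Dy_gt0 t x y : 0 < D 0 1 t x y.
Proof.
have yc : 0 <= clamp 1 y <= 1 by exact: clamp_itv.
have := w_rayleigh (cT t) (yc : channel (x, clamp 1 y)).
by rewrite dywE//= /D rep_clamp (clamp_id (cT t)).
Qed.

Let U t x := U1 (D 0 0 t x).
Let Ux t x := U1 (D 1 0 t x).
Let V t x := V1 (D 1 0 t x).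

Let streamE t z : 0 <= t <= T -> channel z ->
  A t z = V1 (D 0 0 t z.1) z.2 /\ vel_u A t z = U t z.1 z.2.
Proof.
move=> tT; have [sA _ _] := w_sol.
apply: (stream_unique (sA t tT)); first by move=> x; exact: D_cont.
by move=> *; exact: wE.
Qed.

Let velvE t z : 0 <= t <= T -> channel z -> vel_v A t z = V t z.1 z.2.
Proof.
move=> tT zc; apply: (@dx_isD _ _ (fun x => V1 (D 0 0 t x))) => //.
  by move=> z' z'c; case: (streamE tT z'c).
apply: (@isD_V1p _ setT (D 0 0 t) (D 1 0 t)) => //; try exact: D_C2.
by move=> s r _; exact: D_dx'.
Qed.

Let dxuE t z : 0 <= t <= T -> channel z -> dx (vel_u A t) z = Ux t z.1 z.2.
Proof.
move=> tT zc; apply: (@dx_isD _ _ (U t)) => //.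
  by move=> z' z'c; case: (streamE tT z'c).
apply: (@isD_U1p _ setT (D 0 0 t) (D 1 0 t)) => //; try exact: D_C2.
by move=> s r _; exact: D_dx'.
Qed.

Let dyuE t z : 0 <= t <= T -> channel z -> dy (vel_u A t) z = D 0 0 t z.1 z.2.
Proof.
move=> tT zc; apply: (@dy_isD _ _ (U t)) => //.
  by move=> z' z'c; case: (streamE tT z'c).
by apply: isD_U1y; exact: D_cont.
Qed.

Let itvT s : `[0, T]%classic s -> 0 <= s <= T. Proof. by rewrite /= in_itv. Qed.

Let dtw t x y : 0 <= t <= T -> 0 < y < 1 ->
  isD `[0, T] (fun s => D 0 0 s x y) t
    (- (U t x y * D 1 0 t x y + V t x y * D 0 1 t x y)).
Proof.
move=> tT y01; have [_ /(_ t (x, y) tT y01)[dw E] _] := w_sol.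
have zc : channel (x, y) by case/andP: y01 => y0 y1; rewrite /channel/= !ltW.
apply: isD_eq (eq_isD _ (dt_isD tT dw)) _.
  by move=> s /itvT sT; rewrite wE.
move: E; rewrite (streamE tT zc).2 velvE// dxwE// dywE//= => E.
by apply/eqP; rewrite -addr_eq0 addrA E.
Qed.

Let dtu t x y : 0 <= t <= T -> 0 < y < 1 ->
  isD `[0, T] (fun s => U s x y) t
    (- (U t x y * Ux t x y + V t x y * D 0 0 t x y + derive1 (P t) x)).
Proof.
move=> tT y01; have [_ _ /(_ (x, y) y01)[du E]] := P_pressure tT.
have zc : channel (x, y) by case/andP: y01 => y0 y1; rewrite /channel/= !ltW.
apply: isD_eq (eq_isD _ (dt_isD tT du)) _.
  by move=> s /itvT sT; rewrite (streamE sT zc).2.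
move: E; rewrite (streamE tT zc).2 velvE// dxuE// dyuE//= => E.
by apply/eqP; rewrite -addr_eq0 !addrA E.
Qed.

Let a t x y := D 0 0 t x y * D 1 0 t x y / D 0 1 t x y.

Let Dy0 t x y : D 0 1 t x y != 0. Proof. by rewrite gt_eqF. Qed.

Let c00 := @D_C3 0 0 isT.
Let c10 := @D_C3 1 0 isT.
Let c01 := @D_C3 0 1 isT.
Let c20 := @D_C3 2 0 isT.
Let c11 := @D_C3 1 1 isT.
Let c02 := @D_C3 0 2 isT.

Let ca : C3 a. Proof. exact (C3M (C3M c00 c10) (C3V Dy0 c01)). Qed.
Let cU : C3 U. Proof. exact: C3_U1. Qed.
Let cUx : C3 Ux. Proof. exact: C3_U1. Qed.

Let cell_channel z : cell z -> channel z. Proof. by case/cell_cc. Qed.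

Let aE t z : 0 <= t <= T -> channel z ->
  w t z * dx (w t) z / dy (w t) z = a t z.1 z.2.
Proof. by move=> tT zc; rewrite wE// dxwE// dywE. Qed.

Let PX t x (_ : R) := - (2 * prim (fun y => U t x y * Ux t x y) 1).

Let PE t x y : 0 <= t <= T -> derive1 (P t) x = PX t x y.
Proof.
move=> tT; apply: (pressure_gradientE (Px := fun t x => derive1 (P t) x) T_gt0 c00 c10 c01) => //.
Qed.

Let cPX : C3 PX.
Proof. exact (C3N (C3M (C3_cst (c := 2)) (C3_fix (y := 1) (C3_prim (C3M cU cUx))))). Qed.

Let D00_dx t x y := @D_dx' 0 0 t x y isT.
Let D10_dx t x y := @D_dx' 1 0 t x y isT.
Let D01_dx t x y := @D_dx' 0 1 t x y isT.
Let D00_dy t x y := @D_dy 0 0 t x y isT.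
Let D10_dy t x y := @D_dy 1 0 t x y isT.
Let D01_dy t x y := @D_dy 0 1 t x y isT.
Let p00 t x y := D_per 0 0 t x y.
Let p10 t x y := D_per 1 0 t x y.
Let p01 t x y := D_per 0 1 t x y.

Let E1_I2D t : 0 <= t <= T -> E1 w A t = I2 (fun x y => a t x y - Ux t x y).
Proof.
move=> tT; apply: integral2_I2; first exact (C3_section (C3B ca cUx)).
by move=> z /cell_channel zc; rewrite aE// dxuE.
Qed.

Let E1_I2 t : 0 <= t <= T -> E1 w A t = I2 (a t).
Proof.
by move=> tT; apply: etrans (E1_I2D tT) (E1_simpl c00 c10 c01 p00 Dy_gt0 D00_dx _).
Qed.

Let E2_I2 t : 0 <= t <= T -> E2 w A P t = I2 (fun x y => U t x y ^+ 2 * a t x y).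
Proof.
move=> tT; rewrite -(E2_simpl c00 c10 c01 p00 Dy_gt0 D00_dx).
apply: integral2_I2.
  exact (C3_section (C3B (C3M (C3X (n := 2) cU) (C3B ca cUx)) (C3M cU cPX))).
by move=> z /cell_channel zc; rewrite aE// dxuE// (streamE tT zc).2 (PE z.1 z.2 tT).
Qed.

Lemma E1E t : 0 <= t <= T ->
  E1 w A t = integral2 (fun z => w t z * dx (w t) z / dy (w t) z).
Proof.
move=> tT; rewrite E1_I2//; apply/esym/integral2_I2; first exact (C3_section ca).
by move=> z /cell_channel zc; rewrite aE.
Qed.

Lemma E2E t : 0 <= t <= T ->
  E2 w A P t = integral2 (fun z =>
    (vel_u A t z) ^+ 2 * (w t z * dx (w t) z / dy (w t) z)).
Proof.
move=> tT; rewrite E2_I2//; apply/esym/integral2_I2.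
  exact (C3_section (C3M (C3X (n := 2) cU) ca)).
by move=> z /cell_channel zc; rewrite aE// (streamE tT zc).2.
Qed.

Let cln : C3 (fun s x y => ln (1 / D 0 1 s x y)).
Proof.
apply: C3_ln; first by move=> s x y; rewrite divr_gt0.
exact (C3M (C3_cst (c := 1)) (C3V Dy0 c01)).
Qed.

Lemma dt_log t : 0 <= t <= T ->
  derivable_t T (fun s => integral2 (fun z => ln (1 / dy (w s) z))) t /\
  E1 w A t = dt T (fun s => integral2 (fun z => ln (1 / dy (w s) z))) t.
Proof.
move=> tT; rewrite E1_I2D//.
have := dt_log_integral c00 c10 c01 c11 c02 p00 p01 Dy_gt0 D00_dx D01_dx D00_dy D10_dy D01_dy dtw tT.
move=> /(eq_isD (g := fun s => integral2 (fun z => ln (1 / dy (w s) z)))) H.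
have [|d ->//] := isD_dt T_gt0 tT (H _).
move=> s /itvT sT; apply/esym/integral2_I2; first exact (C3_section cln).
by move=> z /cell_channel zc; rewrite dywE.
Qed.

Lemma dtE1 t : 0 <= t <= T -> derivable_t T (E1 w A) t /\
  dt T (E1 w A) t =
    integral2 (fun z => `|dx (vel_u A t) z - w t z * dx (w t) z / dy (w t) z| ^+ 2).
Proof.
move=> tT.
rewrite (integral2_I2 (g := fun x y => `|Ux t x y - a t x y| ^+ 2)); last 2 first.
- under eq_fun2 do rewrite real_normK ?num_real//.
  exact (C3_section (C3X (n := 2) (C3B cUx ca))).
- by move=> z /cell_channel zc; rewrite aE// dxuE.
apply: (isD_dt T_gt0 tT).
apply: eq_isD (dt_E1 c00 c10 c01 c20 c11 c02 p00 p10 p01 Dy_gt0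
  D00_dx D10_dx D01_dx D00_dy D10_dy D01_dy dtw tT).
by move=> s /itvT sT; rewrite E1_I2.
Qed.

Lemma dtE2 t : 0 <= t <= T -> derivable_t T (E2 w A P) t /\
  dt T (E2 w A P) t =
    integral2 (fun z => `|derive1 (P t) z.1 + vel_u A t z *
      (dx (vel_u A t) z - w t z * dx (w t) z / dy (w t) z)| ^+ 2).
Proof.
move=> tT.
rewrite (integral2_I2
  (g := fun x y => `|PX t x y + U t x y * (Ux t x y - a t x y)| ^+ 2)); last 2 first.
- under eq_fun2 do rewrite real_normK ?num_real//.
  exact (C3_section (C3X (n := 2) (C3D cPX (C3M cU (C3B cUx ca))))).
- by move=> z /cell_channel zc; rewrite aE// dxuE// (streamE tT zc).2 (PE z.1 z.2 tT).
apply: (isD_dt T_gt0 tT).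
apply: eq_isD (dt_E2 T_gt0 c00 c10 c01 c20 c11 c02 p00 p10 p01 Dy_gt0
  D00_dx D10_dx D01_dx D00_dy D10_dy D01_dy dtw dtu tT).
by move=> s /itvT sT; rewrite E2_I2.
Qed.

End Solution.

(** Each time derivative comes with its existence, since [dt] is a [lim] and says nothing by itself.
    The continuity hypothesis on [w t] selects, within its H^4 class, the representative whose
    pointwise derivatives appear in the integrands. *)
Theorem proposition4 (R : realType) (T : R) (w0 : R * R -> R)
    (w A : R -> R * R -> R) (P : R -> R -> R)
    (T_gt0 : 0 < T)
    (w0_H4 : sobolev 4 w0)
    (w0_cont : {within channel, continuous w0})
    (w0_rayleigh : local_rayleigh w0)
    (w_H4 : C0_sobolev 4 T w)
    (w_cont : forall t, 0 <= t <= T -> {within channel, continuous (w t)})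
    (w_sol : hydrostatic_euler T w0 w A)
    (w_rayleigh : forall t, 0 <= t <= T -> local_rayleigh (w t))
    (P_pressure : is_pressure T A P) :
  (forall t, 0 <= t <= T ->
     E1 w A t = integral2 (fun z => w t z * dx (w t) z / dy (w t) z)) /\
  (forall t, 0 <= t <= T ->
     E2 w A P t = integral2 (fun z =>
       (vel_u A t z) ^+ 2 * (w t z * dx (w t) z / dy (w t) z))) /\
  (forall t, 0 <= t < T ->
     [/\ derivable_t T (fun s => integral2 (fun z => ln (1 / dy (w s) z))) t /\
         E1 w A t = dt T (fun s => integral2 (fun z => ln (1 / dy (w s) z))) t,
         derivable_t T (E1 w A) t /\
         dt T (E1 w A) t =
           integral2 (fun z =>
             `|dx (vel_u A t) z - w t z * dx (w t) z / dy (w t) z| ^+ 2) &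
         derivable_t T (E2 w A P) t /\
         dt T (E2 w A P) t =
           integral2 (fun z =>
             `|derive1 (P t) z.1 + vel_u A t z *
                (dx (vel_u A t) z - w t z * dx (w t) z / dy (w t) z)| ^+ 2)]).
Proof.
split=> [t tT|]; first exact: (E1E T_gt0 w_H4 w_cont w_sol).
split=> [t tT|t /andP[t0 /ltW tT]]; first exact: (E2E T_gt0 w_H4 w_cont w_sol).
have t0T : 0 <= t <= T by rewrite t0 tT.
split; first exact: (dt_log T_gt0 w_H4 w_cont w_sol).
  exact: (dtE1 T_gt0 w_H4 w_cont w_sol).
exact: (dtE2 T_gt0 w_H4 w_cont w_sol).
Qed.
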